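(* Let $A=kQ/I_S$ be a graded homotopy path algebra over a field $k$. Then $A$ is Koszul if and only if its path poset $\operatorname{Path}_A$ is locally Cohen–Macaulay over $k$.
   Context: Let $Q$ be a finite quiver (loops and cycles allowed). Paths are concatenated left to right: for paths $p$ from $u$ to $v$ and $q$ from $v$ to $w$, $pq$ is the path from $u$ to $w$; $t(p)$, $h(p)$ denote tail and head, and $e_v$ the trivial path at $v$. A homotopy path algebra (HPA) is $A=kQ/I_S$ where $S$ is a set of pairs $(p,q)$ of paths with $t(p)=t(q)$, $h(p)=h(q)$, $I_S$ is the two-sided ideal generated by the $p-q$, $(p,q)\in S$, and $I_S$ is left and right cancellative: writing $p\sim q$ iff $p-q\in I_S$, $rp\sim rq$ implies $p\sim q$ and $pr\sim qr$ implies $p\sim q$. The HPA is graded if all pairs in $S$ consist of paths of equal length, so that $A$ is graded by path length. $A$ is Koszul if $A_0$ is semisimple and $A_0$ as a graded left $A$-module has a graded projective resolution $\cdots\to P^1\to P^0\to A_0$ with each $P^i$ generated in degree $i$. The path poset $\operatorname{Path}_A$ is the set of all paths of $Q$ (including trivial paths) modulo $\sim$, ordered by $p\le q$ iff $q\sim pr$ for some path $r$. A simplicial complex $\Delta$ is Cohen–Macaulay over $k$ if $\widetilde H_i(\operatorname{link}_\Delta(F);k)=0$ for all $F\in\Delta$ and $i<\dim\operatorname{link}_\Delta(F)$, where $\operatorname{link}_\Delta(F)=\{G\in\Delta: F\cup G\in\Delta, F\cap G=\emptyset\}$. A poset is locally Cohen–Macaulay if the order complex of each of its open intervals $(x,y)$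 is Cohen–Macaulay. *)

(* Defs.v *)
From HB Require Import structures.
From mathcomp Require Import all_boot all_order all_algebra.
From mathcomp Require Import boolp.
Set Implicit Arguments. Unset Strict Implicit. Unset Printing Implicit Defensive.
Import GRing.Theory.
Local Open Scope ring_scope.

(* Quivers and paths.  A quiver is given by finite types V (vertices)   *)
(* and E (arrows) with tail/head maps tl hd : E -> V.  A "path" is a    *)
(* pair (v, s) : V * seq E; it is a genuine path of Q when s is a       *)
(* composable sequence of arrows starting at v (s = [::] gives the      *)
(* trivial path e_v).  Concatenation is left to right.                  *)
Section Quiver.
Variables (V E : finType) (tl hd : E -> V).

Definition qpath := (V * seq E)%type.

Definition is_path (p : qpath) : bool :=
  if p.2 is a :: s then (tl a == p.1) && path (fun a b => hd a == tl b) a s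
  else true.

Definition ptail (p : qpath) : V := p.1.
Definition phead (p : qpath) : V := last p.1 (map hd p.2).
Definition plen (p : qpath) : nat := size p.2.

(* p then q, meaningful when phead p = ptail q *)
Definition pcat (p q : qpath) : qpath := (p.1, p.2 ++ q.2).
Definition composable (p q : qpath) : bool := phead p == ptail q.

End Quiver.

Section HPA.
Variables (k : fieldType) (V E : finType) (tl hd : E -> V).
Variable S : qpath V E -> qpath V E -> Prop.

Local Notation qp := (qpath V E).
Local Notation is_path := (is_path tl hd).
Local Notation phead := (phead hd).
Local Notation composable := (composable hd).

(* p ~ q  iff  p - q lies in the two-sided ideal I_S of kQ generated by *)
(* the p' - q', (p',q') in S.  An element of I_S is a finite sum        *)
(* sum_j c_j r_j (p'_j - q'_j) s_j  with paths r_j, s_j (general        *)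
(* elements of kQ expand bilinearly into such terms; terms with         *)
(* non-composable factors vanish).  Equality in kQ is compared           *)
(* coefficientwise on the path basis.                                   *)
Definition ideal_term := (k * qp * (qp * qp) * qp)%type.

Definition sim (p q : qp) : Prop :=
  is_path p /\ is_path q /\
  exists ts : seq ideal_term,
    (forall t, t \in ts ->
       let: (c, r, (p', q'), s) := t in
       [/\ S p' q', is_path r, is_path s, composable r p'
         & composable (pcat r p') s]) /\
    (forall x : qp,
       ((x == p)%:R - (x == q)%:R : k) =
       \sum_(t <- ts)
         (let: (c, r, (p', q'), s) := t in
          c * ((x == pcat (pcat r p') s)%:R - (x == pcat (pcat r q') s)%:R))).

Definition S_wf : Prop :=
  forall p q, S p q ->
    [/\ is_path p, is_path q, ptail p = ptail q & phead p = phead q].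

Definition S_graded : Prop := forall p q, S p q -> plen p = plen q.

Definition cancellative : Prop :=
  (forall r p q, is_path r -> is_path p -> is_path q ->
     composable r p -> composable r q ->
     sim (pcat r p) (pcat r q) -> sim p q) /\
  (forall r p q, is_path r -> is_path p -> is_path q ->
     composable p r -> composable q r ->
     sim (pcat p r) (pcat q r) -> sim p q).

Definition path_le (p q : qp) : Prop :=
  exists r, [/\ is_path r, composable p r & sim q (pcat p r)].

Definition path_lt (p q : qp) : Prop := path_le p q /\ ~ sim p q.

Definition enum_interval (x y : qp) (s : seq qp) : Prop :=
  [/\ (forall z, z \in s -> path_lt x z /\ path_lt z y),
      (forall i j, (i < size s)%N -> (j < size s)%N -> i != j ->
         ~ sim (nth x s i) (nth x s j))
    & (forall z, is_path z -> path_lt x z -> path_lt z y ->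
         exists2 w, w \in s & sim z w)].

Section Simplicial.
Variable n : nat.
Implicit Types (D : {set {set 'I_n}}) (F G : {set 'I_n}).

(* faces with exactly m vertices (dimension m-1) *)
Definition faces D m := [set F in D | #|F| == m].

(* incidence coefficient [F : G] for the oriented boundary, vertices of *)
(* F ordered increasingly: (-1)^(position of the removed vertex).       *)
Definition bcoef F G : k :=
  if G \subset F then
    if [pick x in F :\: G] is Some x then (-1) ^+ #|[set y in F | (y < x)%N]|
    else 0
  else 0.

(* boundary map C_{m-1} -> C_{m-2} (faces with m vertices to faces with *)
(* m-1 vertices), acting on row vectors; the reduced chain complex has   *)
(* C_{-1} = k spanned by the empty face.                                 *)
Definition bd D m : 'M[k]_(#|faces D m|, #|faces D m.-1|) :=
  \matrix_(a, b) bcoef (enum_val a) (enum_val b).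

(* dim_k of the reduced homology group H~_{m-1}(D; k) *)
Definition rhom_dim D m : nat :=
  (#|faces D m| - (if m is 0 then 0 else \rank (bd D m)) - \rank (bd D m.+1))%N.

Definition link D F := [set G in D | (F :|: G \in D) && [disjoint F & G]].

(* number of vertices of a largest face; dim D = maxsize D - 1 *)
Definition maxsize D : nat := \max_(G in D) #|G|.

(* H~_i(link F) = 0 for all i < dim link F, with i = m - 1 *)
Definition cohen_macaulay D : Prop :=
  forall F, F \in D -> forall m, (m < maxsize (link D F))%N ->
    rhom_dim (link D F) m = 0%N.

Definition order_complex (lt : 'I_n -> 'I_n -> Prop) : {set {set 'I_n}} :=
  [set F : {set 'I_n} |
    `[< forall x y, x \in F -> y \in F -> x != y -> lt x y \/ lt y x >]].

End Simplicial.

Definition locally_CM : Prop :=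
  forall x y : qp, is_path x -> is_path y ->
  forall s : seq qp, enum_interval x y s ->
    cohen_macaulay
      (order_complex (fun i j : 'I_(size s) =>
                        path_lt (nth x s i) (nth x s j))).

(* Graded left A-modules, A = kQ/I_S.  A graded module is a k-vector   *)
(* space M = (+)_{j in Z} M_j with a left kQ-action by the paths of Q  *)
(* (p acts M_j -> M_{j+|p|}, (p q).m = p.(q.m), sum_v e_v = 1) on which *)
(* I_S acts trivially (p and q act equally for (p,q) in S).            *)
Record gmod := GMod {
  gcar : lmodType k;
  ghom : int -> gcar -> Prop;
  gact : qp -> gcar -> gcar }.
Arguments ghom : clear implicits.
Arguments gact : clear implicits.

Definition is_gmod (M : gmod) : Prop :=
  (forall j, ghom M j 0 /\
     forall a u v, ghom M j u -> ghom M j v -> ghom M j (a *: u + v)) /\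
  (forall m : gcar M, exists c : seq (int * gcar M),
     [/\ uniq (map fst c), (forall t, t \in c -> ghom M t.1 t.2)
       & m = \sum_(t <- c) t.2]) /\
  (forall c : seq (int * gcar M), uniq (map fst c) ->
     (forall t, t \in c -> ghom M t.1 t.2) ->
     \sum_(t <- c) t.2 = 0 -> forall t, t \in c -> t.2 = 0) /\
  (forall p, is_path p -> forall a u v,
     gact M p (a *: u + v) = a *: gact M p u + gact M p v) /\
  (forall p j u, is_path p -> ghom M j u ->
     ghom M (j + (plen p)%:Z) (gact M p u)) /\
  (forall p q u, is_path p -> is_path q ->
     gact M p (gact M q u) = if composable p q then gact M (pcat p q) u else 0) /\
  (forall u, \sum_(v : V) gact M (v, [::]) u = u) /\
  (forall p q u, S p q -> gact M p u = gact M q u).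

Definition gmorph (M N : gmod) (f : gcar M -> gcar N) : Prop :=
  [/\ (forall a u v, f (a *: u + v) = a *: f u + f v),
      (forall j u, ghom M j u -> ghom N j (f u))
    & (forall p u, is_path p -> f (gact M p u) = gact N p (f u))].

Definition gprojective (P : gmod) : Prop :=
  forall (N N' : gmod) (g : gcar N -> gcar N') (f : gcar P -> gcar N'),
    is_gmod N -> is_gmod N' -> gmorph g -> (forall y, exists x, g x = y) ->
    gmorph f -> exists h : gcar P -> gcar N, gmorph h /\ forall u, g (h u) = f u.

Definition generated_in_degree (P : gmod) (i : nat) : Prop :=
  forall u : gcar P, exists c : seq (qp * gcar P),
    (forall t, t \in c -> is_path t.1 /\ ghom P i%:Z t.2) /\
    u = \sum_(t <- c) gact P t.1 t.2.

(* A_0 = A / A_+ = (+)_v k e_v as a graded left A-module, in degree 0 *)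
Definition A0_car : lmodType k := {ffun V -> k^o}.

Definition A0 : gmod :=
  @GMod A0_car (fun j f => j = 0 \/ f = 0)
    (fun p f => if p.2 is [::] then [ffun w => if w == p.1 then f w else 0]
                else 0).

Definition koszul : Prop :=
  exists (P : nat -> gmod) (eps : gcar (P 0%N) -> gcar A0)
         (d : forall i, gcar (P i.+1) -> gcar (P i)),
  (forall i, [/\ is_gmod (P i), gprojective (P i)
                & generated_in_degree (P i) i]) /\
  gmorph eps /\
  (forall i, gmorph (d i)) /\
  (forall a, exists u, eps u = a) /\
  (forall u, eps u = 0 <-> exists w, d 0%N w = u) /\
  (forall i (u : gcar (P i.+1)), d i u = 0 <-> exists w, d i.+1 w = u).

End HPA.

(* Main.v *)
From HB Require Import structures.
Require Import Defs.
From mathcomp Require Import boolp classical_sets functions.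
From mathcomp Require Import all_boot all_order all_algebra.
From mathcomp Require Import zify ring.
Set Implicit Arguments. Unset Strict Implicit. Unset Printing Implicit Defensive.
Import GRing.Theory.
Local Open Scope ring_scope.

(* Ext^n_A(A_0, A_0) is computed by the normalized bar complex, whose cochains are
   functions on composable lists of nontrivial paths.  In internal degree j this
   complex splits over the path classes r of length j, and sending a factorization of
   r to its partial products identifies the summand of r with the shifted reduced
   cochain complex of the order complex of the open interval (e, r).  Dimension
   shifting along a linear resolution shows that A is Koszul iff these groups vanish
   for j <> n; conversely, given the vanishing, each syzygy is generated in a single
   degree i and is covered by the projective A (x)_{A_0} (its part of degree i).
   By cancellation the interval (x, x r) is isomorphic to (e, r), so this amounts to
   vanishing below the top degree for all open intervals.  Links of faces are joins
   of smaller open intervals, and a Kuenneth argument extends the vanishing to them. *)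

(** * Paths modulo the relations *)

Section Walks.
Variables (V E : finType) (tl hd : E -> V).
Implicit Types (p q r : qpath V E).

(** [koszul] only asserts that some linear resolution exists, so Ext needs a description independent
    of the resolution: [acyc] speaks of bar cochains on an arbitrary submodule, and vanishing is
    passed from one syzygy to the next by chasing cochains. Modules may be infinite-dimensional, so
    complements and sections come from Zorn's lemma. Left cancellation makes [p |-> b p] injective
    on classes, which lets induced modules be modelled by finitely supported functions on classes,
    and it recovers the factors of [r] from their partial products. Lengths give the numerical
    match: a chain in the open interval from [x] to [x r] has at most [|r| - 1] vertices, and a
    factorization into arrows attains this bound, so vanishing below the top dimension is exactness
    at factorizations into [n < |r|] factors; [n > |r|] cannot occur, as each factor has positive
    length. Homology is traded for exactness of cochains by comparing ranks, and the orientation by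
    enumeration index for the one by the path order through a sign. *)

Fixpoint walk (v : V) (s : seq E) : bool :=
  if s is a :: s' then (tl a == v) && walk (hd a) s' else true.

(** The recursive form lets the start vertex vary in inductions over arrows. *)
Lemma is_pathE p : is_path tl hd p = walk p.1 p.2.
Proof.
case: p => v [|a s] //=; congr (_ && _).
elim: s a => //= b s IH a; by rewrite -IH eq_sym.
Qed.

Lemma walk_cat v s t :
  walk v (s ++ t) = walk v s && walk (last v (map hd s)) t.
Proof. by elim: s v => //= a s IH v; rewrite IH andbA. Qed.

Lemma pcatA p q r : pcat p (pcat q r) = pcat (pcat p q) r.
Proof. by rewrite /pcat /= catA. Qed.

Lemma pcat_id p v : pcat p (v, [::]) = p.
Proof. by case: p => w s; rewrite /pcat /= cats0. Qed.

Lemma id_pcat p v : ptail p = v -> pcat (v, [::]) p = p.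
Proof. by case: p => w s /= ->. Qed.

Lemma plen_pcat p q : plen (pcat p q) = (plen p + plen q)%N.
Proof. by rewrite /plen size_cat. Qed.

Lemma ptail_pcat p q : ptail (pcat p q) = ptail p.
Proof. by []. Qed.

Lemma phead_pcat p q : composable hd p q -> phead hd (pcat p q) = phead hd q.
Proof.
by case: p q => v s [w t] /eqP; rewrite /phead /= map_cat last_cat => ->.
Qed.

Lemma is_path_pcat p q : composable hd p q ->
  is_path tl hd (pcat p q) = is_path tl hd p && is_path tl hd q.
Proof. case: p q => v s [w t] /eqP h; rewrite !is_pathE /= walk_cat.
by rewrite (h : last v _ = w).
Qed.

Lemma composable_pcatl p q r : composable hd p q ->
  composable hd (pcat p q) r = composable hd q r.
Proof. by move=> h; rewrite /composable phead_pcat. Qed.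

End Walks.

Section Sim.
Variables (k : fieldType) (V E : finType) (tl hd : E -> V).
Variable S : qpath V E -> qpath V E -> Prop.
Local Notation qp := (qpath V E).
Local Notation is_path := (is_path tl hd).
Local Notation phead := (phead hd).
Local Notation composable := (composable hd).
Local Notation sim := (sim k tl hd S).
Implicit Types (p q r s : qp).

Lemma sim_pathl p q : sim p q -> is_path p. Proof. by case. Qed.
Lemma sim_pathr p q : sim p q -> is_path q. Proof. by case=> _ []. Qed.

Lemma sim_refl p : is_path p -> sim p p.
Proof.
move=> hp; split=> //; split=> //; exists [::]; split=> // x.
by rewrite big_nil subrr.
Qed.

Lemma sim_sym p q : sim p q -> sim q p.
Proof.
case=> hp [hq [ts [H1 H2]]]; split=> //; split=> //.
exists [seq (let: (c, r, pq, s) := t in (- c, r, pq, s)) | t <- ts]; split.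
  move=> t /mapP [[[[c r] [p' q']] s]] ht ->.
  exact: (H1 _ ht).
move=> x; rewrite big_map -[LHS]opprB H2 -sumrN; apply: eq_bigr.
by move=> [[[c r] [p' q']] s] _; rewrite mulNr.
Qed.

Lemma sim_trans p q r : sim p q -> sim q r -> sim p r.
Proof.
case=> hp [hq [ts [H1 H2]]] [_ [hr [ts' [H1' H2']]]]; split=> //; split=> //.
exists (ts ++ ts'); split.
  by move=> t; rewrite mem_cat => /orP [/H1|/H1'].
by move=> x; rewrite big_cat /= -H2 -H2' addrA subrK.
Qed.

Lemma sim_gen r p q s : is_path p -> is_path q -> S p q ->
  ptail p = ptail q -> phead p = phead q ->
  is_path r -> is_path s ->
  composable r p -> composable (pcat r p) s ->
  sim (pcat (pcat r p) s) (pcat (pcat r q) s).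
Proof.
move=> hp hq Spq Et Eh hr hs c1 c2.
have c1' : composable r q by rewrite /composable -Et.
have c2' : composable (pcat r q) s.
  by move: c2; rewrite !composable_pcatl // /composable Eh.
split; first by rewrite !is_path_pcat // hr hp hs.
split; first by rewrite !is_path_pcat // hr hq hs.
exists [:: (1, r, (p, q), s)]; split.
  by move=> t; rewrite inE => /eqP ->.
by move=> x; rewrite big_seq1 mul1r.
Qed.

(* The coefficientwise identity defining [sim] survives any map from paths to a vector space. *)
Lemma formal_eval (W : lmodType k) (phi : qp -> W) p q (ts : seq (ideal_term k V E)) :
  (forall x : qp,
       ((x == p)%:R - (x == q)%:R : k) =
       \sum_(t <- ts)
         (let: (c, r, (p', q'), s) := t in
          c * ((x == pcat (pcat r p') s)%:R - (x == pcat (pcat r q') s)%:R))) ->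
  phi p - phi q = \sum_(t <- ts)
         (let: (c, r, (p', q'), s) := t in
          c *: (phi (pcat (pcat r p') s) - phi (pcat (pcat r q') s))).
Proof.
move=> H.
(* A finite list containing every path that occurs, so that the identity, given one [x] at a time,
   can be summed against [phi x]. *)
pose L := undup ([:: p; q] ++ flatten [seq (let: (c, r, (p', q'), s) := t in
   [:: pcat (pcat r p') s; pcat (pcat r q') s]) | t <- ts]).
have ev z : z \in L -> phi z = \sum_(x <- L) (x == z)%:R *: phi x.
  move=> hz; rewrite (bigD1_seq z) ?undup_uniq //= eqxx scale1r big1 ?addr0 //.
  by move=> x /negPf ->; rewrite scale0r.
have evB z z' : z \in L -> z' \in L ->
    phi z - phi z' = \sum_(x <- L) ((x == z)%:R - (x == z')%:R) *: phi x.
  move=> hz hz'; rewrite (ev z) // (ev z') // -sumrB; apply: eq_bigr => x _.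
  by rewrite scalerBl.
rewrite evB; try by rewrite mem_undup !inE eqxx ?orbT.
under eq_bigr do rewrite H scaler_suml.
rewrite exchange_big /= big_seq [RHS]big_seq; apply: eq_bigr.
move=> [[[c r] [p' q']] s] ht.
rewrite evB ?scaler_sumr; first by apply: eq_bigr => x _; rewrite scalerA.
all: rewrite mem_undup mem_cat; apply/orP; right; apply/flattenP.
all: exists [:: pcat (pcat r p') s; pcat (pcat r q') s]; last by rewrite !inE eqxx ?orbT.
all: by apply/mapP; exists (c, r, (p', q'), s).
Qed.

Lemma sim_eval (W : lmodType k) (phi : qp -> W) p q :
  (forall r p' q' s, S p' q' -> is_path r -> is_path s -> composable r p' ->
     composable (pcat r p') s ->
     phi (pcat (pcat r p') s) = phi (pcat (pcat r q') s)) ->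
  sim p q -> phi p = phi q.
Proof.
move=> Hphi [_ [_ [ts [H1 H2]]]]; apply/eqP; rewrite -subr_eq0.
rewrite (formal_eval phi H2) big_seq big1 // => -[[[c r] [p' q']] s] /H1 [h1 h2 h3 h4 h5].
by rewrite (Hphi _ _ _ _ h1 h2 h3 h4 h5) subrr scaler0.
Qed.

(** Membership in the ideal is a linear condition, not an inductive one. Evaluating it on the
    indicator function of [P] with values in [k] yields induction along elementary replacements,
    because [1 != 0] in [k]. *)
Lemma sim_ind (P : qp -> Prop) p q :
  (forall r p' q' s, S p' q' -> is_path r -> is_path s -> composable r p' ->
     composable (pcat r p') s ->
     P (pcat (pcat r p') s) <-> P (pcat (pcat r q') s)) ->
  sim p q -> P p -> P q.
Proof.
move=> HP h Pp.
have := @sim_eval k^o (fun x => (`[<P x>])%:R) p q _ h.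
rewrite (asboolT Pp); case: (pselect (P q)) => // nP; rewrite (asboolF nP) => H.
have /eqP : (1 : k) = 0.
  apply: H => r p' q' s h1 h2 h3 h4 h5.
  by rewrite (propext (HP _ _ _ _ h1 h2 h3 h4 h5)).
by rewrite oner_eq0.
Qed.

Hypotheses (Swf : S_wf tl hd S) (Sgr : S_graded S).

Lemma sim_inv p q : sim p q ->
  [/\ ptail p = ptail q, phead p = phead q & plen p = plen q].
Proof.
move=> h.
have : (fun x => [/\ ptail p = ptail x, phead p = phead x & plen p = plen x]) q.
  apply: (@sim_ind (fun x => [/\ ptail p = ptail x, phead p = phead x & plen p = plen x]) p) => //.
  move=> r p' q' s Spq hr hs c1 c2.
  have [hp hq Et Eh] := Swf Spq; have El := Sgr Spq.
  have c1' : composable r q' by rewrite /composable -Et.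
  have c2' : composable (pcat r q') s.
    by move: c2; rewrite !composable_pcatl // /composable Eh.
  by rewrite !ptail_pcat !phead_pcat // !plen_pcat El.
by [].
Qed.

Lemma sim_tail p q : sim p q -> ptail p = ptail q. Proof. by case/sim_inv. Qed.
Lemma sim_head p q : sim p q -> phead p = phead q. Proof. by case/sim_inv. Qed.
Lemma sim_len p q : sim p q -> plen p = plen q. Proof. by case/sim_inv. Qed.

Lemma sim_catl r p q : is_path r -> composable r p -> sim p q ->
  sim (pcat r p) (pcat r q).
Proof.
move=> hr hc h.
(* The condition on tails keeps [r] composable with every intermediate path. *)
apply: (@sim_ind (fun x => ptail x = ptail p -> sim (pcat r p) (pcat r x)) p) => //.
- move=> r' p' q' s Spq hr' hs c1 c2; have [hp' hq' Et Eh] := Swf Spq.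
  rewrite !ptail_pcat.
  suff H : ptail r' = ptail p ->
     sim (pcat r (pcat (pcat r' p') s)) (pcat r (pcat (pcat r' q') s)).
    by split=> G e; [apply: sim_trans (G e) (H e)|apply: sim_trans (G e) (sim_sym (H e))].
  move=> e; have cr : composable r r' by rewrite /composable e.
  rewrite !pcatA -!(pcatA r r'); rewrite !pcatA.
  by apply: sim_gen; rewrite // ?is_path_pcat ?hr // ?composable_pcatl //;
     move: c2; rewrite !composable_pcatl.
- by move=> _; apply: sim_refl; rewrite is_path_pcat // hr (sim_pathl h).
- by rewrite (sim_tail h).
Qed.

Lemma sim_catr r p q : is_path r -> composable p r -> sim p q ->
  sim (pcat p r) (pcat q r).
Proof.
move=> hr hc h.
apply: (@sim_ind (fun x => phead x = phead p -> sim (pcat p r) (pcat x r)) p) => //.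
- move=> r' p' q' s Spq hr' hs c1 c2; have [hp' hq' Et Eh] := Swf Spq.
  have c1' : composable r' q' by rewrite /composable -Et.
  have c2' : composable (pcat r' q') s.
    by move: c2; rewrite !composable_pcatl // /composable Eh.
  rewrite !phead_pcat //.
  suff H : phead s = phead p ->
     sim (pcat (pcat (pcat r' p') s) r) (pcat (pcat (pcat r' q') s) r).
    by split=> G e; [apply: sim_trans (G e) (H e)|apply: sim_trans (G e) (sim_sym (H e))].
  move=> e; have cr : composable s r by rewrite /composable e.
  rewrite -(pcatA _ s r) -(pcatA (pcat r' q') s r).
  by apply: sim_gen; rewrite // ?is_path_pcat ?hs.
- by move=> _; apply: sim_refl; rewrite is_path_pcat // hr (sim_pathl h).
- by rewrite (sim_head h).
Qed.

Lemma sim_cat p p' q q' : composable p q -> sim p p' -> sim q q' ->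
  sim (pcat p q) (pcat p' q').
Proof.
move=> c hp hq; apply: (sim_trans (sim_catl (sim_pathl hp) c hq)).
apply: sim_catr => //; first exact: sim_pathr hq.
by move: c; rewrite /composable (sim_tail hq).
Qed.

End Sim.

(** * Linear projections *)

Section Subspaces.
Variable k : fieldType.

Section LinearMaps.
Variables (V W : lmodType k) (g : V -> W).
Hypothesis gl : forall a u v, g (a *: u + v) = a *: g u + g v.

Lemma lin0 : g 0 = 0.
Proof. by have := gl (-1) 0 0; rewrite scaler0 addr0 scaleN1r addNr. Qed.
Lemma linD u v : g (u + v) = g u + g v.
Proof. by have := gl 1 u v; rewrite !scale1r. Qed.
Lemma linZ a u : g (a *: u) = a *: g u.
Proof. by have := gl a u 0; rewrite lin0 !addr0. Qed.
Lemma linB u v : g (u - v) = g u - g v.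
Proof. by rewrite linD -scaleN1r linZ scaleN1r. Qed.
Lemma lin_sum (I : Type) (r : seq I) (P : pred I) (F : I -> V) :
  g (\sum_(i <- r | P i) F i) = \sum_(i <- r | P i) g (F i).
Proof. by apply: (big_morph g); [apply: linD|apply: lin0]. Qed.

End LinearMaps.

Definition subspace (V : lmodType k) (U : V -> Prop) : Prop :=
  U 0 /\ forall a u v, U u -> U v -> U (a *: u + v).

Section Theory.
Variables (V : lmodType k) (U : V -> Prop) (HU : subspace U).

Lemma subspace0 : U 0. Proof. by case: HU. Qed.
Lemma subspaceD u v : U u -> U v -> U (u + v).
Proof. by move=> hu hv; rewrite -[u]scale1r; apply: HU.2. Qed.
Lemma subspaceZ a u : U u -> U (a *: u).
Proof. by move=> hu; rewrite -[_ *: _]addr0; apply: HU.2 => //; apply: subspace0. Qed.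
Lemma subspaceN u : U u -> U (- u).
Proof. by rewrite -scaleN1r; apply: subspaceZ. Qed.
Lemma subspaceB u v : U u -> U v -> U (u - v).
Proof. by move=> hu hv; apply: subspaceD => //; apply: subspaceN. Qed.
Lemma subspace_sum (I : Type) (r : seq I) (P : pred I) (F : I -> V) :
  (forall i, P i -> U (F i)) -> U (\sum_(i <- r | P i) F i).
Proof. by move=> h; apply: big_ind => //; [exact: subspace0|exact: subspaceD]. Qed.
Lemma subspace_sum_seq (I : eqType) (r : seq I) (P : pred I) (F : I -> V) :
  (forall i, i \in r -> P i -> U (F i)) -> U (\sum_(i <- r | P i) F i).
Proof.
by move=> h; rewrite big_seq_cond; apply: subspace_sum => i /andP [] ; apply: h.
Qed.

(** Zorn's lemma gives a maximal subspace [C] meeting [U] only in 0, and maximality forces it to be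
    a complement; [rho] is the projection along [C]. *)
Lemma projection_exists : exists rho : V -> V,
  [/\ (forall a u v, rho (a *: u + v) = a *: rho u + rho v),
      (forall v, U (rho v)) & (forall u, U u -> rho u = u)].
Proof.
pose P (C : set V) := (forall a u v, C u -> C v -> C (a *: u + v)) /\
                      (forall u, C u -> U u -> u = 0).
have [C [[Clin CU] Cmax]] : exists C, P C /\ forall B, (C `<` B)%classic -> ~ P B.
  apply: Zorn_bigcup => F FP Ftot; split.
    move=> a u v [X FX Xu] [Y FY Yv].
    have [XY|YX] := Ftot _ _ FX FY.
      by exists Y => //; apply: (FP Y FY).1 => //; apply: XY.
    by exists X => //; apply: (FP X FX).1 => //; apply: YX.
  by move=> u [X FX Xu]; apply: (FP X FX).2.
(* The empty set satisfies [P], so membership of 0 has to come from maximality. *)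
have C0 : C 0.
  apply: contrapT => nC0; apply: (Cmax [set 0]%classic).
    split=> [x Cx|/(_ 0 erefl) //].
    by case: nC0; rewrite -[0](addNr x) -scaleN1r; apply: Clin.
  by split=> [a u v -> ->|u ->] //=; rewrite scaler0 addr0.
have dec v : exists u, U u /\ C (v - u).
  apply: contrapT => nv.
  pose B : set V := fun w : V => exists c a, C c /\ w = c + a *: v.
  apply: (Cmax B).
    split; first by move=> c Cc; exists c, 0; rewrite scale0r addr0.
    move=> BC; apply: nv; exists 0; split; first exact: subspace0.
    by rewrite subr0; apply: BC; exists 0, 1; rewrite add0r scale1r.
  split.
    move=> a _ _ [c [b [Cc ->]]] [c' [b' [Cc' ->]]].
    exists (a *: c + c'), (a * b + b'); split; first exact: Clin.
    by rewrite scalerDr scalerDl -scalerA addrACA.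
  move=> _ [c [a [Cc ->]]] Uw.
  have [a0|a0] := eqVneq a 0.
    by move: Uw; rewrite a0 scale0r addr0; apply: CU.
  case: nv; exists (a^-1 *: (c + a *: v)); split; first exact: subspaceZ.
  rewrite scalerDr scalerA mulVf // scale1r opprD addrCA subrr addr0 -scaleNr.
  by rewrite -[_ *: c]addr0; apply: Clin.
have /choice [rho rhoP] := dec.
have uniq v u : U u -> C (v - u) -> rho v = u.
  move=> Uu Cu; have [Ur Cr] := rhoP v; apply/eqP; rewrite -subr_eq0; apply/eqP.
  apply: CU; last exact: subspaceB.
  have -> : rho v - u = (-1) *: (v - rho v) + (v - u).
    by rewrite scaleN1r opprB addrA subrK.
  exact: Clin.
exists rho; split=> [a u v|v|u Uu]; last by apply: uniq; rewrite ?subrr.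
  have [U1 C1] := rhoP u; have [U2 C2] := rhoP v.
  apply: uniq; first by apply: HU.2.
  by rewrite opprD addrACA -scalerBr; apply: Clin.
by case: (rhoP v).
Qed.

End Theory.

(** Preimages in [A] are chosen arbitrarily and their kernel components removed: two preimages of
    one vector differ by an element of [K], so [v - rho v] does not depend on the choice, and this
    gives linearity. *)
Lemma linear_on_section (V W : lmodType k) (g : V -> W) (A : V -> Prop) (B : W -> Prop) :
  (forall a u v, g (a *: u + v) = a *: g u + g v) ->
  subspace A -> subspace B -> (forall w, B w -> exists2 v, A v & g v = w) ->
  exists s : W -> V,
    [/\ (forall a w w', B w -> B w' -> s (a *: w + w') = a *: s w + s w'),
        (forall w, B w -> A (s w)) & (forall w, B w -> g (s w) = w)].
Proof.
move=> gl HA HB sur.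
have g0 := lin0 gl.
pose K v := A v /\ g v = 0.
have HK : subspace K.
  split; first by split; [apply: subspace0|].
  move=> a u v [Au gu] [Av gv]; split; first exact: HA.2.
  by rewrite gl gu gv scaler0 addr0.
have [rho [rl rK rid]] := projection_exists HK.
have gB := linB gl; have rB := linB rl.
have /choice [s sP] : forall w, exists v, B w -> A v /\ g v = w.
  move=> w; case: (pselect (B w)) => [/sur [v Av gv]|nB]; first by exists v.
  by exists 0.
exists (fun w => s w - rho (s w)); split.
- move=> a w w' Bw Bw'; have [A1 g1] := sP _ Bw; have [A2 g2] := sP _ Bw'.
  have [A3 g3] := sP _ (HB.2 a _ _ Bw Bw').
  set x := s (_ + _) in A3 g3 *; set y := a *: s w + s w'.
  have Kxy : K (x - y).
    split; first by apply: subspaceB => //; apply: HA.2.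
    by rewrite gB g3 gl g1 g2 subrr.
  have E := rid _ Kxy; rewrite rB in E.
  have -> : x - rho x = y - rho y.
    apply/eqP; rewrite -subr_eq0 opprD opprK addrACA -E.
    by rewrite [- rho x + _]addrC addrA subrK subrr.
  by rewrite /y rl scalerBr opprD addrACA.
- move=> w Bw; have [A1 g1] := sP _ Bw.
  by apply: subspaceB => //; case: (rK (s w)).
- move=> w Bw; have [A1 g1] := sP _ Bw.
  by rewrite gB g1; case: (rK (s w)) => _ ->; rewrite subr0.
Qed.

(** With [rho] a projection onto [U], the vector [w = v - rho v] is non-zero, and [f x] is the
    coordinate of [x - rho x] along [w]. *)
Lemma separating_functional (V : lmodType k) (U : V -> Prop) v : subspace U -> ~ U v -> exists f : V -> k,
  [/\ (forall a x y, f (a *: x + y) = a * f x + f y),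
      (forall u, U u -> f u = 0) & f v = 1].
Proof.
move=> HU nUv; have [rho [rl rU rid]] := projection_exists HU.
pose w := v - rho v.
have w0 : w != 0 by apply/negP; rewrite subr_eq0 => /eqP E; apply: nUv; rewrite E.
have scal_inj a b : a *: w = b *: w -> a = b.
  move=> /eqP; rewrite -subr_eq0 -scalerBl scaler_eq0 (negPf w0) orbF subr_eq0.
  by move/eqP.
pose L (x : V) := exists a, x = a *: w.
have LL : subspace L.
  split; first by exists 0; rewrite scale0r.
  by move=> a _ _ [b ->] [c ->]; exists (a * b + c); rewrite scalerDl scalerA.
have [sg [sl sL sid]] := projection_exists LL.
have /choice [f fP] : forall x, exists a, sg x = a *: w := sL.
have rhoU u : U u -> u - rho u = 0 by move=> /rid ->; rewrite subrr.
have s0 : sg 0 = 0 by apply: sid; apply: subspace0.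
exists (fun x => f (x - rho x)); split.
- move=> a x y; apply: scal_inj; rewrite scalerDl -scalerA -!fP -sl; congr sg.
  by rewrite rl scalerBr opprD addrACA.
- by move=> u /rhoU ->; apply: scal_inj; rewrite -fP s0 scale0r.
- apply: scal_inj; rewrite -fP -/w scale1r; apply: sid.
  by exists 1; rewrite scale1r.
Qed.



End Subspaces.

(** * The bar complex *)

Section Merge.
Variables (V E : finType) (k : fieldType).
Local Notation qp := (qpath V E).
Implicit Types (l m : seq qp) (F G : seq qp -> k).

(** These are the lists on which [mrg F l] evaluates [F], so hypotheses on [F] are only asked
    there. *)
Fixpoint merges l : seq (seq qp) :=
  if l is b :: t then
    if t is c :: l' then (pcat c b :: l') :: [seq b :: m | m <- merges t]
    else [::]
  else [::].

(* The alternating sum of [F] over [merges l]. *)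
Fixpoint mrg F l : k :=
  if l is b :: t then
    if t is c :: l' then F (pcat c b :: l') - mrg (fun m => F (b :: m)) t
    else 0
  else 0.

Lemma merges2 b c l :
  merges [:: b, c & l] = (pcat c b :: l) :: [seq b :: m | m <- merges (c :: l)].
Proof. by []. Qed.

Lemma mrg2 F b c l :
  mrg F [:: b, c & l] = F (pcat c b :: l) - mrg (fun m => F (b :: m)) (c :: l).
Proof. by []. Qed.

Lemma mrg1 F b : mrg F [:: b] = 0. Proof. by []. Qed.

Lemma merges_size l m : m \in merges l -> size l = (size m).+1.
Proof.
elim: l m => // b [|c l] IH m //; rewrite merges2 inE => /orP [/eqP -> //|].
by case/mapP => m' /IH /= -> ->.
Qed.

Lemma eq_mrg F G l : (forall m, m \in merges l -> F m = G m) -> mrg F l = mrg G l.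
Proof.
elim: l F G => // b [|c l] IH F G // H; rewrite !mrg2 H ?inE ?eqxx //.
congr (_ - _); apply: IH => m hm; apply: H.
by rewrite merges2 inE map_f ?orbT.
Qed.

Lemma mrg_lin a F G l : mrg (fun m => a * F m + G m) l = a * mrg F l + mrg G l.
Proof.
elim: l F G => [|b [|c l] IH] F G; rewrite ?mrg1 ?mulr0 ?addr0 //.
by rewrite !mrg2 IH mulrBr opprD addrACA.
Qed.

Lemma mrg0 l : mrg (fun=> 0) l = 0.
Proof. by elim: l => // b [|c l] // IH; rewrite mrg2 IH subr0. Qed.

Lemma mrg_sum (I : Type) (r : seq I) (P : pred I) (F : I -> seq qp -> k) l :
  mrg (fun m => \sum_(i <- r | P i) F i m) l = \sum_(i <- r | P i) mrg (F i) l.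
Proof.
elim: r => [|i r IH].
  by rewrite big_nil -[RHS](mrg0 l); apply: eq_mrg => m _; rewrite big_nil.
rewrite big_cons -IH; case: (boolP (P i)) => hP; last first.
  by apply: eq_mrg => m _; rewrite big_cons (negPf hP).
rewrite -[mrg (F i) l]mul1r -mrg_lin; apply: eq_mrg => m _.
by rewrite big_cons hP mul1r.
Qed.

Lemma mrgN F l : mrg (fun m => - F m) l = - mrg F l.
Proof.
rewrite -[RHS]addr0 -[in RHS](mrg0 l) -mulN1r -mrg_lin.
by apply: eq_mrg => m _; rewrite mulN1r addr0.
Qed.

Lemma mrgB F G l : mrg (fun m => F m - G m) l = mrg F l - mrg G l.
Proof.
rewrite -mrgN -[mrg F l]mul1r -mrg_lin.
by apply: eq_mrg => m _; rewrite mul1r.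
Qed.

Lemma mrg_mrg F l : mrg (mrg F) l = 0.
Proof.
elim: l F => // b [|c [|d l]] IH F //.
  by rewrite mrg2 !mrg1 subr0.
rewrite mrg2 mrg2 pcatA.
(* The induction hypothesis for [F (b :: _)] removes from [mrg F (b :: m)] every term but the merge
   that involves [b]; the rest cancels by associativity of concatenation. *)
have -> : mrg (fun m => mrg F (b :: m)) [:: c, d & l] =
   mrg (fun m => if m is c' :: m' then F (pcat c' b :: m') else 0) [:: c, d & l].
  rewrite -[RHS]subr0 -[in RHS](IH (fun m => F (b :: m))) -mrgB.
  by apply: eq_mrg => -[/merges_size //|c' m] _.
by rewrite mrg2 subrr.
Qed.
End Merge.

Arguments mrg : simpl never.

Section Chains.
Variables (k : fieldType) (V E : finType) (tl hd : E -> V).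
Variable S : qpath V E -> qpath V E -> Prop.
Local Notation qp := (qpath V E).
Local Notation is_path := (is_path tl hd).
Local Notation phead := (phead hd).
Local Notation composable := (composable hd).
Local Notation sim := (sim k tl hd S).
Hypotheses (Swf : S_wf tl hd S) (Sgr : S_graded S).
Implicit Types (p q r : qp) (l m : seq qp).

Definition lhead l : option V := if l is b :: _ then Some (phead b) else None.
Definition ltail0 (o : option V) (v : V) := if o is Some w then w == v else true.

(* [b1; ...; bn] stands for the composable product bn ... b1: the factor that acts
   first on a left module comes first. *)
Fixpoint okl l : bool :=
  if l is b :: l' then
    [&& is_path b, (0 < plen b)%N, ltail0 (lhead l') (ptail b) & okl l']
  else true.

Lemma okl_cons b l : okl (b :: l) =
  [&& is_path b, (0 < plen b)%N, ltail0 (lhead l) (ptail b) & okl l].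
Proof. by []. Qed.

Definition tlen l : nat := sumn [seq plen b | b <- l].

Fixpoint lprod b l : qp := if l is c :: l' then pcat (lprod c l') b else b.

Fixpoint lsim l m : Prop :=
  match l, m with
  | [::], [::] => True
  | b :: l', c :: m' => sim b c /\ lsim l' m'
  | _, _ => False
  end.

Lemma lsim_refl l : okl l -> lsim l l.
Proof.
by elim: l => //= b l IH /and4P [h _ _ /IH]; split => //; apply: sim_refl.
Qed.

Lemma lsim_sym l m : lsim l m -> lsim m l.
Proof. by elim: l m => [|b l IH] [|c m] //= [/sim_sym h /IH]. Qed.

Lemma lsim_head l m : lsim l m -> lhead l = lhead m.
Proof. by case: l m => [|b l] [|c m] //= [/(sim_head Swf Sgr) ->]. Qed.

Lemma lsim_tlen l m : lsim l m -> tlen l = tlen m.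
Proof.
elim: l m => [|b l IH] [|c m] //= [/(sim_len Swf Sgr) h /IH].
by rewrite /tlen /= h => ->.
Qed.

Lemma lsim_okl l m : lsim l m -> okl l -> okl m.
Proof.
elim: l m => [|b l IH] [|c m] //= [h hl] /and4P [h1 h2 h3 h4].
rewrite (sim_pathr h) -(sim_len Swf Sgr h) h2 -(lsim_head hl) -(sim_tail Swf Sgr h) h3.
exact: IH.
Qed.

Lemma okl_path b l : okl (b :: l) -> is_path b. Proof. by rewrite !okl_cons => /and4P []. Qed.
Lemma okl_pos b l : okl (b :: l) -> (0 < plen b)%N. Proof. by rewrite !okl_cons => /and4P []. Qed.
Lemma okl_tl b l : okl (b :: l) -> okl l. Proof. by rewrite !okl_cons => /and4P []. Qed.
Lemma okl_comp b c l : okl [:: b, c & l] -> composable c b.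
Proof. by rewrite !okl_cons => /and4P []. Qed.

Lemma tlen_cons b l : tlen (b :: l) = (plen b + tlen l)%N. Proof. by []. Qed.

Lemma size_tlen l : okl l -> (size l <= tlen l)%N.
Proof.
elim: l => // b l IH h; rewrite tlen_cons /=.
by have := okl_pos h; have := IH (okl_tl h); lia.
Qed.

Lemma okl_merge b c l : okl [:: b, c & l] -> okl (pcat c b :: l).
Proof.
move=> h; have cb := okl_comp h; move: h; rewrite !okl_cons.
case/and4P => hb b0 _ /and4P [hc c0 hl hl'].
by rewrite is_path_pcat // hc hb plen_pcat addn_gt0 c0 hl' ptail_pcat hl.
Qed.

Lemma mergesP l m : okl l -> m \in merges l ->
  [/\ okl m, lhead m = lhead l & tlen m = tlen l].
Proof.
elim: l m => // b [|c l] IH m // h; rewrite merges2 inE => /orP [/eqP ->|].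
  split; first exact: okl_merge.
    by rewrite /= phead_pcat // (okl_comp h).
  by rewrite !tlen_cons plen_pcat addnCA addnA.
case/mapP => m' hm' ->.
have [o1 o2 o3] := IH _ (okl_tl h) hm'.
split=> //; last by rewrite !tlen_cons o3.
by move/and4P: h => [h1 h2 h3 _]; rewrite okl_cons h1 h2 o2 h3.
Qed.

Lemma merges_lprod b l m : m \in merges (b :: l) ->
  exists b' m', m = b' :: m' /\ lprod b' m' = lprod b l.
Proof.
elim: l b m => // c l IH b m; rewrite merges2 inE => /orP [/eqP ->|].
  exists (pcat c b), l; split=> //; case: l {IH} => //= d l.
  by rewrite pcatA.
case/mapP => m' /IH [b' [m'' [-> e]]] ->; exists b, (b' :: m''); split=> //.
by rewrite /= e.
Qed.

(** Two functions are compared, so that the induction can pass to [F (b :: _)] and [G (b' :: _)],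
    whose first entries are equivalent but different. *)
Lemma mrg_lsim (F G : seq qp -> k) l l' : okl l -> lsim l l' ->
  (forall m m', m \in merges l -> lsim m m' -> F m = G m') -> mrg F l = mrg G l'.
Proof.
elim: l l' F G => [|b l IH] [|b' l'] F G //.
case: l l' IH => [|c l] [|c' l'] IH //; try by move=> ? [].
move=> ok [hb hl] H; rewrite !mrg2; congr (_ - _).
  apply: H; first by rewrite merges2 inE eqxx.
  case: hl => hc hl; split=> //; apply: sim_cat => //; exact: okl_comp ok.
apply: IH => // [|m m' hm hs]; first exact: okl_tl ok.
by apply: H; rewrite // merges2 inE map_f ?orbT.
Qed.

Lemma lprod_ok b l : okl (b :: l) ->
  [/\ is_path (lprod b l), phead (lprod b l) = phead b &
      plen (lprod b l) = tlen (b :: l)].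
Proof.
elim: l b => [|c l IH] b h.
  by rewrite /= (okl_path h) tlen_cons addn0.
have [h1 h2 h3] := IH _ (okl_tl h).
have cc : composable (lprod c l) b by rewrite /composable h2; apply: okl_comp h.
rewrite [lprod _ _]/=; split; first by rewrite is_path_pcat // h1 (okl_path h).
  by rewrite phead_pcat.
by rewrite plen_pcat h3 addnC -tlen_cons.
Qed.

Lemma lprod_comp b c l : okl [:: b, c & l] -> composable (lprod c l) b.
Proof.
move=> h; have [_ h2 _] := lprod_ok (okl_tl h).
by rewrite /composable h2; apply: okl_comp h.
Qed.

End Chains.

(** * Graded modules *)

Section Modules.
Variables (k : fieldType) (V E : finType) (tl hd : E -> V).
Variable S : qpath V E -> qpath V E -> Prop.
Local Notation qp := (qpath V E).
Local Notation is_path := (is_path tl hd).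
Local Notation phead := (phead hd).
Local Notation composable := (composable hd).
Local Notation sim := (sim k tl hd S).
Local Notation gmod := (gmod k V E).
Local Notation is_gmod := (is_gmod tl hd S).
Local Notation hom M := (@ghom _ _ _ M).
Hypotheses (Swf : S_wf tl hd S) (Sgr : S_graded S).
Implicit Types (p q r : qp) (l m : seq qp) (M : gmod).

Section OneModule.
Variables (M : gmod) (HM : is_gmod M).
Implicit Types (u : gcar M).

Lemma hom_sub j : subspace (hom M j).
Proof. by case: HM => h _; case: (h j). Qed.

Lemma hom_dec u : exists c : seq (int * gcar M),
     [/\ uniq (map fst c), (forall t, t \in c -> hom M t.1 t.2)
       & u = \sum_(t <- c) t.2].
Proof. by case: HM => _ [h _]. Qed.

Lemma hom_indep (c : seq (int * gcar M)) : uniq (map fst c) ->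
     (forall t, t \in c -> hom M t.1 t.2) ->
     \sum_(t <- c) t.2 = 0 -> forall t, t \in c -> t.2 = 0.
Proof. by case: HM => _ [_ [h _]]; apply: h. Qed.

Lemma act_lin p : is_path p -> forall a u v,
  gact p (a *: u + v) = a *: gact p u + gact p v.
Proof. by case: HM => _ [_ [_ [h _]]]; apply: h. Qed.

Lemma act_hom p j u : is_path p -> hom M j u ->
     hom M (j + (plen p)%:Z) (gact p u).
Proof. by case: HM => _ [_ [_ [_ [h _]]]]; apply: h. Qed.

Lemma act_act p q u : is_path p -> is_path q ->
     gact p (gact q u) = if composable p q then gact (pcat p q) u else 0.
Proof. by case: HM => _ [_ [_ [_ [_ [h _]]]]]; apply: h. Qed.

Lemma act_one u : \sum_(v : V) gact (v, [::]) u = u.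
Proof. by case: HM => _ [_ [_ [_ [_ [_ [h _]]]]]]; apply: h. Qed.

Lemma act_S p q u : S p q -> gact p u = gact q u.
Proof. by case: HM => _ [_ [_ [_ [_ [_ [_ h]]]]]]; apply: h. Qed.

Lemma act0 p : is_path p -> gact p (0 : gcar M) = 0.
Proof. by move=> hp; rewrite (lin0 (act_lin hp)). Qed.

Lemma act_sim p q u : sim p q -> gact p u = gact q u.
Proof.
move=> h; apply: (sim_eval (phi := fun x => gact x u)) h.
move=> r p' q' s Spq hr hs c1 c2; have [hp' hq' Et Eh] := Swf Spq.
have c1' : composable r q' by rewrite /composable -Et.
have c2' : composable (pcat r q') s.
  by move: c2; rewrite !composable_pcatl // /composable Eh.
have e1 := act_act u (p := pcat r p') (q := s); rewrite c2 in e1.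
rewrite -e1 ?is_path_pcat ?hr //.
have e2 := act_act u (p := pcat r q') (q := s); rewrite c2' in e2.
rewrite -e2 ?is_path_pcat ?hr //.
have e3 := act_act (gact s u) (p := r) (q := p'); rewrite c1 in e3.
rewrite -e3 //.
have e4 := act_act (gact s u) (p := r) (q := q'); rewrite c1' in e4.
by rewrite -e4 // (act_S _ Spq).
Qed.

Lemma act_cat p q u : is_path p -> is_path q -> composable p q ->
  gact p (gact q u) = gact (pcat p q) u.
Proof. by move=> hp hq c; rewrite act_act // c. Qed.

Lemma act_idem p u : is_path p -> gact p (gact (phead p, [::]) u) = gact p u.
Proof. by move=> hp; rewrite act_cat // ?pcat_id // /composable. Qed.

Lemma act_tail p u : is_path p -> gact (ptail p, [::]) (gact p u) = gact p u.
Proof. by move=> hp; rewrite act_cat // /composable ?id_pcat. Qed.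

(** Group the terms by degree and subtract the total from the group of degree [j]: the resulting
    homogeneous elements sum to 0, so each of them vanishes by independence. *)
Lemma hom_component (I : eqType) (r : seq I) (d : I -> int) (F : I -> gcar M) j :
  (forall i, i \in r -> hom M (d i) (F i)) -> hom M j (\sum_(i <- r) F i) ->
  \sum_(i <- r | d i == j) F i = \sum_(i <- r) F i.
Proof.
move=> H Hj; set T := \sum_(i <- r) F i.
pose js := undup (j :: map d r).
pose w j' := \sum_(i <- r | d i == j') F i - (if j' == j then T else 0).
have wj : w j = 0.
  apply: (@hom_indep [seq (j', w j') | j' <- js] _ _ _ (j, w j)).
  - by rewrite -map_comp map_id undup_uniq.
  - move=> t /mapP [j' _ ->] /=; apply: subspaceB; first exact: hom_sub.
      apply: subspace_sum_seq; first exact: hom_sub.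
      by move=> i ir /eqP <-; apply: H.
    by case: eqP => [->|_] //; apply: subspace0; apply: hom_sub.
  - rewrite big_map /w sumrB.
    have -> : \sum_(j' <- js) (if j' == j then T else 0) = T.
      rewrite (bigD1_seq j) ?undup_uniq ?mem_undup ?inE ?eqxx //= big1 ?addr0 //.
      by move=> i /negPf ->.
    under eq_bigr do rewrite big_mkcond /=.
    rewrite exchange_big /=; apply/eqP; rewrite subr_eq0; apply/eqP.
    rewrite /T big_seq [RHS]big_seq; apply: eq_bigr => i ir.
    rewrite (bigD1_seq (d i)) ?undup_uniq ?mem_undup ?inE ?map_f ?orbT //= eqxx.
    by rewrite big1 ?addr0 // => j'; rewrite eq_sym => /negPf ->.
  - by apply/mapP; exists j => //; rewrite mem_undup inE eqxx.
by move/eqP: wj; rewrite /w eqxx subr_eq0 => /eqP.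
Qed.

Lemma hom_unique i j u : hom M j u -> hom M i u -> j != i -> u = 0.
Proof.
move=> hj hi ne.
have := @hom_component unit [:: tt] (fun _ => i) (fun _ => u) j.
rewrite !big_cons !big_nil /= eq_sym (negPf ne) addr0 => H.
by rewrite -H.
Qed.

End OneModule.
End Modules.

(** * Bar cochains on a submodule *)

Section Cochains.
Variables (k : fieldType) (V E : finType) (tl hd : E -> V).
Variable S : qpath V E -> qpath V E -> Prop.
Local Notation qp := (qpath V E).
Local Notation is_path := (is_path tl hd).
Local Notation sim := (sim k tl hd S).
Local Notation gmod := (gmod k V E).
Local Notation is_gmod := (is_gmod tl hd S).
Local Notation hom M := (@ghom _ _ _ M).
Local Notation okl := (okl tl hd).
Local Notation lhead := (lhead hd).
Local Notation lsim := (lsim k tl hd S).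
Hypotheses (Swf : S_wf tl hd S) (Sgr : S_graded S).
Implicit Types (p q r : qp) (l m : seq qp) (M P : gmod).

(** A tensor product over [A_0] becomes the condition that the module element is fixed by the
    idempotent at the head of the factor acting first; an empty list imposes no condition. *)
Definition vfix M (o : option V) (u : gcar M) : Prop :=
  if o is Some v then gact (v, [::]) u = u else True.

Definition dom M (Q : gcar M -> Prop) (d : int) (o : option V) (u : gcar M) : Prop :=
  [/\ Q u, hom M d u & vfix o u].

(** The internal degree [j] counts the lengths of the paths together with the degree of the module
    element. *)
Definition ldom M (Q : gcar M -> Prop) (j : int) l : gcar M -> Prop :=
  dom Q (j - (tlen l)%:Z) (lhead l).

Definition submod M (Q : gcar M -> Prop) : Prop :=
  subspace Q /\ forall p u, is_path p -> Q u -> Q (gact p u).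

(* [n]-cochains of internal degree [j] of the normalized bar complex computing
   Ext_A(Q, A_0); they only matter on admissible arguments, i.e. on lists [l] with
   [okl l] and elements of [ldom Q j l]. *)
Definition cochain M (Q : gcar M -> Prop) (n : nat) (j : int)
    (f : seq qp -> gcar M -> k) : Prop :=
  (forall l a u v, okl l -> size l = n -> ldom Q j l u -> ldom Q j l v ->
     f l (a *: u + v) = a * f l u + f l v) /\
  (forall l m u, okl l -> lsim l m -> size l = n -> ldom Q j l u -> f l u = f m u).

(** The general bar differential has one more term, in which the outermost factor acts on the
    coefficients [A_0]; it vanishes because all factors are nontrivial. *)
Definition delta M (f : seq qp -> gcar M -> k) l (u : gcar M) : k :=
  if l is b :: l' then f l' (gact b u) - mrg (fun m => f m u) l else 0.

Lemma delta_cons M (f : seq qp -> gcar M -> k) b l u :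
  delta f (b :: l) u = f l (gact b u) - mrg (fun m => f m u) (b :: l).
Proof. by []. Qed.

Definition cocycle M (Q : gcar M -> Prop) (n : nat) (j : int)
    (f : seq qp -> gcar M -> k) : Prop :=
  forall l u, okl l -> size l = n.+1 -> ldom Q j l u -> delta f l u = 0.

(* Ext^n(Q, A_0) vanishes in internal degree [j]. For [n = 0] the conclusion says
   that [f [::]] vanishes, since [delta g [::] = 0]. *)
Definition acyc M (Q : gcar M -> Prop) (n : nat) (j : int) : Prop :=
  forall f, cochain Q n j f -> cocycle Q n j f ->
  exists2 g, cochain Q n.-1 j g &
    forall l u, okl l -> size l = n -> ldom Q j l u -> delta g l u = f l u.

Section OneModule.
Variables (M : gmod) (HM : is_gmod M) (Q : gcar M -> Prop) (HQ : submod Q).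

Implicit Types (f g : seq qp -> gcar M -> k).

Lemma dom_sub d o : subspace (dom Q d o).
Proof.
have [Q0 Ql] := HQ.1; have [h0 hl] := hom_sub HM d.
split.
  by split => //; case: o => //= v; rewrite (act0 HM).
move=> a u v [u1 u2 u3] [v1 v2 v3]; split; [exact: Ql|exact: hl|].
by case: o u3 v3 => //= w u3 v3; rewrite (act_lin HM) // u3 v3.
Qed.

Lemma ldom_act j b l u : okl (b :: l) -> ldom Q j (b :: l) u ->
  ldom Q j l (gact b u).
Proof.
move=> ok [u1 u2 u3]; have hb := okl_path ok; split.
- exact: HQ.2.
- have -> : j - (tlen l)%:Z = j - (tlen (b :: l))%:Z + (plen b)%:Z.
    by rewrite tlen_cons; lia.
  exact: act_hom HM _ _ _ hb u2.
- case: l ok {u2 u3} => // c l /okl_comp /eqP /= ->.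
  by rewrite (act_tail HM).
Qed.

Lemma ldom_merges j l m u : okl l -> m \in merges l -> ldom Q j l u -> ldom Q j m u.
Proof. by move=> ok /(mergesP ok) [_ h1 h2]; rewrite /ldom h1 h2. Qed.

Lemma cochain0 n j f l : cochain Q n j f -> okl l -> size l = n -> f l 0 = 0.
Proof.
move=> [h _] ok sl; have D0 : ldom Q j l 0 by apply: subspace0; apply: dom_sub.
by have := h l (-1) 0 0 ok sl D0 D0; rewrite scaler0 addr0 mulN1r addNr.
Qed.

Lemma cochain_sum n j f l (I : eqType) (r : seq I) (F : I -> gcar M) :
  cochain Q n j f -> okl l -> size l = n ->
  (forall i, i \in r -> ldom Q j l (F i)) ->
  f l (\sum_(i <- r) F i) = \sum_(i <- r) f l (F i).
Proof.
move=> cf ok sl; have DS := dom_sub (j - (tlen l)%:Z) (lhead l).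
elim: r => [|i r IH] h; first by rewrite !big_nil (cochain0 cf).
rewrite !big_cons -IH => [|i' hi']; last by apply: h; rewrite inE hi' orbT.
rewrite -[F i]scale1r -[f l (1 *: _)]mul1r.
rewrite cf.1 ?scale1r //; first by apply: h; rewrite inE eqxx.
by apply: (subspace_sum_seq DS) => i' hi' _; apply: h; rewrite inE hi' orbT.
Qed.

Lemma delta_cochain n j f : cochain Q n j f -> cochain Q n.+1 j (delta f).
Proof.
move=> cf; split.
  move=> [|b l] a u v ok // [sl] du dv; rewrite /delta.
  rewrite (act_lin HM) ?(okl_path ok) // cf.1 ?(okl_tl ok) //; try exact: ldom_act.
  rewrite (eq_mrg (G := fun m => a * f m u + f m v)) ?mrg_lin; last first.
    move=> m hm; have [okm _ _] := mergesP ok hm; have := merges_size hm.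
    by move=> [e]; apply: cf.1; rewrite -?e //; apply: ldom_merges hm _.
  by rewrite mulrBr opprD addrACA.
move=> [|b l] [|c m] u ok // hs // [sl] du.
have [hb hl] : sim b c /\ lsim l m by [].
rewrite /delta -(act_sim Swf HM _ hb); congr (_ - _).
  by apply: cf.2 => //; [exact: okl_tl ok|exact: ldom_act].
apply: (mrg_lsim Swf Sgr ok hs) => m1 m2 h1 h2.
have [okm _ _] := mergesP ok h1; have := merges_size h1.
by move=> [e]; apply: cf.2; rewrite -?e //; apply: ldom_merges h1 _.
Qed.

Lemma delta_delta f l u : okl l -> delta (delta f) l u = 0.
Proof.
case: l => [|b [|c l]] // ok; first by rewrite /delta mrg1 subr0.
have cc := okl_comp ok; have hb := okl_path ok; have hc := okl_path (okl_tl ok).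
rewrite !delta_cons mrg2 delta_cons (act_cat HM) //.
have -> : mrg (fun m => delta f (b :: m) u) (c :: l) =
   mrg (fun m => f m (gact b u)) (c :: l)
   - mrg (fun m => mrg (fun m' => f m' u) (b :: m)) (c :: l).
  by rewrite -mrgB.
have := mrg_mrg (fun m => f m u) [:: b, c & l]; rewrite mrg2.
move=> /eqP; rewrite subr_eq0 => /eqP <-.
set X := f l _; set Y := mrg _ (c :: l); set Z := mrg _ (_ :: l).
by rewrite [X - Z - _]addrAC opprB opprD opprK; ring.
Qed.

End OneModule.
End Cochains.

(** * Dimension shifting along a map with image [Q] *)

Section Shift.
Variables (k : fieldType) (V E : finType) (tl hd : E -> V).
Variable S : qpath V E -> qpath V E -> Prop.
Local Notation qp := (qpath V E).
Local Notation is_path := (is_path tl hd).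
Local Notation composable := (composable hd).
Local Notation gmod := (gmod k V E).
Local Notation is_gmod := (is_gmod tl hd S).
Local Notation hom M := (@ghom _ _ _ M).
Local Notation okl := (okl tl hd).
Local Notation lhead := (lhead hd).
Local Notation gmorph := (gmorph tl hd).
Local Notation submod := (submod tl hd).
Local Notation cochain := (cochain tl hd S).
Local Notation acyc := (acyc tl hd S).
Local Notation ldom := (ldom hd).
Hypotheses (Swf : S_wf tl hd S) (Sgr : S_graded S).
Variables (M P : gmod) (HM : is_gmod M) (HP : is_gmod P).
Variables (eps : gcar P -> gcar M) (Heps : gmorph eps).
Variable Q : gcar M -> Prop.
Hypothesis Qim : forall w, Q w <-> exists u, eps u = w.
Implicit Types (l m : seq qp).

Let K (u : gcar P) : Prop := eps u = 0.
Let all (u : gcar P) : Prop := True.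

Lemma submod_all : submod all.
Proof. by []. Qed.

Let elin : forall a u v, eps (a *: u + v) = a *: eps u + eps v.
Proof. by case: Heps. Qed.
Let ehom j u : hom P j u -> hom M j (eps u).
Proof. by case: Heps => _ h _; apply: h. Qed.
Let eact p u : is_path p -> eps (gact p u) = gact p (eps u).
Proof. by case: Heps => _ _ h; apply: h. Qed.

Lemma submod_ker : submod K.
Proof.
split; last by move=> p u hp Ku; rewrite /K eact // Ku (act0 HM).
split; first exact: (lin0 elin).
by move=> a u v Ku Kv; rewrite /K elin Ku Kv scaler0 addr0.
Qed.

Lemma submod_im : submod Q.
Proof.
split; first split.
- by apply/Qim; exists 0; apply: (lin0 elin).
- move=> a _ _ /Qim [u <-] /Qim [v <-]; apply/Qim.
  by exists (a *: u + v).
- by move=> p _ hp /Qim [u <-]; apply/Qim; exists (gact p u); rewrite eact.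
Qed.

(** A preimage may be inhomogeneous, but its part of degree [d] has the same image, since [eps]
    preserves degrees and [w] has degree [d]. *)
Lemma hom_lift d w : hom M d w -> Q w -> exists2 u, hom P d u & eps u = w.
Proof.
move=> hw /Qim [u eu]; have [c [_ ch E1]] := hom_dec HP u.
exists (\sum_(t <- c | t.1 == d) t.2).
  apply: subspace_sum_seq; first exact: hom_sub HP _.
  by move=> t tc /eqP <-; apply: ch.
have E2 : \sum_(t <- c) eps t.2 = w by rewrite -(lin_sum elin) -E1.
rewrite (lin_sum elin).
rewrite (hom_component HM (d := fun t : int * gcar P => t.1)) ?E2 //.
by move=> t tc; apply: ehom; apply: ch.
Qed.

Lemma dom_lift d o w : dom Q d o w -> exists2 u, dom all d o u & eps u = w.
Proof.
move=> [Qw hw fw]; have [u hu eu] := hom_lift hw Qw.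
case: o fw => [v|] /= fw; last by exists u.
exists (gact (v, [::]) u); last by rewrite eact // eu.
split=> //=; first by have := act_hom HP (p := (v, [::])) erefl hu; rewrite addr0.
by rewrite (act_cat HP) // /composable.
Qed.

Lemma dom_eps d o u : dom all d o u -> dom Q d o (eps u).
Proof.
move=> [_ hu fu]; split; [by apply/Qim; exists u|exact: ehom|].
by case: o fu => //= v fu; rewrite -eact // fu.
Qed.

Lemma dom_all d o u : dom K d o u -> dom all d o u.
Proof. by case. Qed.

Lemma lift_exists : exists s : int -> option V -> gcar M -> gcar P,
  forall d o w, dom Q d o w -> dom all d o (s d o w) /\ eps (s d o w) = w.
Proof.
have /choice [s sP] : forall x : int * option V * gcar M, exists u,
    dom Q x.1.1 x.1.2 x.2 -> dom all x.1.1 x.1.2 u /\ eps u = x.2.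
  move=> [[d o] w]; case: (pselect (dom Q d o w)) => [/dom_lift [u h1 h2]|h].
    by exists u.
  by exists 0.
by exists (fun d o w => s (d, o, w)) => d o w; apply: (sP (d, o, w)).
Qed.

Lemma proj_ker_exists : exists rho : int -> option V -> gcar P -> gcar P,
  forall d o, [/\ (forall a u v, rho d o (a *: u + v) = a *: rho d o u + rho d o v),
      (forall u, dom K d o (rho d o u)) & (forall u, dom K d o u -> rho d o u = u)].
Proof.
have /choice [r rP] := fun x : int * option V =>
  projection_exists (dom_sub HP submod_ker x.1 x.2).
by exists (fun d o => r (d, o)) => d o; apply: (rP (d, o)).
Qed.

(** Precompose with a projection onto the kernel. The projection depends on the list only through
    its total length and its head, which equivalent lists share, so invariance is kept. *)
Lemma cochain_extend n j f : cochain K n j f ->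
  exists2 f', cochain all n j f' &
    forall l u, okl l -> size l = n -> ldom K j l u -> f' l u = f l u.
Proof.
move=> cf; have [rho rP] := proj_ker_exists.
exists (fun l u => f l (rho (j - (tlen l)%:Z) (lhead l) u)).
  split.
    move=> l a u v ok sl du dv; have [r1 r2 r3] := rP (j - (tlen l)%:Z) (lhead l).
    by rewrite r1 cf.1 //; apply: r2.
  move=> l m u ok h sl du; have [r1 r2 r3] := rP (j - (tlen l)%:Z) (lhead l).
  rewrite -(lsim_head Swf Sgr h) -(lsim_tlen Swf Sgr h); apply: cf.2 => //.
  exact: r2.
move=> l u ok sl du; have [r1 r2 r3] := rP (j - (tlen l)%:Z) (lhead l).
by rewrite r3.
Qed.

(** The lift [s] need not be linear: two lifts of one element differ by an element of the kernel, on
    which [f] vanishes. *)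
Lemma cochain_descend n j f : cochain all n j f ->
  (forall l u, okl l -> size l = n -> ldom K j l u -> f l u = 0) ->
  exists2 f', cochain Q n j f' &
    forall l u, okl l -> size l = n -> ldom all j l u -> f' l (eps u) = f l u.
Proof.
move=> cf f0; have [s sP] := lift_exists.
pose f' l w := f l (s (j - (tlen l)%:Z) (lhead l) w).
have DS d o := dom_sub HP submod_all d o.
have key l u v : okl l -> size l = n -> ldom all j l u -> ldom all j l v ->
    eps u = eps v -> f l u = f l v.
  move=> ok sl du dv e; apply/eqP; rewrite -subr_eq0; apply/eqP.
  have duv : ldom all j l (u - v) by apply: (subspaceB (DS _ _)).
  rewrite -[RHS](f0 l (u - v)) //; last first.
    by case: duv => _ h1 h2; split=> //; rewrite /K (linB elin) e subrr.
  by rewrite [u - v]addrC -scaleN1r cf.1 // mulN1r addrC.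
exists f'.
  split.
    move=> l a w w' ok sl dw dw'.
    have [u1 u2] := sP _ _ _ dw; have [v1 v2] := sP _ _ _ dw'.
    have dz : ldom Q j l (a *: w + w') by apply: (dom_sub HM submod_im _ _).2.
    have [z1 z2] := sP _ _ _ dz.
    rewrite /f' -cf.1 //; apply: key => //; first by apply: (DS _ _).2.
    by rewrite elin u2 v2 z2.
  move=> l m w ok h sl dw; rewrite /f'.
  rewrite -(lsim_head Swf Sgr h) -(lsim_tlen Swf Sgr h); apply: cf.2 => //.
  by have [] := sP _ _ _ dw.
move=> l u ok sl du; have [u1 u2] := sP _ _ _ (dom_eps du).
by apply: key.
Qed.

Lemma cochain_pull n j f : cochain Q n j f -> cochain all n j (fun l u => f l (eps u)).
Proof.
move=> cf; split.
  by move=> l a u v ok sl du dv; rewrite elin cf.1 //; apply: dom_eps.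
by move=> l m u ok h sl du; apply: cf.2 => //; apply: dom_eps.
Qed.

Lemma cochainB n j (N : gmod) (R : gcar N -> Prop) f g :
  cochain R n j f -> cochain R n j g -> cochain R n j (fun l u => f l u - g l u).
Proof.
move=> cf cg; split.
  by move=> l a u v ok sl du dv; rewrite cf.1 // cg.1 // opprD addrACA -mulrBr.
by move=> l m u ok h sl du; rewrite (cf.2 l m) // (cg.2 l m).
Qed.

Lemma deltaB (N : gmod) f g l (u : gcar N) :
  delta (fun l u => f l u - g l u) l u = delta f l u - delta g l u.
Proof.
case: l => [|b l]; first by rewrite /= subrr.
rewrite !delta_cons mrgB; ring.
Qed.

Lemma delta_pull f l u : okl l -> delta (fun l u => f l (eps u)) l u = delta f l (eps u).
Proof. by case: l => // b l ok; rewrite !delta_cons eact // (okl_path ok). Qed.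

(* [delta] only involves admissible arguments, so it only depends on the restriction
   of a cochain to a submodule, and commutes with descent to a quotient. *)
Lemma delta_ext (N N' : gmod) (R : gcar N -> Prop) n j f g (h : gcar N -> gcar N') l u :
  is_gmod N -> submod R ->
  (forall p u, is_path p -> h (gact p u) = gact p (h u)) ->
  (forall l u, okl l -> size l = n -> ldom R j l u -> f l u = g l (h u)) ->
  okl l -> size l = n.+1 -> ldom R j l u -> delta f l u = delta g l (h u).
Proof.
move=> HN HR hact H; case: l => // b l ok [sl] du; rewrite !delta_cons.
rewrite H ?(okl_tl ok) ?hact ?(okl_path ok) //; last exact: (ldom_act HN HR ok du).
congr (_ - _); apply: eq_mrg => m hm; have [okm _ _] := mergesP ok hm.
have := merges_size hm; rewrite [size _]/= sl => -[e].
by apply: H; rewrite -?e //; apply: (ldom_merges ok hm du).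
Qed.

(** The piece [Ext^(n-1)(K) -> Ext^n(Q) -> Ext^n(P)] of the long exact sequence. Write the pullback
    of [f] as [delta g]; [g] restricts to a cocycle on the kernel, hence to some [delta h]; after
    subtracting [delta] of an extension of [h], [g] descends to a primitive of [f]. *)
Lemma acyc_from_ker n j : (0 < n)%N ->
  acyc all n j -> acyc K n.-1 j -> acyc Q n j.
Proof.
case: n => // n _ aP aK f cf zf.
have [|g cg dg] := aP _ (cochain_pull cf).
  move=> l u ok sl du; rewrite delta_pull //; apply: zf => //; exact: dom_eps.
have cgK : cochain K n j g.
  split; first by move=> l a u v ok sl /dom_all du /dom_all dv; apply: cg.1.
  by move=> l m u ok h sl /dom_all du; apply: cg.2.
have [|h ch dh] := aK _ cgK.
  move=> l u ok sl du; rewrite dg //; last exact: dom_all.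
  case: du => -> _ _; exact: (cochain0 HM submod_im cf).
have [h' ch' eh'] := cochain_extend ch.
(* In degree 0 nothing is subtracted: acyclicity of the kernel there already says that [g] vanishes
   on it. *)
have [||g1 cg1 eg1] := @cochain_descend n j (fun l u => g l u - (if n is 0%N then fun _ _ => 0 else delta h') l u).
- apply: cochainB => //; case: n {aP aK f cf zf g cg dg cgK ch dh eh' h} ch' => [|n] ch'.
    by split=> *; rewrite ?mulr0 ?addr0.
  exact: (delta_cochain Swf Sgr HP submod_all).
- move=> l u ok sl du; apply/eqP; rewrite subr_eq0; apply/eqP.
  rewrite -dh //; case: n {aP aK cf zf cg dg cgK dh ch ch'} sl eh' => [|n] sl eh'.
    by case: l ok sl du.
  symmetry; apply: (delta_ext (R := K) (h := id) HP submod_ker _ _ ok sl du) => //.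
exists g1 => //.
move=> l w ok sl dw; have [u du <-] := dom_lift dw; rewrite -[RHS](dg l u) //.
transitivity (delta (fun l u => g l u - (if n is 0%N then fun _ _ => 0 else delta h') l u) l u).
  symmetry; apply: (delta_ext (R := all) (h := eps) HP submod_all _ _ ok sl du) => //.
  by move=> l' v ok' sl' dv; rewrite eg1.
rewrite deltaB -[RHS]subr0; congr (_ - _).
case: n {aP aK f cf zf g cg dg cgK ch dh eh' h cg1 eg1} ch' sl => [|n] ch' sl.
  by case: l sl ok {du dw} => // b [|] // _ _; rewrite delta_cons subr0.
by rewrite (delta_delta HP).
Qed.

(** The piece [Ext^n(P) -> Ext^n(K) -> Ext^(n+1)(Q)]. The coboundary of an extension of [f] to [P]
    vanishes on the kernel and descends to [phi], the image of [f] under the connecting map; a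
    primitive of [phi] corrects the extension to a cocycle on [P] without changing it on the
    kernel. *)
Lemma acyc_of_ker n j : acyc all n j -> acyc Q n.+1 j -> acyc K n j.
Proof.
move=> aP aQ f cf zf.
have [f' cf' ef'] := cochain_extend cf.
have [||phi cphi ephi] := @cochain_descend n.+1 j (delta f').
- exact: (delta_cochain Swf Sgr HP submod_all).
- move=> l u ok sl du; rewrite -[RHS](zf l u) //.
  exact: (delta_ext (R := K) (h := id) HP submod_ker _ ef' ok sl du).
have [||g cg dg] := aQ phi => //.
  move=> l w ok sl dw; have [u du <-] := dom_lift dw.
  rewrite -[RHS](delta_delta HP f' u ok); symmetry.
  apply: (delta_ext (R := all) (h := eps) HP submod_all _ _ ok sl du).
    by move=> p v hp; apply: eact.
  by move=> l' v ok' sl' dv; rewrite ephi.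
have [||h ch dh] := aP (fun l u => f' l u - g l (eps u)).
- by apply: cochainB => //; apply: cochain_pull.
- move=> l u ok sl du; rewrite deltaB delta_pull // dg //; last exact: dom_eps.
  by rewrite ephi // subrr.
exists h.
  split; first by move=> l a u v ok sl /dom_all du /dom_all dv; apply: ch.1.
  by move=> l m u ok hs sl /dom_all du; apply: ch.2.
move=> l u ok sl du; rewrite dh //; last exact: dom_all.
rewrite ef' //; case: du => -> _ _.
by rewrite (cochain0 HM submod_im cg) // subr0.
Qed.

End Shift.

(** * Induced modules *)

Section SubspaceType.
Variables (k : fieldType) (W : lmodType k) (Q : W -> Prop) (HQ : subspace Q).

(** The carrier of a module is a type, so a subspace given by a predicate has to become one; the
    closure proof is a parameter, so that the structures can be inferred from the predicate. *)
Definition subspace_pred of subspace Q : {pred W} := fun w => `[<Q w>].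

Lemma subspace_pred_closed : submod_closed (subspace_pred HQ).
Proof.
split; first by apply/asboolP; apply: subspace0.
by move=> a u v /asboolP hu /asboolP hv; apply/asboolP; apply: HQ.2.
Qed.

HB.instance Definition _ :=
  GRing.isSubmodClosed.Build k W (subspace_pred HQ) subspace_pred_closed.

Record subspace_type := SubspaceType {
  subspace_val : W; subspace_valP : subspace_val \in subspace_pred HQ }.
HB.instance Definition _ := [isSub for subspace_val].
HB.instance Definition _ := [Choice of subspace_type by <:].
HB.instance Definition _ := [SubChoice_isSubLmodule of subspace_type by <:].
End SubspaceType.

(** * Representatives of path classes and sums over them *)

Section NormalForms.
Variables (k : fieldType) (V E : finType) (tl hd : E -> V).
Variable S : qpath V E -> qpath V E -> Prop.
Local Notation qp := (qpath V E).
Local Notation is_path := (is_path tl hd).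
Local Notation composable := (composable hd).
Local Notation sim := (sim k tl hd S).
Hypotheses (Swf : S_wf tl hd S) (Sgr : S_graded S) (Hcan : cancellative k tl hd S).
Implicit Types (p q r : qp).

(** The representative is chosen from the class, so equivalent paths share it; sums over classes
    become sums over the finite lists [nfs N]. *)
Definition nf p : qp := choose (fun q => `[<sim p q>]) p.

Lemma sim_nf p : is_path p -> sim p (nf p).
Proof.
move=> hp; apply/asboolP.
by apply: (@chooseP _ (fun q => `[<sim p q>])); apply/asboolP; apply: sim_refl.
Qed.

Lemma nf_sim p q : sim p q -> nf p = nf q.
Proof.
move=> h; rewrite /nf.
have -> : (fun x => `[<sim p x>]) = (fun x => `[<sim q x>]).
  apply/funext => x; apply: asbool_equiv_eq.
  by split=> hx; [apply: sim_trans (sim_sym h) hx|apply: sim_trans h hx].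
apply: choose_id; apply/asboolP; last by apply: sim_refl (sim_pathr h).
exact: sim_sym.
Qed.

Lemma simP p q : is_path p -> is_path q -> (sim p q <-> nf p = nf q).
Proof.
move=> hp hq; split=> [|e]; first exact: nf_sim.
by apply: (sim_trans (sim_nf hp)); rewrite e; apply: sim_sym; apply: sim_nf.
Qed.

Lemma nf_path p : is_path p -> is_path (nf p).
Proof. by move/sim_nf/sim_pathr. Qed.

Lemma nf_nf p : is_path p -> nf (nf p) = nf p.
Proof. by move=> /sim_nf /nf_sim. Qed.

Definition nfs (N : nat) : seq qp :=
  undup [seq p <- flatten [seq [seq (v, tval t) | v <- enum V, t <- enum {: n.-tuple E}]
    | n <- iota 0 N.+1] | is_path p && (nf p == p)].

Lemma mem_nfs N p : (p \in nfs N) = [&& is_path p, nf p == p & (plen p <= N)%N].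
Proof.
rewrite mem_undup mem_filter -andbA; congr (_ && _); congr (_ && _).
apply/flattenP/idP => [[s /mapP [n]]|h].
  rewrite mem_iota => /andP [_ hn] -> /allpairsP [[v t] /= [_ _ ->]].
  by rewrite /plen /= size_tuple; lia.
exists [seq (v, tval t) | v <- enum V, t <- enum {: (plen p).-tuple E}].
  by apply/mapP; exists (plen p) => //; rewrite mem_iota; lia.
apply/allpairsP; exists (p.1, in_tuple p.2); rewrite !mem_enum; split=> //=.
by case: (p).
Qed.

Lemma nfs_uniq N : uniq (nfs N). Proof. exact: undup_uniq. Qed.

Lemma nfs_path N p : p \in nfs N -> is_path p.
Proof. by rewrite mem_nfs => /and3P []. Qed.

Lemma nf_mem_nfs N p : is_path p -> (plen p <= N)%N -> nf p \in nfs N.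
Proof.
move=> hp hN; rewrite mem_nfs nf_path // nf_nf // eqxx /=.
by rewrite -(sim_len Swf Sgr (sim_nf hp)).
Qed.

(** Elements of induced modules have bounded support but no distinguished bound; this allows passing
    from one bound to another. *)
Lemma sum_nfs_le (W : nmodType) N N' (F : qp -> W) : (N <= N')%N ->
  (forall p, (N < plen p)%N -> F p = 0) ->
  \sum_(p <- nfs N') F p = \sum_(p <- nfs N) F p.
Proof.
move=> hN F0; rewrite (bigID (fun p => plen p <= N)%N) /= [X in _ + X]big1 ?addr0; last first.
  by move=> p; rewrite -ltnNge; apply: F0.
rewrite -big_filter; apply: perm_big; apply: uniq_perm; rewrite ?filter_uniq ?nfs_uniq //.
move=> p; rewrite mem_filter !mem_nfs; case: (is_path p) => /=; rewrite ?andbF //.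
case: (_ == _); rewrite ?andbF //=; lia.
Qed.

Lemma sum_nfs1 (W : nmodType) N (F : qp -> W) p : is_path p -> (plen p <= N)%N ->
  (forall q, is_path q -> ~ sim p q -> F q = 0) ->
  \sum_(q <- nfs N) F q = F (nf p).
Proof.
move=> hp hN F0; rewrite (bigD1_seq (nf p)) ?nf_mem_nfs ?nfs_uniq //=.
rewrite big_seq_cond big1 ?addr0 // => q /andP [hq /eqP ne]; apply: F0.
  exact: nfs_path hq.
move=> /nf_sim e; apply: ne; rewrite e; move: hq.
by rewrite mem_nfs => /and3P [_ /eqP ->].
Qed.

(* Left cancellation makes [p |-> b p] injective on classes, so that sums over the
   classes in [b A] are sums over [p]. *)
Lemma sum_nfs_shift (W : nmodType) N (G : qp -> W) b : is_path b ->
  (forall p q, sim p q -> G p = G q) ->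
  (forall q, is_path q ->
     (forall p, is_path p -> composable b p -> ~ sim q (pcat b p)) -> G q = 0) ->
  \sum_(q <- nfs (plen b + N)) G q =
  \sum_(p <- nfs N | composable b p) G (pcat b p).
Proof.
move=> hb Gs G0; pose h p := nf (pcat b p).
pose X := [seq p <- nfs N | composable b p].
have XP p : p \in X -> [/\ is_path p, nf p = p, (plen p <= N)%N & composable b p].
  by rewrite mem_filter mem_nfs => /andP [-> /and3P [-> /eqP -> ->]].
have uX : uniq [seq h p | p <- X].
  rewrite map_inj_in_uniq ?filter_uniq ?nfs_uniq // => p q /XP [p1 p2 p3 p4] /XP [q1 q2 q3 q4] e.
  rewrite -p2 -q2; apply/simP => //; apply: (Hcan.1 b) => //.
  by apply/simP => //; rewrite is_path_pcat // hb.
transitivity (\sum_(q <- [seq h p | p <- X]) G q).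
  rewrite (bigID (mem [seq h p | p <- X])) /= [X in _ + X]big_seq_cond.
  rewrite [X in _ + X]big1 ?addr0; last first.
    move=> q /andP [hq nq]; have := hq; rewrite mem_nfs => /and3P [q1 /eqP q2 q3].
    apply: G0 => // p hp c hs; case/negP: nq; apply/mapP; exists (nf p).
      rewrite mem_filter nf_mem_nfs //; last first.
        by have := sim_len Swf Sgr hs; rewrite plen_pcat; lia.
      by move: c; rewrite /composable (sim_tail Swf Sgr (sim_nf hp)) => ->.
    rewrite -q2; apply: nf_sim; apply: (sim_trans hs).
    by apply: sim_catl => //; apply: sim_nf.
  rewrite -big_filter; apply: perm_big; apply: uniq_perm => //.
    by rewrite filter_uniq ?nfs_uniq.
  move=> q; rewrite mem_filter andbC; apply/andP/idP => [[] //|hq]; split=> //.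
  case/mapP: hq => p /XP [p1 p2 p3 p4] ->; apply: nf_mem_nfs.
    by rewrite is_path_pcat // hb.
  by rewrite plen_pcat leq_add2l.
rewrite big_map big_filter big_seq_cond [RHS]big_seq_cond.
apply: eq_bigr => p /andP [/nfs_path hp c]; apply: Gs; apply: sim_sym; apply: sim_nf.
by rewrite is_path_pcat // hb.
Qed.

End NormalForms.

Section Regroup.
Variables (k : fieldType) (W : lmodType k) (h : int -> W -> Prop).
Hypothesis hs : forall j, subspace (h j).

(** Brings a sum of homogeneous elements into the shape with pairwise distinct degrees that
    [is_gmod] asks for. *)
Lemma regroup (I : eqType) (r : seq I) (d : I -> int) (F : I -> W) :
  (forall i, i \in r -> h (d i) (F i)) ->
  exists c : seq (int * W),
     [/\ uniq (map fst c), (forall t, t \in c -> h t.1 t.2)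
       & \sum_(i <- r) F i = \sum_(t <- c) t.2].
Proof.
move=> H; pose js := undup [seq d i | i <- r].
exists [seq (j, \sum_(i <- r | d i == j) F i) | j <- js]; split.
- by rewrite -map_comp map_id undup_uniq.
- move=> t /mapP [j _ ->] /=; apply: subspace_sum_seq => // i ir /eqP <-.
  exact: H.
- rewrite big_map /=; under [RHS]eq_bigr do rewrite big_mkcond /=.
  rewrite exchange_big /= big_seq [RHS]big_seq; apply: eq_bigr => i ir.
  rewrite (bigD1_seq (d i)) ?undup_uniq ?mem_undup ?map_f //= eqxx.
  by rewrite big1 ?addr0 // => j'; rewrite eq_sym => /negPf ->.
Qed.

End Regroup.

Section Induced.
Variables (k : fieldType) (V E : finType) (tl hd : E -> V).
Variable S : qpath V E -> qpath V E -> Prop.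
Local Notation qp := (qpath V E).
Local Notation is_path := (is_path tl hd).
Local Notation phead := (phead hd).
Local Notation composable := (composable hd).
Local Notation sim := (sim k tl hd S).
Local Notation gmod := (gmod k V E).
Local Notation is_gmod := (is_gmod tl hd S).
Local Notation hom M := (@ghom _ _ _ M).
Local Notation nfs := (nfs k tl hd S).
Hypotheses (Swf : S_wf tl hd S) (Sgr : S_graded S) (Hcan : cancellative k tl hd S).
Implicit Types (p q r b : qp).

(** The graded [A_0]-submodules, which serve as spaces of generators for induced modules. *)
Definition vertex_stable (M : gmod) (U : gcar M -> Prop) : Prop :=
  [/\ subspace U, (forall v u, U u -> U (gact (v, [::]) u)) &
      (forall u, U u -> exists c : seq (int * gcar M),
         (forall t, t \in c -> hom M t.1 t.2 /\ U t.2) /\ u = \sum_(t <- c) t.2)].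

Section Ind.
Variables (M : gmod) (HM : is_gmod M) (U : gcar M -> Prop) (HU : vertex_stable U).
Local Notation Wf := (qp -> gcar M).
Implicit Types (phi : Wf).

(* [phi] stands for the sum of the p (x) phi p over the classes of paths p, an element
   of A (x)_{A_0} U. *)
Definition ind_fun phi : Prop :=
  [/\ (forall p, ~ is_path p -> phi p = 0),
      (forall p q, sim p q -> phi p = phi q),
      (forall p, is_path p -> U (phi p) /\ gact (phead p, [::]) (phi p) = phi p)
    & (exists N, forall p, (N < plen p)%N -> phi p = 0)].

Lemma ind_fun_sub : subspace ind_fun.
Proof.
have [Us _ _] := HU; split.
  split=> // [p _|]; last by exists 0%N.
  by split; [exact: subspace0|rewrite (act0 HM)].
move=> a f g [f1 f2 f3 [Nf f4]] [g1 g2 g3 [Ng g4]]; split.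
- by move=> p np; rewrite !fctE f1 // g1 // scaler0 addr0.
- by move=> p q h; rewrite !fctE (f2 p q) // (g2 p q).
- move=> p hp; have [Uf ef] := f3 p hp; have [Ug eg] := g3 p hp.
  rewrite !fctE; split; first by apply: Us.2.
  by rewrite (act_lin HM) // ef eg.
- exists (Nf + Ng)%N => p hp; rewrite !fctE f4 ?g4 ?scaler0 ?addr0 //; lia.
Qed.

(* The action of [b] sends p (x) u to b p (x) u. *)
Definition ind_shift b phi : Wf := fun q =>
  if pselect (exists p, [/\ is_path p, composable b p & sim q (pcat b p)]) is left h
  then phi (projT1 (cid h)) else 0.

(** By left cancellation the class of [b p] determines that of [p], so the choice made in
    [ind_shift] is immaterial. *)
Lemma ind_shiftE b phi p q : ind_fun phi -> is_path b -> is_path p -> composable b p ->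
  sim q (pcat b p) -> ind_shift b phi q = phi p.
Proof.
move=> [_ f2 _ _] hb hp c h; rewrite /ind_shift; case: pselect => [H|[]]; last by exists p.
case: (cid H) => p' [h1 h2 h3] /=; apply: f2; apply: (Hcan.1 b) => //.
exact: sim_trans (sim_sym h3) h.
Qed.

Lemma ind_shift0 b phi q : 
  (forall p, is_path p -> composable b p -> ~ sim q (pcat b p)) -> ind_shift b phi q = 0.
Proof.
move=> H; rewrite /ind_shift; case: pselect => // -[p [h1 h2 h3]].
by case: (H p h1 h2).
Qed.

Lemma ind_shift_fun b phi : is_path b -> ind_fun phi -> ind_fun (ind_shift b phi).
Proof.
move=> hb hf; have [f1 f2 f3 [N f4]] := hf; have [Us _ _] := HU; split.
- by move=> p np; apply: ind_shift0 => q _ _ /sim_pathl.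
- move=> p q h; case: (pselect (exists p', [/\ is_path p', composable b p' & sim p (pcat b p')])).
    move=> [p' [h1 h2 h3]]; rewrite !(ind_shiftE hf hb h1 h2) //.
    exact: sim_trans (sim_sym h) h3.
  move=> H; rewrite !ind_shift0 // => p' h1 h2 h3; apply: H; exists p'; split => //.
  exact: sim_trans h h3.
- move=> q hq; case: (pselect (exists p, [/\ is_path p, composable b p & sim q (pcat b p)])).
    move=> [p [h1 h2 h3]]; rewrite !(ind_shiftE hf hb h1 h2) //.
    by rewrite (sim_head Swf Sgr h3) phead_pcat //; apply: f3.
  move=> H; rewrite ind_shift0; last by move=> p' h1 h2 h3; apply: H; exists p'.
  by split; [exact: subspace0|rewrite (act0 HM)].
- exists (plen b + N)%N => q hq.
  case: (pselect (exists p, [/\ is_path p, composable b p & sim q (pcat b p)])).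
    move=> [p [h1 h2 h3]]; rewrite (ind_shiftE hf hb h1 h2) //; apply: f4.
    by have := sim_len Swf Sgr h3; rewrite plen_pcat; lia.
  by move=> H; rewrite ind_shift0 // => p' h1 h2 h3; apply: H; exists p'.
Qed.

Definition ind_car : lmodType k := subspace_type ind_fun_sub.

Lemma ind_valP (x : ind_car) : ind_fun (val x).
Proof. by apply/asboolP; exact: (valP x). Qed.

Definition ind_mk phi : ind_car := insubd (0 : ind_car) phi.

Lemma ind_mkE phi : ind_fun phi -> val (ind_mk phi) = phi.
Proof. by move=> h; rewrite insubdK //; apply/asboolP. Qed.

Definition ind : gmod := @GMod k V E ind_car
  (fun j x => forall p, hom M (j - (plen p)%:Z) (val x p))
  (fun b x => ind_mk (ind_shift b (val x))).

Lemma ind_actE b (x : gcar ind) : is_path b -> val (gact b x) = ind_shift b (val x).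
Proof. by move=> hb; rewrite /= ind_mkE //; apply: ind_shift_fun => //; apply: ind_valP. Qed.

Lemma ind_ext (x y : gcar ind) : (forall p, is_path p -> val x p = val y p) -> x = y.
Proof.
move=> H; apply: val_inj; apply/funext => p; have [hp|/negP np] := boolP (is_path p).
  exact: H.
by have [-> // _ _ _] := ind_valP x; have [-> // _ _ _] := ind_valP y.
Qed.

Lemma ind_val_lin a (x y : gcar ind) p : val (a *: x + y) p = a *: val x p + val y p.
Proof. by []. Qed.

Lemma ind_val_sum (I : Type) (r : seq I) (P : pred I) (F : I -> gcar ind) p :
  val (\sum_(i <- r | P i) F i) p = \sum_(i <- r | P i) val (F i) p.
Proof. by apply: (big_morph (fun x : gcar ind => val x p)). Qed.

(** This is the single tensor [p (x) u], for [u] in [U] at the head of [p]. *)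
Definition ind_single p (u : gcar M) : gcar ind :=
  ind_mk (fun q => if `[< sim p q >] then u else 0).

Lemma ind_singleE p u q : is_path p -> U u -> gact (phead p, [::]) u = u ->
  val (ind_single p u) q = if `[< sim p q >] then u else 0.
Proof.
move=> hp hu eu; have [Us _ _] := HU; rewrite ind_mkE //; split.
- by move=> x nx; rewrite asboolF // => /sim_pathr.
- move=> x y h; congr (if _ then _ else _); apply: asbool_equiv_eq.
  by split=> h'; apply: (sim_trans h') => //; apply: sim_sym.
- move=> x hx; case: asboolP => [h|_]; last by split; [exact: subspace0|rewrite (act0 HM)].
  by rewrite -(sim_head Swf Sgr h).
- exists (plen p) => x hx; rewrite asboolF // => /(sim_len Swf Sgr) h.
  by rewrite h ltnn in hx.
Qed.

Lemma ind_sum_single (x : gcar ind) N : (forall p, (N < plen p)%N -> val x p = 0) ->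
  x = \sum_(p <- nfs N) ind_single p (val x p).
Proof.
move=> hN; have [f1 f2 f3 _] := ind_valP x; apply: ind_ext => q hq.
rewrite ind_val_sum; have [le|lt] := leqP (plen q) N.
  rewrite (sum_nfs1 Swf Sgr hq le).
    have hn := nf_path k S hq; have [n1 n2] := f3 _ hn.
    rewrite ind_singleE // asboolT; last exact/sim_sym/sim_nf.
    by apply: f2; apply: sim_nf.
  move=> p hp ns; have [n1 n2] := f3 _ hp; rewrite ind_singleE // asboolF //.
  by move/sim_sym.
rewrite hN // big_seq big1 // => p hp; have := hp.
rewrite mem_nfs => /and3P [h1 _ h2]; have [n1 n2] := f3 _ h1.
rewrite ind_singleE // asboolF // => /(sim_len Swf Sgr) e; lia.
Qed.

Lemma ind_hom_single p u j : is_path p -> U u -> gact (phead p, [::]) u = u ->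
  hom M j u -> hom ind (j + (plen p)%:Z) (ind_single p u).
Proof.
move=> hp hu eu hj q; rewrite ind_singleE //.
case: asboolP => [/(sim_len Swf Sgr) <-|_]; first by rewrite addrK.
exact: (subspace0 (hom_sub HM _)).
Qed.

Lemma ind_hom_sub j : subspace (hom ind j).
Proof.
split; first by move=> p; apply: (subspace0 (hom_sub HM _)).
by move=> a x y hx hy p; rewrite ind_val_lin; apply: (hom_sub HM _).2; [apply: hx|apply: hy].
Qed.

Lemma ind_is_gmod : is_gmod ind.
Proof.
have [Us Uv Ud] := HU.
split=> [j|]; first exact: ind_hom_sub.
split.
  move=> x; have [f1 f2 f3 [N f4]] := ind_valP x.
  (* Each value of [x] is split into homogeneous parts at the head of its path; the resulting
     tensors are then regrouped by degree, shifted by the length of the path. *)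
  have /choice [c cP] : forall p, exists c : seq (int * gcar M), is_path p ->
    (forall t, t \in c -> [/\ hom M t.1 t.2, U t.2 & gact (phead p, [::]) t.2 = t.2])
    /\ val x p = \sum_(t <- c) t.2.
    move=> p; case: (pselect (is_path p)) => [hp|np]; last by exists [::].
    have [n1 n2] := f3 p hp; have [c [cH cE]] := Ud _ n1.
    exists [seq (t.1, gact (phead p, [::]) t.2) | t <- c] => _; split.
      move=> _ /mapP [t tc ->] /=; have [t1 t2] := cH _ tc; split; [|exact: Uv|].
        by have := act_hom HM (p := (phead p, [::])) erefl t1; rewrite addr0.
      by rewrite (act_cat HM) // /composable.
    rewrite big_map /= -(lin_sum (act_lin HM (p := (phead p, [::])) erefl)) -cE.
    by rewrite n2.
  pose r := [seq (p, t) | p <- nfs N, t <- c p].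
  have [|d [d1 d2 d3]] := regroup ind_hom_sub (r := r) (d := fun y => y.2.1 + (plen y.1)%:Z)
     (F := fun y => ind_single y.1 y.2.2).
    move=> _ /allpairsPdep [p [t [hp ht ->]]] /=.
    by have [/(_ _ ht) [h1 h2 h3] _] := cP _ (nfs_path hp); apply: ind_hom_single => //; exact: nfs_path hp.
  exists d; split=> //; rewrite -d3 (ind_sum_single f4) big_allpairs_dep /=.
  rewrite big_seq [RHS]big_seq; apply: eq_bigr => p hp.
  have hp' := nfs_path hp; have [c1 c2] := cP _ hp'; have [n1 n2] := f3 _ hp'.
  apply: ind_ext => q hq; rewrite ind_val_sum ind_singleE // {1}c2.
  case: (asboolP (sim p q)) => [h|h].
    rewrite big_seq [RHS]big_seq; apply: eq_bigr => t /c1 [t1 t2 t3].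
    by rewrite ind_singleE // asboolT.
  rewrite big_seq big1 // => t /c1 [t1 t2 t3].
  by rewrite ind_singleE // asboolF.
split.
  move=> c uc ch c0 t tc; apply: ind_ext => p hp.
  (* Independence is tested at one path at a time, after shifting all degrees by its length. *)
  have := @hom_indep _ _ _ _ _ _ M HM [seq (t.1 - (plen p)%:Z, val t.2 p) | t <- c].
  move=> /(_ _ _ _ (t.1 - (plen p)%:Z, val t.2 p)) /=; apply.
  - rewrite -map_comp (eq_map (g := (fun i : int => i - (plen p)%:Z) \o fst)) //.
    by rewrite map_comp map_inj_uniq // => a b /addIr.
  - by move=> _ /mapP [t' tc' ->] /=; apply: ch.
  - by rewrite big_map /= -(ind_val_sum _ _ snd) c0.
  - by apply/mapP; exists t.
split.
  move=> b hb a x y; apply: ind_ext => q hq.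
  rewrite ind_actE // ind_val_lin !ind_actE //.
  by rewrite /ind_shift; case: pselect => // _; rewrite scaler0 addr0.
split.
  move=> b j x hb hx q; rewrite ind_actE //.
  case: (pselect (exists p, [/\ is_path p, composable b p & sim q (pcat b p)])).
    move=> [p [h1 h2 h3]]; rewrite (ind_shiftE (ind_valP x) hb h1 h2) //.
    have := hx p; congr (hom M _ _).
    by rewrite (sim_len Swf Sgr h3) plen_pcat; lia.
  move=> H; rewrite ind_shift0; first exact: (subspace0 (hom_sub HM _)).
  by move=> p' h1 h2 h3; apply: H; exists p'.
split.
  move=> b c x hb hc; apply: ind_ext => q hq; have hx := ind_valP x.
  have hcx := ind_shift_fun hc hx.
  rewrite ind_actE // ind_actE //; case: ifP => bc.
    have hbc : is_path (pcat b c) by rewrite is_path_pcat // hb.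
    rewrite ind_actE //.
    case: (pselect (exists p, [/\ is_path p, composable c p & sim q (pcat (pcat b c) p)])).
      move=> [p [h1 h2 h3]].
      have h2' : composable (pcat b c) p by rewrite composable_pcatl.
      rewrite (ind_shiftE hx hbc h1 h2') //.
      have hcp : is_path (pcat c p) by rewrite is_path_pcat // hc.
      rewrite (ind_shiftE hcx hb hcp) //; last by rewrite pcatA.
      by rewrite (ind_shiftE hx hc h1 h2) //; apply: sim_refl.
    move=> H; rewrite [RHS]ind_shift0; last first.
      by move=> p h1; rewrite composable_pcatl // => h2 h3; apply: H; exists p.
    case: (pselect (exists p, [/\ is_path p, composable b p & sim q (pcat b p)])).
      move=> [p [h1 h2 h3]]; rewrite (ind_shiftE hcx hb h1 h2) //.
      apply: ind_shift0 => p' g1 g2 g3; apply: H; exists p'; split=> //.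
      by apply: (sim_trans h3); rewrite -pcatA; apply: sim_catl.
    by move=> H'; apply: ind_shift0 => p' h1 h2 h3; apply: H'; exists p'.
  case: (pselect (exists p, [/\ is_path p, composable b p & sim q (pcat b p)])).
    move=> [p [h1 h2 h3]]; rewrite (ind_shiftE hcx hb h1 h2) //.
    apply: ind_shift0 => p' g1 g2 /(sim_tail Swf Sgr) g3.
    by move: h2 bc; rewrite /composable g3 ptail_pcat => ->.
  by move=> H'; apply: ind_shift0 => p' h1 h2 h3; apply: H'; exists p'.
split.
  move=> x; apply: ind_ext => q hq; rewrite ind_val_sum.
  have hx := ind_valP x.
  rewrite (bigD1 (ptail q)) //= big1 ?addr0.
    rewrite -[ind_mk _]/(gact (ptail q, [::]) x) ind_actE //.
    rewrite (ind_shiftE hx _ hq) ?id_pcat //; first by rewrite /composable.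
    exact: sim_refl.
  move=> v nv; rewrite -[ind_mk _]/(gact (v, [::]) x) ind_actE //.
  apply: ind_shift0 => p h1 h2 /(sim_tail Swf Sgr) h3.
  by rewrite h3 eqxx in nv.
move=> b c x Sbc; have [hb hc Et Eh] := Swf Sbc.
have hbc : sim b c.
  have := sim_gen k hb hc Sbc Et Eh (r := (ptail b, [::])) (s := (phead b, [::])).
  by rewrite !pcat_id !id_pcat //; apply=> //; rewrite /composable ?id_pcat.
apply: ind_ext => q hq; rewrite !ind_actE //; have hx := ind_valP x.
case: (pselect (exists p, [/\ is_path p, composable b p & sim q (pcat b p)])).
  move=> [p [h1 h2 h3]]; rewrite (ind_shiftE hx hb h1 h2) //.
  rewrite (ind_shiftE hx hc h1) //; first by rewrite /composable -Eh.
  by apply: (sim_trans h3); apply: sim_catr.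
move=> H; rewrite !ind_shift0 // => p h1 h2 h3; apply: H; exists p; split=> //.
  by rewrite /composable Eh.
by apply: (sim_trans h3); apply: sim_catr => //; apply: sim_sym.
Qed.

End Ind.
End Induced.

Section InducedMaps.
Variables (k : fieldType) (V E : finType) (tl hd : E -> V).
Variable S : qpath V E -> qpath V E -> Prop.
Local Notation qp := (qpath V E).
Local Notation is_path := (is_path tl hd).
Local Notation phead := (phead hd).
Local Notation composable := (composable hd).
Local Notation sim := (sim k tl hd S).
Local Notation gmod := (gmod k V E).
Local Notation is_gmod := (is_gmod tl hd S).
Local Notation hom M := (@ghom _ _ _ M).
Local Notation gmorph := (gmorph tl hd).
Local Notation nfs := (nfs k tl hd S).
Local Notation submod := (submod tl hd).
Hypotheses (Swf : S_wf tl hd S) (Sgr : S_graded S) (Hcan : cancellative k tl hd S).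
Implicit Types (p q r b : qp).

Definition gen_by (M : gmod) (U : gcar M -> Prop) (Q : gcar M -> Prop) : Prop :=
  forall u, Q u -> exists c : seq (qp * gcar M),
    (forall t, t \in c -> is_path t.1 /\ U t.2) /\
    u = \sum_(t <- c) gact t.1 t.2.

Section Lift.
Variables (M : gmod) (HM : is_gmod M) (U : gcar M -> Prop) (HU : vertex_stable U).
Local Notation ind := (ind HM HU).
Local Notation single := (@ind_single k V E tl hd S M HM U HU).

Definition ind_bound (x : gcar ind) : nat :=
  projT1 (cid (let: And4 _ _ _ h := ind_valP x in h)).

Lemma ind_boundP (x : gcar ind) p : (ind_bound x < plen p)%N -> val x p = 0.
Proof. by rewrite /ind_bound; case: cid => N /= H; apply: H. Qed.

Lemma ind_val_dom (x : gcar ind) p : is_path p ->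
  U (val x p) /\ gact (phead p, [::]) (val x p) = val x p.
Proof. by have [_ _ f3 _] := ind_valP x; apply: f3. Qed.

Lemma single_lin p a u v : is_path p -> U u -> gact (phead p, [::]) u = u ->
  U v -> gact (phead p, [::]) v = v ->
  single p (a *: u + v) = a *: single p u + single p v.
Proof.
move=> hp uU eu vU ev; have [Us _ _] := HU; apply: ind_ext => q hq.
rewrite ind_val_lin !ind_singleE //; try exact: Us.2.
  by case: asboolP => // _; rewrite scaler0 addr0.
by rewrite (act_lin HM) // eu ev.
Qed.

Lemma act_single b p u : is_path b -> is_path p -> composable b p ->
  U u -> gact (phead p, [::]) u = u ->
  gact b (single p u) = single (pcat b p) u.
Proof.
move=> hb hp bp hu eu; apply: ind_ext => q hq.
have hbp : is_path (pcat b p) by rewrite is_path_pcat // hb.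
rewrite (ind_actE Swf Sgr Hcan) // ind_singleE //; last by rewrite phead_pcat.
have hx := ind_valP (single p u).
case: asboolP => [h|h].
  rewrite (ind_shiftE Hcan hx hb hp bp); last exact: sim_sym.
  by rewrite ind_singleE // asboolT //; apply: sim_refl.
case: (pselect (exists p', [/\ is_path p', composable b p' & sim q (pcat b p')])).
  move=> [p' [h1 h2 h3]]; rewrite (ind_shiftE Hcan hx hb h1 h2 h3).
  rewrite ind_singleE // asboolF // => h4; apply: h; apply: sim_sym.
  by apply: (sim_trans h3); apply: sim_catl => //; apply: sim_sym.
by move=> H; apply: ind_shift0 => p' h1 h2 h3; apply: H; exists p'.
Qed.

Lemma single_act p u : is_path p -> U u -> gact (phead p, [::]) u = u ->
  single p u = gact p (single (phead p, [::]) u).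
Proof. by move=> hp hu eu; rewrite act_single // ?pcat_id // /composable. Qed.

Variables (N : gmod) (HN : is_gmod N) (tau : V -> gcar M -> gcar N).
Let Uv v u := U u /\ gact (v, [::]) u = u.
Hypothesis tau_lin : forall v a x y, Uv v x -> Uv v y ->
  tau v (a *: x + y) = a *: tau v x + tau v y.
Hypothesis tau_v : forall v x, Uv v x -> gact (v, [::]) (tau v x) = tau v x.
Hypothesis tau_hom : forall v x j, Uv v x -> hom M j x -> hom N j (tau v x).

Let tau0 v : tau v 0 = 0.
Proof.
have [Us _ _] := HU.
have U0 : Uv v 0 by split; [exact: subspace0|rewrite (act0 HM)].
by have := tau_lin (-1) U0 U0; rewrite scaler0 addr0 scaleN1r addNr.
Qed.

(** The extension to [A (x)_{A_0} U] of an [A_0]-linear map given by its components [tau v] on the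
    part of [U] at [v]. *)
Definition ind_lift (x : gcar ind) : gcar N :=
  \sum_(p <- nfs (ind_bound x)) gact p (tau (phead p) (val x p)).

Lemma ind_liftE (x : gcar ind) n : (forall p, (n < plen p)%N -> val x p = 0) ->
  ind_lift x = \sum_(p <- nfs n) gact p (tau (phead p) (val x p)).
Proof.
move=> hn; rewrite /ind_lift.
pose F p := if is_path p then gact p (tau (phead p) (val x p)) else 0.
have FE m : \sum_(p <- nfs m) gact p (tau (phead p) (val x p)) = \sum_(p <- nfs m) F p.
  by rewrite big_seq [RHS]big_seq; apply: eq_bigr => p /nfs_path hp; rewrite /F hp.
have F0 m : (forall p, (m < plen p)%N -> val x p = 0) ->
    forall p, (m < plen p)%N -> F p = 0.
  by move=> hm p hp; rewrite /F hm // tau0; case: ifP => // h; rewrite (act0 HN).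
have := @ind_boundP x; rewrite !FE; move: (ind_bound x) => m hm.
rewrite -(sum_nfs_le k tl hd S (leq_addr n m) (F0 _ hm)).
by rewrite -(sum_nfs_le k tl hd S (leq_addl m n) (F0 _ hn)).
Qed.

Lemma ind_lift_gmorph : gmorph ind_lift.
Proof.
split.
- move=> a x y; set n := (ind_bound x + ind_bound y)%N.
  have hx p : (n < plen p)%N -> val x p = 0 by move=> h; apply: ind_boundP; lia.
  have hy p : (n < plen p)%N -> val y p = 0 by move=> h; apply: ind_boundP; lia.
  rewrite (ind_liftE hx) (ind_liftE hy) (@ind_liftE _ n); last first.
    by move=> p h; rewrite ind_val_lin hx // hy // scaler0 addr0.
  rewrite scaler_sumr -big_split /= big_seq [RHS]big_seq; apply: eq_bigr => p /nfs_path hp.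
  have [x1 x2] := ind_val_dom x hp; have [y1 y2] := ind_val_dom y hp.
  by rewrite tau_lin // (act_lin HN).
- move=> j x hx; rewrite /ind_lift; apply: subspace_sum_seq; first exact: hom_sub HN _.
  move=> p /nfs_path hp _; have -> : j = j - (plen p)%:Z + (plen p)%:Z by rewrite subrK.
  apply: (act_hom HN) => //; apply: tau_hom; first exact: ind_val_dom.
  exact: hx.
- move=> b x hb; have hx := ind_valP x.
  have hn : forall q, (plen b + ind_bound x < plen q)%N -> val (gact b x) q = 0.
    move=> q hq; rewrite (ind_actE Swf Sgr Hcan) //.
    case: (pselect (exists p, [/\ is_path p, composable b p & sim q (pcat b p)])).
      move=> [p [h1 h2 h3]]; rewrite (ind_shiftE Hcan hx hb h1 h2 h3).
      apply: ind_boundP; have := sim_len Swf Sgr h3; rewrite plen_pcat; lia.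
    by move=> H; apply: ind_shift0 => p' h1 h2 h3; apply: H; exists p'.
  rewrite (ind_liftE hn) (ind_actE Swf Sgr Hcan) //.
  pose G q := if is_path q then gact q (tau (phead q) (ind_shift tl hd S b (val x) q)) else 0.
  transitivity (\sum_(q <- nfs (plen b + ind_bound x)) G q).
    by rewrite big_seq [RHS]big_seq; apply: eq_bigr => p /nfs_path hp; rewrite /G hp.
  rewrite (sum_nfs_shift Swf Sgr Hcan) //.
  + rewrite /ind_lift (lin_sum (act_lin HN hb)) big_mkcond big_seq [RHS]big_seq.
    apply: eq_bigr => p /nfs_path hp; rewrite (act_act HN) //; case: ifP => // c.
    rewrite /G is_path_pcat // hb hp /= phead_pcat //.
    by rewrite (ind_shiftE Hcan hx hb hp c) //; apply: sim_refl; rewrite is_path_pcat // hb.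
  + move=> p q h; rewrite /G (sim_pathl h) (sim_pathr h) (sim_head Swf Sgr h).
    have [_ f2 _ _] := ind_shift_fun Swf Sgr Hcan HM HU hb hx.
    by rewrite (f2 _ _ h) (act_sim Swf HN _ h).
  + move=> q hq H; rewrite /G hq ind_shift0 // tau0 (act0 HN) //.
Qed.

Lemma ind_lift_single p u : is_path p -> U u -> gact (phead p, [::]) u = u ->
  ind_lift (single p u) = gact p (tau (phead p) u).
Proof.
move=> hp hu eu; rewrite (@ind_liftE _ (plen p)); last first.
  move=> q hq; rewrite ind_singleE // asboolF // => /(sim_len Swf Sgr) h.
  by rewrite h ltnn in hq.
rewrite (sum_nfs1 Swf Sgr hp (leqnn _)); last first.
  by move=> q hq h; rewrite ind_singleE // asboolF // tau0 (act0 HN).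
have hs := sim_nf k S hp.
by rewrite ind_singleE // asboolT // -(sim_head Swf Sgr hs) -(act_sim Swf HN _ hs).
Qed.

End Lift.

Section Evaluation.
Variables (M : gmod) (HM : is_gmod M) (U : gcar M -> Prop) (HU : vertex_stable U).
Local Notation ind := (ind HM HU).
Local Notation single := (@ind_single k V E tl hd S M HM U HU).

Definition ind_ev : gcar ind -> gcar M := @ind_lift M HM U HU M (fun _ u => u).

Lemma ind_ev_gmorph : gmorph ind_ev.
Proof. by apply: ind_lift_gmorph => // v x []. Qed.

Lemma ind_evE (x : gcar ind) n : (forall p, (n < plen p)%N -> val x p = 0) ->
  ind_ev x = \sum_(p <- nfs n) gact p (val x p).
Proof. by move=> h; rewrite /ind_ev (ind_liftE HM _ h). Qed.

Lemma ind_ev_single p u : is_path p -> U u -> gact (phead p, [::]) u = u ->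
  ind_ev (single p u) = gact p u.
Proof. by move=> hp hu eu; rewrite /ind_ev ind_lift_single. Qed.

Lemma ind_ev_im (Q : gcar M -> Prop) : submod Q -> (forall u, U u -> Q u) -> gen_by U Q ->
  forall w, Q w <-> exists x, ind_ev x = w.
Proof.
move=> [Qs Qa] UQ gQ w; have [el _ ea] := ind_ev_gmorph; have [_ Uv _] := HU.
split=> [/gQ [c [cP ->]]|[x <-]].
  (* The idempotent moves the generator to the head of [t.1], which acts on it as before. *)
  exists (\sum_(t <- c) single t.1 (gact (phead t.1, [::]) t.2)).
  rewrite (lin_sum el) big_seq [RHS]big_seq; apply: eq_bigr => t /cP [t1 t2].
  rewrite ind_ev_single ?(act_idem HM) //; exact: Uv.
apply: subspace_sum_seq => // p /nfs_path hp _; apply: Qa => //; apply: UQ.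
by have [] := ind_val_dom x hp.
Qed.

Lemma ind_generated i : (forall u, U u -> hom M i%:Z u) -> generated_in_degree tl hd ind i.
Proof.
move=> hi x; exists [seq (p, single (phead p, [::]) (val x p)) | p <- nfs (ind_bound x)].
split.
  move=> _ /mapP [p /nfs_path hp ->] /=; split=> //; have [x1 x2] := ind_val_dom x hp.
  have := ind_hom_single Swf Sgr HM HU (p := (phead p, [::])) (u := val x p) (j := i%:Z).
  by rewrite addr0; apply=> //; apply: hi.
rewrite big_map {1}(ind_sum_single Swf Sgr (@ind_boundP _ HM _ HU x)).
rewrite big_seq [RHS]big_seq; apply: eq_bigr => p /nfs_path hp.
by have [x1 x2] := ind_val_dom x hp; rewrite single_act.
Qed.

(** As [U] lies in the single degree [i], a linear section of [g] in degree [i] at each vertex lifts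
    the values of [f] on generators; [ind_lift] extends this to the whole module. *)
Lemma ind_projective i : (forall u, U u -> hom M i u) -> gprojective tl hd S ind.
Proof.
move=> hi N N' g f HN HN' gm gsur fm.
have [fl fh fa] := fm; have [gl gh ga] := gm.
have tri : forall w : gcar N', True <-> exists u, g u = w.
  by move=> w; split=> // _; apply: gsur.
have sall (R : gmod) : submod (fun _ : gcar R => True) by [].
have /choice [s sP] := fun v => linear_on_section gl
   (dom_sub HN (sall N) i (Some v)) (dom_sub HN' (sall N') i (Some v))
   (fun w => @dom_lift _ _ _ _ _ _ _ _ HN' HN _ gm _ tri i (Some v) w).
pose tau v u := s v (f (single (v, [::]) u)).
have fd v u : U u /\ gact (v, [::]) u = u ->
    dom (fun _ : gcar N' => True) i (Some v) (f (single (v, [::]) u)).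
  move=> [hu eu]; split=> //.
    have := ind_hom_single Swf Sgr HM HU (p := (v, [::])) (u := u) (j := i).
    by rewrite addr0 => h; apply: fh; apply: h => //; apply: hi.
  by rewrite /= -fa // act_single // /composable.
have tl' : forall v a x y, U x /\ gact (v, [::]) x = x -> U y /\ gact (v, [::]) y = y ->
  tau v (a *: x + y) = a *: tau v x + tau v y.
  move=> v a x y hx hy; rewrite /tau single_lin //; try (by case: hx); try (by case: hy).
  by have [s1 s2 s3] := sP v; rewrite fl s1 //; apply: fd.
have tv' : forall v x, U x /\ gact (v, [::]) x = x -> gact (v, [::]) (tau v x) = tau v x.
  by move=> v x /fd h; have [s1 s2 s3] := sP v; case: (s2 _ h).
have th' : forall v x j, U x /\ gact (v, [::]) x = x -> hom M j x -> hom N j (tau v x).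
  move=> v x j hx hj; have [s1 s2 s3] := sP v; have [_ h _] := s2 _ (fd _ _ hx).
  (* An element homogeneous in two different degrees is 0, so only [j = i] matters. *)
  have [-> //|ne] := eqVneq j i.
  suff x0 : x = 0.
    have Us : subspace U by case: HU.
    have U0 : U 0 /\ gact (v, [::]) (0 : gcar M) = 0 by split; [exact: subspace0|rewrite (act0 HM)].
    have := tl' v (-1) _ _ U0 U0; rewrite scaler0 addr0 scaleN1r addNr => t0.
    by rewrite x0 t0; apply: (subspace0 (hom_sub HN _)).
  by apply: (hom_unique HM hj _ ne); apply: hi; case: hx.
have hm := ind_lift_gmorph HM HU HN tl' th'.
exists (@ind_lift M HM U HU N tau); split=> // x; have [hl hh ha] := hm.
rewrite (ind_sum_single Swf Sgr (@ind_boundP _ HM _ HU x)) (lin_sum hl) (lin_sum gl) (lin_sum fl).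
rewrite big_seq [RHS]big_seq; apply: eq_bigr => p /nfs_path hp.
have [x1 x2] := ind_val_dom x hp.
rewrite ind_lift_single // ga // /tau; have [s1 s2 s3] := sP (phead p).
by rewrite s3; [rewrite -fa // -single_act|apply: fd].
Qed.

End Evaluation.
End InducedMaps.

(** * Acyclicity of graded projectives *)

Section ProjectiveAcyclic.
Variables (k : fieldType) (V E : finType) (tl hd : E -> V).
Variable S : qpath V E -> qpath V E -> Prop.
Local Notation qp := (qpath V E).
Local Notation is_path := (is_path tl hd).
Local Notation phead := (phead hd).
Local Notation composable := (composable hd).
Local Notation sim := (sim k tl hd S).
Local Notation gmod := (gmod k V E).
Local Notation is_gmod := (is_gmod tl hd S).
Local Notation hom M := (@ghom _ _ _ M).
Local Notation okl := (okl tl hd).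
Local Notation gmorph := (gmorph tl hd).
Local Notation nfs := (nfs k tl hd S).
Local Notation submod := (submod tl hd).
Local Notation acyc := (acyc tl hd S).
Local Notation ldom := (ldom hd).
Hypotheses (Swf : S_wf tl hd S) (Sgr : S_graded S) (Hcan : cancellative k tl hd S).
Implicit Types (p q r b : qp) (l m : seq qp).

Variables (P : gmod) (HP : is_gmod P) (Pproj : gprojective tl hd S P).
Let all (u : gcar P) : Prop := True.

Lemma vertex_stable_all : vertex_stable all.
Proof.
split=> // u _; have [c [_ c2 c3]] := hom_dec HP u.
by exists c; split=> // t /c2.
Qed.

Local Notation F := (ind HP vertex_stable_all).
Local Notation ev := (@ind_ev k V E tl hd S P HP all vertex_stable_all).

(** Evaluation is onto, already through trivial paths, so projectivity splits it. *)
Lemma projective_section :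
  exists2 sg : gcar P -> gcar F, gmorph sg & forall u, ev (sg u) = u.
Proof.
have evm : gmorph ev by apply: ind_ev_gmorph.
have evsur y : exists x, ev x = y.
  suff H : forall w, all w <-> exists x, ev x = w by apply/H.
  apply: (ind_ev_im Swf Sgr Hcan) => // u _.
  exists [seq ((v, [::]), u) | v <- enum V]; split.
    by move=> _ /mapP [v _ ->].
  by rewrite big_map /= big_enum /= (act_one HP).
have idm : gmorph (id : gcar P -> gcar P) by [].
have FG := ind_is_gmod Swf Sgr Hcan HP vertex_stable_all.
have [sg [sm sE]] := Pproj FG HP evm evsur idm.
by exists sg.
Qed.

(* A section [sg] of the evaluation A (x)_{A_0} P -> P contracts the complex: split
   off the trivial paths from [sg u] and append the remaining ones to the list. *)
Lemma projective_acyc n j : acyc all n.+1 j.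
Proof.
have [sg [sl sh sa] sE] := projective_section.
have HA : submod all by [].
move=> f cf zf.
(* The test discards trivial paths, in keeping with the normalized complex, and paths that do not
   compose with the list. *)
pose T l p (x : gcar F) : k := if okl (p :: l) then f (p :: l) (val x p) else 0.
pose sf l u := \sum_(p <- nfs (ind_bound (sg u))) T l p (sg u).
have dsg l u p : is_path p -> ldom all j l u -> ldom all j (p :: l) (val (sg u) p).
  move=> hp [_ hu _]; split=> //; last by have [_ h] := ind_val_dom (sg u) hp.
  have := sh _ _ hu p; congr (hom P _ _); rewrite tlen_cons; lia.
have T0 l p x : size l = n -> val x p = 0 -> T l p x = 0.
  by move=> sl' x0; rewrite /T x0; case: ifP => // ok; apply: (cochain0 HP HA cf) => //=; rewrite sl'.
have sfE l u N : size l = n -> (forall p, (N < plen p)%N -> val (sg u) p = 0) ->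
    sf l u = \sum_(p <- nfs N) T l p (sg u).
  move=> sl' hN; have hb := @ind_boundP _ _ _ _ _ _ _ HP _ vertex_stable_all (sg u).
  rewrite /sf; move: (ind_bound _) hb => m hm.
  rewrite -(sum_nfs_le k tl hd S (leq_addr N m)); last by move=> p /hm; apply: T0.
  by rewrite -(sum_nfs_le k tl hd S (leq_addl m N)) // => p /hN; apply: T0.
exists sf.
  split.
    move=> l a u v ok sl' du dv; set N := (ind_bound (sg u) + ind_bound (sg v))%N.
    have hu p : (N < plen p)%N -> val (sg u) p = 0 by move=> h; apply: ind_boundP; lia.
    have hv p : (N < plen p)%N -> val (sg v) p = 0 by move=> h; apply: ind_boundP; lia.
    rewrite (sfE _ u N) // (sfE _ v N) // (sfE _ _ N) //; last first.
      by move=> p h; rewrite sl ind_val_lin hu // hv // scaler0 addr0.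
    rewrite mulr_sumr -big_split /= big_seq [RHS]big_seq; apply: eq_bigr => p /nfs_path hp.
    rewrite /T; case: ifP => okp; last by rewrite mulr0 addr0.
    by rewrite sl ind_val_lin cf.1 //=; [rewrite sl'|apply: dsg|apply: dsg].
  move=> l m u ok hs sl' du; rewrite /sf big_seq [RHS]big_seq.
  apply: eq_bigr => p /nfs_path hp; rewrite /T.
  have hs' : lsim k tl hd S (p :: l) (p :: m) by split=> //; apply: sim_refl.
  have -> : okl (p :: m) = okl (p :: l).
    apply/idP/idP; first exact: (lsim_okl Swf Sgr (lsim_sym hs')).
    exact: (lsim_okl Swf Sgr hs').
  by case: ifP => okp //; apply: cf.2 => //=; [rewrite sl'|apply: dsg].
move=> [|b l] u ok // [sl'] du; rewrite delta_cons.
have hb := okl_path ok; set x := sg u; set N := ind_bound x.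
have hN p : (N < plen p)%N -> val x p = 0 by apply: ind_boundP.
have hx := ind_valP x.
(* As [u] is fixed by the idempotent at the head of [b], all paths in the support of [sg u] start
   there. *)
have x0 p : is_path p -> ~~ composable b p -> val x p = 0.
  move=> hp nc; have eu : gact (phead b, [::]) u = u by case: du.
  rewrite /x -eu sa // (ind_actE Swf Sgr Hcan) //.
  apply: ind_shift0 => q h1 h2 /(sim_tail Swf Sgr) h3.
  by move: nc; rewrite /composable h3 /= eqxx.
have okb p : is_path p -> composable b p -> okl (pcat b p :: l).
  move=> hp c; move: ok; rewrite !okl_cons => /and4P [_ b0 bl ->].
  by rewrite is_path_pcat // hb hp plen_pcat addn_gt0 b0 /= bl.
have -> : sf l (gact b u) =
    \sum_(p <- nfs N | composable b p) f (pcat b p :: l) (val x p).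
  rewrite (sfE _ _ (plen b + N)%N) //; last first.
    move=> q hq; rewrite sa // (ind_actE Swf Sgr Hcan) //.
    case: (pselect (exists p, [/\ is_path p, composable b p & sim q (pcat b p)])).
      move=> [p [h1 h2 h3]]; rewrite (ind_shiftE Hcan hx hb h1 h2 h3); apply: hN.
      by have := sim_len Swf Sgr h3; rewrite plen_pcat; lia.
    by move=> H; apply: ind_shift0 => p' h1 h2 h3; apply: H; exists p'.
  rewrite sa //.
  rewrite (sum_nfs_shift Swf Sgr Hcan) //.
  - rewrite big_seq_cond [RHS]big_seq_cond; apply: eq_bigr => p /andP [/nfs_path hp c].
    rewrite /T okb // (ind_actE Swf Sgr Hcan) // (ind_shiftE Hcan hx hb hp c) //.
    by apply: sim_refl; rewrite is_path_pcat // hb.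
  - move=> p q h; rewrite /T.
    have hv : val (gact b x) p = val (gact b x) q.
      by have [_ h2 _ _] := ind_valP (gact b x); apply: h2.
    have okE : okl (p :: l) = okl (q :: l).
      rewrite !okl_cons (sim_pathl h) (sim_pathr h) (sim_len Swf Sgr h).
      by rewrite (sim_tail Swf Sgr h).
    rewrite okE; case: ifP => // okq; rewrite -hv; apply: cf.2; rewrite ?okE //.
    + by split=> //; apply: lsim_refl; apply: okl_tl ok.
    + by rewrite /= sl'.
    + rewrite /x -sa //; apply: dsg; first exact: sim_pathl h.
      exact: (ldom_act HP HA ok du).
  - move=> q hq H; apply: T0 => //; rewrite (ind_actE Swf Sgr Hcan) //.
    exact: ind_shift0.
(* For nontrivial [p] this is the cocycle condition on the list extended by [p]; for trivial [p] the
   left side has no term and the two terms on the right agree. *)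
have -> : mrg (fun m => sf m u) (b :: l) =
    \sum_(p <- nfs N | composable b p)
      (f (pcat b p :: l) (val x p) - f (b :: l) (gact p (val x p))).
  rewrite /sf mrg_sum [RHS]big_mkcond /= big_seq [RHS]big_seq.
  apply: eq_bigr => p /nfs_path hp.
  have okm m : m \in merges (b :: l) -> okl (p :: m) = okl [:: p, b & l].
    move=> /(mergesP ok) [m1 m2 _].
    by rewrite (okl_cons _ _ p m) (okl_cons _ _ p (b :: l)) m1 m2 ok.
  have dp := dsg _ _ _ hp du.
  have okpb : okl [:: p, b & l] = (0 < plen p)%N && composable b p.
    by rewrite okl_cons ok hp andbT.
  have [okp|okp] := boolP (okl [:: p, b & l]).
    have := okp; rewrite okpb => /andP [_ ->].
    have sz : size [:: p, b & l] = n.+2 by rewrite /= sl'.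
    have := zf _ _ okp sz dp; rewrite delta_cons mrg2 => /eqP; rewrite subr_eq0 => /eqP ->.
    rewrite opprB addrCA subrr addr0; apply: eq_mrg => m hm.
    by rewrite /T okm // okp.
  rewrite (eq_mrg (G := fun=> 0)) ?mrg0; last by move=> m hm; rewrite /T okm // (negPf okp).
  case: ifP => // c; move: okp; rewrite okpb c andbT -eqn0Ngt => /eqP p0.
  have e : p = (phead b, [::]).
    by case: (p) c p0 => v [|? ?] //= /eqP ->.
  rewrite e pcat_id; have := ind_val_dom x hp; rewrite e => -[_ ->].
  by rewrite subrr.
rewrite -sumrB; under eq_bigr do rewrite opprB addrCA subrr addr0.
rewrite -big_filter -(cochain_sum HP HA cf) //=; last 2 first.
- by rewrite sl'.
- move=> p; rewrite mem_filter => /andP [c /nfs_path hp]; have [_ h1 _] := dsg _ _ _ hp du.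
  split=> //; last by rewrite /= (eqP c) (act_tail HP).
  have := act_hom HP hp h1; congr (hom P _ _); rewrite !tlen_cons; lia.
congr (f _ _); rewrite big_filter -[RHS]sE -/x (ind_evE hN).
rewrite big_mkcond /= big_seq [RHS]big_seq; apply: eq_bigr => p /nfs_path hp.
by case: ifP => // /negbT c; rewrite x0 // (act0 HP).
Qed.

End ProjectiveAcyclic.

(** * Linear resolutions *)

Section Resolution.
Variables (k : fieldType) (V E : finType) (tl hd : E -> V).
Variable S : qpath V E -> qpath V E -> Prop.
Local Notation qp := (qpath V E).
Local Notation is_path := (is_path tl hd).
Local Notation phead := (phead hd).
Local Notation composable := (composable hd).
Local Notation gmod := (gmod k V E).
Local Notation is_gmod := (is_gmod tl hd S).
Local Notation hom M := (@ghom _ _ _ M).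
Local Notation okl := (okl tl hd).
Local Notation gmorph := (gmorph tl hd).
Local Notation submod := (submod tl hd).
Local Notation cochain := (cochain tl hd S).
Local Notation acyc := (acyc tl hd S).
Local Notation ldom := (ldom hd).
Local Notation gen_by := (gen_by tl hd).
Local Notation A0 := (A0 k V E).
Hypotheses (Swf : S_wf tl hd S) (Sgr : S_graded S) (Hcan : cancellative k tl hd S).
Implicit Types (p q r b : qp) (l m : seq qp) (M : gmod).

(** A 0-cocycle kills every [p u] with [p] nontrivial, and in degree [j != i] a submodule generated
    in degree [i] consists of sums of such elements. *)
Lemma gen_acyc0 M (Q : gcar M -> Prop) (i j : int) : is_gmod M -> submod Q ->
  gen_by (fun u => Q u /\ hom M i u) Q -> j != i -> acyc Q 0 j.
Proof.
move=> HM HQ gQ ne f cf zf; exists (fun _ _ => 0).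
  by split=> *; rewrite ?mulr0 ?addr0.
move=> [|//] u _ _ du; rewrite /delta; symmetry.
have [c [cP uE]] := gQ _ (let: And3 h _ _ := du in h).
have hc t : t \in c -> hom M (i + (plen t.1)%:Z) (gact t.1 t.2).
  by move=> /cP [t1 [_ t2]]; apply: (act_hom HM).
have uj : hom M j (\sum_(t <- c) gact t.1 t.2).
  by rewrite -uE; case: du => _; rewrite subr0.
rewrite uE -(hom_component HM hc uj) -big_filter.
have key t : t \in c -> i + (plen t.1)%:Z = j ->
    okl [:: t.1] /\ ldom Q j [:: t.1] (gact (phead t.1, [::]) t.2).
  move=> /cP [t1 [t2 t3]] e; split.
    rewrite okl_cons t1 /= andbT lt0n; apply/eqP => p0.
    by move: ne; rewrite -e p0 addr0 eqxx.
  split; first exact: HQ.2.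
    have -> : j - (tlen [:: t.1])%:Z = i + (plen (phead t.1, [::] : seq E))%:Z.
      by rewrite tlen_cons /tlen /= addn0 -e /plen /=; lia.
    exact: (act_hom HM).
  by rewrite /= (act_cat HM) // /composable.
rewrite (cochain_sum HM HQ cf) //.
  rewrite big_seq big1 // => t; rewrite mem_filter => /andP [/eqP e tc].
  have [ok dt] := key _ tc e; have [t1 _] := cP _ tc.
  by have := zf _ _ ok erefl dt; rewrite delta_cons mrg1 subr0 (act_idem HM).
move=> t; rewrite mem_filter => /andP [/eqP e tc]; have [t1 [t2 t3]] := cP _ tc.
by split=> //; [exact: HQ.2|rewrite subr0 -e; apply: hc].
Qed.

Definition graded_sub M (Q : gcar M -> Prop) : Prop :=
  forall u, Q u -> exists c : seq (int * gcar M),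
     (forall t, t \in c -> hom M t.1 t.2 /\ Q t.2) /\ u = \sum_(t <- c) t.2.

(* Graded Nakayama: a functional on [Q] killing [A_+ Q] is a cocycle. *)
Lemma acyc0_gen M (Q : gcar M -> Prop) (i : int) : is_gmod M -> submod Q ->
  graded_sub Q -> (forall j u, (j < i)%R -> Q u -> hom M j u -> u = 0) ->
  (forall j, j != i -> acyc Q 0 j) ->
  gen_by (fun u => Q u /\ hom M i u) Q.
Proof.
move=> HM HQ gQ Qlow aQ.
pose G (u : gcar M) := exists c : seq (qp * gcar M),
    (forall t, t \in c -> is_path t.1 /\ (Q t.2 /\ hom M i t.2)) /\
    u = \sum_(t <- c) gact t.1 t.2.
have G0 : G 0 by exists [::]; split=> //; rewrite big_nil.
have GD u v : G u -> G v -> G (u + v).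
  move=> [c [c1 ->]] [d [d1 ->]]; exists (c ++ d); split; last by rewrite big_cat.
  by move=> t; rewrite mem_cat => /orP [/c1|/d1].
have Gsum (I : eqType) (r : seq I) (F : I -> gcar M) :
    (forall x, x \in r -> G (F x)) -> G (\sum_(x <- r) F x).
  by move=> h; rewrite big_seq; apply: big_ind.
have Gact b u : is_path b -> G u -> G (gact b u).
  move=> hb [c [c1 ->]]; rewrite (lin_sum (act_lin HM hb)).
  apply: Gsum => t /c1 [t1 t2]; rewrite (act_act HM) //; case: ifP => // bt.
  exists [:: (pcat b t.1, t.2)]; split; last by rewrite big_seq1.
  by move=> x; rewrite inE => /eqP -> /=; rewrite is_path_pcat // hb.
have step n u : Q u -> hom M (i + n%:Z) u -> G u.
  elim/ltn_ind: n u => n IH u Qu hu; have [n0|n0] := eqVneq n 0%N.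
    exists [seq ((v, [::]), u) | v <- enum V]; split.
      by move=> _ /mapP [v _ ->] /=; split=> //; split=> //; rewrite n0 addr0 in hu.
    by rewrite big_map /= big_enum /= (act_one HM).
  (* [T] is [A_+ Q] with a degree recorded for each coefficient, so that the induction on the degree
     applies to the coefficients. *)
  pose T (u : gcar M) := exists c : seq (qp * (int * gcar M)),
    (forall t, t \in c -> [/\ is_path t.1, (0 < plen t.1)%N, hom M t.2.1 t.2.2 & Q t.2.2])
    /\ u = \sum_(t <- c) gact t.1 t.2.2.
  have Ts : subspace T.
    split; first by exists [::]; split=> //; rewrite big_nil.
    move=> a x y [c [c1 ->]] [d [d1 ->]].
    exists ([seq (t.1, (t.2.1, a *: t.2.2)) | t <- c] ++ d); split.
      move=> t; rewrite mem_cat => /orP [/mapP [t' /c1 [t1 t2 t3 t4] ->]|/d1 //].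
      split=> //=; first by apply: (subspaceZ (hom_sub HM _)).
      by apply: subspaceZ => //; case: HQ.
    rewrite big_cat /= big_map scaler_sumr; congr (_ + _).
    rewrite big_seq [RHS]big_seq; apply: eq_bigr => t /c1 [t1 _ _ _].
    by rewrite (linZ (act_lin HM t1)).
  have Tu : T u.
    apply: contrapT => nT; have [phi [pl pT pu]] := separating_functional Ts nT.
    have ne : i + n%:Z != i by apply/negP => /eqP; lia.
    have cphi : cochain Q 0 (i + n%:Z) (fun _ x => phi x) by split=> // *; rewrite pl.
    have [|g _ gE] := aQ _ ne _ cphi.
      move=> [|b [|//]] x ok // _ [x1 x2 x3]; rewrite delta_cons mrg1 subr0.
      apply: pT; exists [:: (b, (i + n%:Z - (tlen [:: b])%:Z, x))].
      split; last by rewrite big_seq1.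
      move=> t; rewrite inE => /eqP -> /=; split=> //; first exact: okl_path ok.
      exact: okl_pos ok.
    have := gE [::] u erefl erefl; rewrite /ldom /= subr0 pu => H.
    have /eqP : (0 : k) = 1 by apply: H.
    by rewrite eq_sym oner_eq0.
  have [c [c1 uE]] := Tu.
  have hc t : t \in c -> hom M (t.2.1 + (plen t.1)%:Z) (gact t.1 t.2.2).
    by move=> /c1 [t1 t2 t3 t4]; apply: (act_hom HM).
  rewrite uE in hu *; rewrite -(hom_component HM hc hu) -big_filter.
  apply: Gsum => t; rewrite mem_filter => /andP [/eqP e /c1 [t1 t2 t3 t4]].
  apply: Gact => //; have [lt|ge] := Order.TotalTheory.ltP t.2.1 i.
    by rewrite (Qlow _ _ lt t4 t3).
  apply: (IH (n - plen t.1)%N) => //; first lia.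
  by have -> : i + (n - plen t.1)%:Z = t.2.1 by lia.
move=> u /gQ [c [c1 ->]]; apply: Gsum => t /c1 [t1 t2].
have [lt|ge] := Order.TotalTheory.ltP t.1 i; first by rewrite (Qlow _ _ lt t2 t1).
by apply: (step `|t.1 - i|%N) => //; have -> : i + `|t.1 - i|%:Z = t.1 by lia.
Qed.

Lemma uniq_map_inj (T T' : eqType) (f : T -> T') (s : seq T) x y :
  uniq (map f s) -> x \in s -> y \in s -> f x = f y -> x = y.
Proof.
elim: s => // z s IH /= /andP [nz us]; rewrite !inE.
case/orP=> [/eqP ->|xs] /orP [/eqP ->|ys] e //; last exact: IH.
  by move: nz; rewrite e map_f.
by move: nz; rewrite -e map_f.
Qed.

Lemma A0_is_gmod : is_gmod A0.
Proof.
split.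
  move=> j; split; first by right.
  move=> a u v [->|->] [e|->]; try by left.
  by right; rewrite scaler0 addr0.
split.
  move=> u; exists [:: (0, u)]; split=> //; last by rewrite big_seq1.
  by move=> t; rewrite inE => /eqP -> /=; left.
split.
  move=> c uc ch c0 t tc; have [t0|//] := ch _ tc.
  move: c0; rewrite (bigD1_seq t) //=; last exact: map_uniq uc.
  rewrite big_seq_cond big1 ?addr0 // => t' /andP [tc' ne].
  have [t0'|//] := ch _ tc'; case/eqP: ne.
  by apply: (uniq_map_inj uc); rewrite // t0 t0'.
split.
  move=> [v [|b s]] _ a x y /=; last by rewrite scaler0 addr0.
  apply/ffunP => w; rewrite !ffunE; case: eqP => // _; by rewrite scaler0 addr0.
split.
  move=> [v [|b s]] j u _ hu; last by right.
  case: hu => [->|->]; first by left.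
  by right; apply/ffunP => w; rewrite !ffunE; case: eqP.
split.
  move=> [v s] [w t] u hp hq; case: s hp => [|b s] hp.
    case: t hq => [|c t] hq; last first.
      rewrite /gact /= /pcat /=; case: ifP => // _; apply/ffunP => x; rewrite !ffunE;
        by case: eqP.
    rewrite /gact /= /pcat /= /composable /phead /= /ptail /=.
    have [->|ne] := eqVneq v w; first by apply/ffunP => x; rewrite !ffunE; case: (x == w).
    rewrite /=; apply/ffunP => x; rewrite !ffunE.
    by have [->|//] := eqVneq x v; rewrite (negPf ne).
  rewrite /gact /=; case: ifP => //.
split.
  move=> u; apply/ffunP => w; rewrite sum_ffunE (bigD1 w) //= ffunE eqxx big1 ?addr0 //.
  by move=> v ne; rewrite ffunE eq_sym (negPf ne).
move=> p q u Spq; have [hp hq Et Eh] := Swf Spq; have := Sgr Spq.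
by case: p q hp hq Et Eh {Spq} => [v [|a s]] [w [|b t]] //= _ _ ->.
Qed.

Lemma submod_kernel M N (f : gcar M -> gcar N) : is_gmod N -> gmorph f ->
  submod (fun u => f u = 0).
Proof. by move=> HN fm; exact: (submod_ker HN fm). Qed.

Lemma graded_kernel M N (f : gcar M -> gcar N) : is_gmod M -> is_gmod N -> gmorph f ->
  graded_sub (fun u => f u = 0).
Proof.
move=> HM HN [fl fh fa] u fu; have [c [c1 c2 c3]] := hom_dec HM u.
exists c; split=> // t tc; split; first exact: c2.
have H : forall x, x \in [seq (t.1, f t.2) | t <- c] -> x.2 = 0.
  apply: (hom_indep HN); first by rewrite -map_comp.
    by move=> _ /mapP [t' tc' ->]; apply: fh; apply: c2.
  by rewrite big_map /= -(lin_sum fl) -c3.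
by apply: (H (t.1, f t.2)); apply: map_f.
Qed.

Lemma gen_image M N (f : gcar M -> gcar N) (Q : gcar N -> Prop) (i : nat) : gmorph f ->
  generated_in_degree tl hd M i -> (forall w, Q w <-> exists u, f u = w) ->
  gen_by (fun u => Q u /\ hom N i%:Z u) Q.
Proof.
move=> [fl fh fa] gM Qim w /Qim [u <-]; have [c [c1 ->]] := gM u.
exists [seq (t.1, f t.2) | t <- c]; split.
  move=> _ /mapP [t /c1 [t1 t2] ->] /=; split=> //; split; last exact: fh.
  by apply/Qim; exists t.2.
rewrite (lin_sum fl) big_map big_seq [RHS]big_seq; apply: eq_bigr => t /c1 [t1 t2].
exact: fa.
Qed.

Lemma koszul_acyc : koszul k tl hd S ->
  forall n j, j != n%:Z -> acyc (fun _ : gcar A0 => True) n j.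
Proof.
move=> [P [eps [d [HP [em [dm [esur [ed dd]]]]]]]].
have PG i : is_gmod (P i) by case: (HP i).
have PP i : gprojective tl hd S (P i) by case: (HP i).
have Pg i : generated_in_degree tl hd (P i) i by case: (HP i).
pose K i : gcar (P i) -> Prop :=
  if i is i'.+1 as i0 return gcar (P i0) -> Prop then fun u => d i' u = 0
  else fun u => eps u = 0.
have Kim i w : K i w <-> exists u, d i u = w by case: i w => [|i] w; [apply: ed|apply: dd].
have Aim (w : gcar A0) : True <-> exists u, eps u = w by split.
(* The kernel [K i] is generated in degree [i + 1], so its diagonal is [j = n + i + 1]. All syzygies
   are treated together, since dimension shifting lowers [n] at the price of passing to the next
   one. *)
suff H n : (forall j, j != n%:Z -> acyc (fun _ : gcar A0 => True) n j) /\
    (forall i j, j != n%:Z + i%:Z + 1 -> acyc (@K i) n j).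
  by move=> n j; case: (H n) => h _; apply: h.
elim: n => [|n [IH1 IH2]]; split.
- move=> j hj; apply: (gen_acyc0 A0_is_gmod _ (gen_image em (Pg 0%N) Aim)) => //.
- move=> i j hj; have HK : submod (@K i).
    by case: i {hj} => [|i]; apply: submod_kernel => //; apply: A0_is_gmod.
  apply: (gen_acyc0 (PG i) HK (gen_image (dm i) (Pg i.+1) (@Kim i))).
  by apply: contraNneq hj => ->; apply/eqP; lia.
- move=> j hj; apply: (acyc_from_ker Swf Sgr A0_is_gmod (PG 0%N) em Aim) => //.
    exact: projective_acyc.
  apply: (IH2 0%N); apply: contraNneq hj => ->; apply/eqP; lia.
- move=> i j hj; apply: (acyc_from_ker Swf Sgr (PG i) (PG i.+1) (dm i) (@Kim i)) => //.
    exact: projective_acyc.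
  apply: (IH2 i.+1); apply: contraNneq hj => ->; apply/eqP; lia.
Qed.

Definition degree_part M (Q : gcar M -> Prop) (i : nat) (u : gcar M) : Prop :=
  Q u /\ hom M i%:Z u.

Lemma degree_part_stable M (Q : gcar M -> Prop) i : is_gmod M -> submod Q ->
  vertex_stable (degree_part Q i).
Proof.
move=> HM HQ; split.
- split; first by split; [apply: subspace0; case: HQ|apply: (subspace0 (hom_sub HM _))].
  move=> a u v [u1 u2] [v1 v2]; split; first by apply: HQ.1.2.
  by apply: (hom_sub HM _).2.
- move=> v u [u1 u2]; split; first exact: HQ.2.
  by have := act_hom HM (p := (v, [::])) erefl u2; rewrite addr0.
- move=> u hu; exists [:: (i%:Z, u)]; split; last by rewrite big_seq1.
  by move=> t; rewrite inE => /eqP ->; case: (hu).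
Qed.

(* [sQ] is the current syzygy, a submodule of the last module [smod] of the resolution. *)
Record stage := Stage {
  smod : gmod; sok : is_gmod smod;
  sQ : gcar smod -> Prop; sQsub : submod sQ }.

Definition stage0 : stage :=
  @Stage A0 A0_is_gmod (fun _ => True) (conj (conj I (fun _ _ _ _ _ => I)) (fun _ _ _ _ => I)).

Section Next.
Variables (i : nat) (s : stage).

Let HU := degree_part_stable i (sok s) (sQsub s).

Definition next_mod : gmod := ind (sok s) HU.
Definition next_map : gcar next_mod -> gcar (smod s) := @ind_ev k V E tl hd S _ (sok s) _ HU.

Lemma next_ok : is_gmod next_mod. Proof. exact: ind_is_gmod. Qed.
Lemma next_morph : gmorph next_map. Proof. exact: ind_ev_gmorph. Qed.

Definition next_stage : stage :=
  Stage next_ok (submod_kernel (sok s) next_morph).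

(** The [i]-th syzygy starts in degree [i] and inherits the vanishing shifted by [i]; by graded
    Nakayama it is then generated in degree [i]. *)
Definition stage_inv : Prop :=
  [/\ graded_sub (@sQ s), (forall j u, (j < i%:Z)%R -> sQ u -> hom (smod s) j u -> u = 0)
    & (forall n j, j != n%:Z + i%:Z -> acyc (@sQ s) n j)].

Hypothesis Hinv : stage_inv.

Lemma next_projective : gprojective tl hd S next_mod.
Proof. by apply: (ind_projective Swf Sgr Hcan (i := i%:Z)) => u []. Qed.

Lemma next_generated : generated_in_degree tl hd next_mod i.
Proof. by apply: (ind_generated Swf Sgr Hcan) => u []. Qed.

Lemma next_im w : sQ w <-> exists x, next_map x = w.
Proof.
case: Hinv => gQ low aQ.
apply: (ind_ev_im Swf Sgr Hcan) => [|u []//|]; first exact: sQsub.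
apply: acyc0_gen => //; [exact: sok|exact: sQsub|].
by move=> j hj; apply: aQ; rewrite add0r.
Qed.

(** The cover vanishes below degree [i], and in degree [i] it consists of tensors with trivial
    paths, on which evaluation is injective; so the kernel starts in degree [i + 1]. *)
Lemma next_low j (x : gcar next_mod) : (j < (i.+1)%:Z)%R -> next_map x = 0 ->
  hom next_mod j x -> x = 0.
Proof.
move=> hj x0 hx.
have vz p : is_path p -> j != (plen p)%:Z + i%:Z -> val x p = 0.
  move=> hp ne; have [[_ h1] _] := ind_val_dom x hp.
  apply: (hom_unique (sok s) (hx p) h1); apply: contraNneq ne => e; apply/eqP; lia.
apply: ind_ext => p hp; rewrite [RHS](_ : _ = 0) //.
have [e|] := eqVneq j ((plen p)%:Z + i%:Z); last exact: vz.
have p0 : plen p = 0%N by lia.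
have {e hj} ji : j = i%:Z by lia.
have xb q : (0 < plen q)%N -> val x q = 0.
  move=> hq; have [hq'|/negP nq] := boolP (is_path q); last first.
    by have [h _ _ _] := ind_valP x; apply: h.
  by apply: vz => //; apply/negP => /eqP; lia.
have pE : p = (phead p, [::]) by case: (p) p0 => v [].
(* Acting by the trivial path [p] on the evaluation of [x] isolates the value of [x] at [p]. *)
have := x0; rewrite /next_map (ind_evE xb) => /(congr1 (gact p)).
rewrite (act0 (sok s)) // (lin_sum (act_lin (sok s) hp)).
have hn := sim_nf k S hp.
rewrite (sum_nfs1 Swf Sgr hp); rewrite ?p0 //; last first.
  move=> q hq nq; have [q0|q0] := posnP (plen q); last first.
    by rewrite xb // !(act0 (sok s)).
  rewrite (act_act (sok s)) //; case: ifP => // /eqP e; case: nq.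
  have <- : p = q by case: (p) (q) p0 q0 e => v [] // [w []] // _ _ e; rewrite (e : v = w).
  exact: sim_refl.
have [_ h2 _ _] := ind_valP x; rewrite -(h2 _ _ hn).
rewrite -(act_sim Swf (sok s) _ hn) (act_cat (sok s)) //; last first.
  by rewrite pE /composable.
rewrite {2}pE pcat_id; have [_ h3] := ind_val_dom x hp.
by rewrite -h3 {1}[p]pE (act_cat (sok s)) // ?pcat_id // /composable.
Qed.

(** Dimension shifting along the cover, which is acyclic in positive cohomological degree by
    projectivity and in degree 0 off the diagonal by its generation. *)
Lemma next_acyc n j : j != n%:Z + (i.+1)%:Z ->
  acyc (fun x : gcar next_mod => next_map x = 0) n j.
Proof.
case: Hinv => gQ low aQ hj; have HK := submod_kernel (sok s) next_morph.
(* At [n = 0] and [j = i] the cover itself may have cohomology and shifting does not apply; there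
   the kernel has no non-zero element of degree [i]. *)
have [/andP [/eqP n0 /eqP ji]|nn] := boolP ((n == 0)%N && (j == i%:Z)).
  rewrite n0 ji => f cf _.
  exists (fun _ _ => 0); first by split=> *; rewrite ?mulr0 ?addr0.
  move=> [|//] u ok _ [u1 u2 _]; rewrite subr0 in u2.
  by rewrite (next_low _ u1 u2) ?(cochain0 next_ok HK cf) //; lia.
apply: (acyc_of_ker Swf Sgr (sok s) next_ok next_morph next_im).
  case: n hj nn => [|n] hj nn; last exact: projective_acyc next_ok next_projective _ _.
  apply: (gen_acyc0 (i := i%:Z) next_ok) => // u _.
  have [c [c1 cE]] := next_generated u; exists c; split=> // t /c1 [t1 t2].
  by [].
by apply: aQ; apply: contraNneq hj => ->; apply/eqP; lia.
Qed.

End Next.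

Fixpoint stages (i : nat) : stage :=
  if i is i'.+1 then next_stage i' (stages i') else stage0.

Lemma acyc_koszul :
  (forall n j, j != n%:Z -> acyc (fun _ : gcar A0 => True) n j) -> koszul k tl hd S.
Proof.
move=> H.
have inv i : stage_inv i (stages i).
  elim: i => [|i IH].
    split; first by move=> u _; have [c [_ c1 c2]] := hom_dec A0_is_gmod u; exists c; split=> // t /c1.
      by move=> j u hj _ [e|//]; rewrite e Order.POrderTheory.ltxx in hj.
    by move=> n j hj; apply: H; rewrite addr0 in hj.
  split.
  - apply: graded_kernel; [exact: next_ok|exact: sok|exact: next_morph].
  - by move=> j u hj u0 hu; apply: (next_low hj u0 hu).
  - by move=> n j; apply: next_acyc.
exists (fun i => next_mod i (stages i)), (@next_map 0 stage0),
  (fun i => @next_map i.+1 (next_stage i (stages i))).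
split.
  move=> i; split; first exact: next_ok.
    exact: next_projective.
  exact: next_generated.
split; first exact: next_morph.
split; first by move=> i; apply: next_morph.
split; first by move=> a; apply/(next_im (inv 0%N)).
split; first by move=> u; apply: (next_im (inv 1%N)).
by move=> i u; apply: (next_im (inv i.+2)).
Qed.

End Resolution.

(** * From bar cochains on [A_0] to factorizations of one path *)

Section ListExact.
Variables (k : fieldType) (V E : finType) (tl hd : E -> V).
Variable S : qpath V E -> qpath V E -> Prop.
Local Notation qp := (qpath V E).
Local Notation is_path := (is_path tl hd).
Local Notation phead := (phead hd).
Local Notation sim := (sim k tl hd S).
Local Notation okl := (okl tl hd).
Local Notation lsim := (lsim k tl hd S).
Local Notation cochain := (cochain tl hd S).
Local Notation acyc := (acyc tl hd S).
Local Notation ldom := (ldom hd).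
Local Notation lhead := (lhead hd).
Local Notation A0 := (A0 k V E).
Hypotheses (Swf : S_wf tl hd S) (Sgr : S_graded S).
Implicit Types (p q r b : qp) (l m : seq qp).

Definition factors r l : Prop := if l is b :: l' then sim (lprod b l') r else False.

Lemma lsim_lprod b l c m : okl (b :: l) -> lsim (b :: l) (c :: m) ->
  sim (lprod b l) (lprod c m).
Proof.
elim: l m b c => [|b' l IH] [|c' m] b c ok [h1 h2] //.
have hl := IH m b' c' (okl_tl ok) h2.
by apply: sim_cat => //; apply: lprod_comp ok.
Qed.

Lemma factors_lsim r l m : okl l -> lsim l m -> factors r l <-> factors r m.
Proof.
case: l m => [|b l] [|c m] // ok h; have H := lsim_lprod ok h.
by split=> h'; [apply: sim_trans (sim_sym H) h'|apply: sim_trans H h'].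
Qed.

Lemma factors_merges r l m : m \in merges l -> factors r l <-> factors r m.
Proof. by case: l => // b l /merges_lprod [b' [m' [-> /= ->]]]. Qed.

Lemma factors_tlen r l : okl l -> factors r l -> tlen l = plen r.
Proof.
by case: l => // b l ok /(sim_len Swf Sgr) <-; have [_ _ ->] := lprod_ok ok.
Qed.

Definition sim_invariant r n (F : seq qp -> k) : Prop :=
  forall l m, okl l -> lsim l m -> size l = n -> factors r l -> F l = F m.

(* Exactness at factorizations of length [n] of the complex of factorizations of [r]. *)
Definition factor_exact r n : Prop :=
  forall F, sim_invariant r n F ->
    (forall l, okl l -> size l = n.+1 -> factors r l -> mrg F l = 0) ->
    exists2 G, sim_invariant r n.-1 G &
      forall l, okl l -> size l = n -> factors r l -> mrg G l = F l.

(** The basis vector of [A_0] at a vertex; a cochain on a non-empty list is determined by its value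
    there. *)
Definition vdelta (o : option V) : gcar A0 :=
  [ffun w => if o is Some v then (w == v)%:R else 0].

Lemma A0_act_pos b (u : gcar A0) : (0 < plen b)%N -> gact b u = 0.
Proof. by case: b => v []. Qed.

Lemma vdelta_dom j l : (tlen l)%:Z = j -> (0 < size l)%N ->
  ldom (fun _ : gcar A0 => True) j l (vdelta (lhead l)).
Proof.
case: l => // b l e _; split=> //; first by left; rewrite e subrr.
by apply/ffunP => w; rewrite !ffunE /=; case: (w == phead b).
Qed.

Lemma A0_submod : submod tl hd (fun _ : gcar A0 => True). Proof. by []. Qed.

Lemma A0_dom l j (u : gcar A0) : (0 < size l)%N ->
  ldom (fun _ : gcar A0 => True) j l u ->
  u = (if lhead l is Some v then u v else 0) *: vdelta (lhead l).
Proof.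
case: l => // b l _ [_ _ /= <-]; apply/ffunP => w; rewrite !ffunE.
by rewrite eqxx; case: eqP => [->|_]; rewrite /GRing.scale /= ?mulr1 ?mulr0.
Qed.

(** A function on factorizations of [r], extended by 0, is a bar cochain of internal degree
    [plen r]. Nontrivial paths act by 0 on [A_0], so [delta] reduces to minus [mrg], whence the sign
    of the primitive. *)
Lemma acyc_factor_exact : (forall n j, j != n%:Z -> acyc (fun _ : gcar A0 => True) n j) ->
  forall r n, (n < plen r)%N -> factor_exact r n.
Proof.
move=> H r n nr F Finv F0.
pose f l (u : gcar A0) : k :=
  if `[< factors r l >] then F l * (if lhead l is Some v then u v else 0) else 0.
have cf : cochain (fun _ : gcar A0 => True) n (plen r)%:Z f.
  split.
    move=> l a u v ok sl _ _; rewrite /f; case: asboolP => _; last by rewrite mulr0 addr0.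
    case: (lhead l) => [w|]; last by rewrite !mulr0 addr0.
    by rewrite !ffunE mulrDr /GRing.scale /= mulrCA.
  move=> l m u ok h sl _; rewrite /f -(asbool_equiv_eq (factors_lsim r ok h)).
  case: asboolP => // hl; rewrite (lsim_head Swf Sgr h); congr (_ * _).
  exact: Finv.
have zf : cocycle tl hd (fun _ : gcar A0 => True) n (plen r)%:Z f.
  move=> [|b l] u ok // sl du; rewrite delta_cons A0_act_pos ?(okl_pos ok) //.
  rewrite [f l 0](_ : _ = 0); last first.
    rewrite /f; case: asboolP => // _; case: (lhead l) => [w|]; rewrite ?mulr0 //.
    by rewrite ffunE mulr0.
  pose c : k := if `[< factors r (b :: l) >] then u (phead b) else 0.
  rewrite sub0r (eq_mrg (G := fun m => c * F m + 0)).
    rewrite mrg_lin mrg0 addr0 /c; case: asboolP => h; last by rewrite mul0r oppr0.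
    by rewrite F0 // mulr0 oppr0.
  move=> m hm; rewrite /f -(asbool_equiv_eq (factors_merges r hm)) addr0 /c.
  have [_ -> _] := mergesP ok hm.
  by case: asboolP => _; rewrite ?mul0r // mulrC.
have [|g cg gE] := H n _ _ f cf zf; first by apply/negP => /eqP; lia.
exists (fun l => - g l (vdelta (lhead l))).
  move=> l m ok h sl hl; congr (- _); rewrite -(lsim_head Swf Sgr h).
  apply: cg.2 => //; apply: vdelta_dom; first by rewrite (factors_tlen ok hl).
  by case: l hl {ok h sl}.
move=> [|b l] ok sl // hl.
have d : ldom (fun _ : gcar A0 => True) (plen r)%:Z (b :: l) (vdelta (lhead (b :: l))).
  by apply: vdelta_dom => //; rewrite (factors_tlen ok hl).
have := gE _ _ ok sl d; rewrite delta_cons A0_act_pos ?(okl_pos ok) //.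
rewrite (cochain0 (A0_is_gmod k Swf Sgr) A0_submod cg) ?(okl_tl ok) //; last by rewrite -sl.
rewrite sub0r -mrgN /f asboolT //= !ffunE eqxx mulr1 => <-.
by apply: eq_mrg => m hm; have [_ -> _] := mergesP ok hm.
Qed.

(** Primitives chosen for each class [r] of length [j] are assembled along the product of the list.
    A list of [n.+1] nontrivial factors has total length at least [n.+1], and [j != n.+1] excludes
    equality, so exactness applies wherever the domain is non-zero. *)
Lemma factor_exact_acyc :
  (forall r n, is_path r -> (0 < n)%N -> (n < plen r)%N -> factor_exact r n) ->
  forall n j, j != n%:Z -> acyc (fun _ : gcar A0 => True) n j.
Proof.
move=> H [|n] j nj f cf zf.
  exists (fun _ _ => 0); first by split=> *; rewrite ?mulr0 ?addr0.
  move=> [|//] u _ _ [_ [e|->] _].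
    by case/eqP: nj; move: e; rewrite subr0.
  by rewrite (cochain0 (A0_is_gmod k Swf Sgr) A0_submod cf).
pose F l := f l (vdelta (lhead l)).
have /choice [G GP] : forall r, exists G, is_path r -> (n.+1 < plen r)%N -> (plen r)%:Z = j ->
   sim_invariant r n G /\ forall l, okl l -> size l = n.+1 -> factors r l -> mrg G l = F l.
  move=> r; case: (pselect (is_path r /\ (n.+1 < plen r)%N /\ (plen r)%:Z = j)); last first.
    by move=> h; exists (fun _ => 0) => h1 h2 h3; case: h.
  move=> [hr [nr rj]]; have [||G G1 G2] := H r n.+1 hr isT nr F.
  - move=> l m ok h sl hl; rewrite /F -(lsim_head Swf Sgr h); apply: cf.2 => //.
    by apply: vdelta_dom; rewrite ?sl // (factors_tlen ok hl).
  - move=> [|b l] ok sl // hl.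
    have d : ldom (fun _ : gcar A0 => True) j (b :: l) (vdelta (lhead (b :: l))).
      by apply: vdelta_dom => //; rewrite (factors_tlen ok hl).
    have := zf _ _ ok sl d; rewrite delta_cons A0_act_pos ?(okl_pos ok) //.
    rewrite (cochain0 (A0_is_gmod k Swf Sgr) A0_submod cf) ?(okl_tl ok) //; last by case: sl.
    rewrite sub0r => /eqP; rewrite oppr_eq0 => /eqP H0; rewrite -[RHS]H0.
    by apply: eq_mrg => m hm; rewrite /F; have [_ -> _] := mergesP ok hm.
  - by exists G.
(* The primitive is read off at the representative of the product of the whole list, which merging
   preserves. The test keeps to lengths for which [G] was constructed. *)
pose g l (u : gcar A0) : k :=
  if l is b :: l' then
    if (n.+1 < tlen l)%N then - (G (nf k tl hd S (lprod b l')) l * u (phead b)) else 0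
  else 0.
have rP b l : okl (b :: l) -> let r := nf k tl hd S (lprod b l) in
    [/\ is_path r, factors r (b :: l) & plen r = tlen (b :: l)].
  move=> ok /=; have [h1 h2 h3] := lprod_ok ok; have h := sim_nf k S h1.
  by split=> //; [exact: sim_pathr h|rewrite -(sim_len Swf Sgr h)].
exists g.
  split.
    move=> [|b l] a u v ok sl _ _; rewrite /g ?mulr0 ?addr0 //.
    case: ifP => _; last by rewrite mulr0 addr0.
    by rewrite !ffunE mulrDr opprD mulrN mulrCA.
  move=> [|b l] [|c m] u ok // hs sl du; rewrite /g -(lsim_tlen Swf Sgr hs).
  case: ifP => // nt.
  have [h1 h2 h3] := rP _ _ ok.
  rewrite -(nf_sim (lsim_lprod ok hs)); have [hbc _] := hs.
  rewrite -(sim_head Swf Sgr hbc); case: du => _ [e|->] _; last by rewrite ffunE !mulr0.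
  have rj : (plen (nf k tl hd S (lprod b l)))%:Z = j by rewrite h3; lia.
  congr (- (_ * _)); apply: (proj1 (GP _ h1 _ rj)) => //.
  by rewrite h3.
move=> [|b l] u ok // sl du; rewrite delta_cons A0_act_pos ?(okl_pos ok) //.
have -> : g l 0 = 0 by case: (l) => //= c m; rewrite ffunE mulr0 oppr0 if_same.
have [h1 h2 h3] := rP _ _ ok; set r := nf k tl hd S (lprod b l) in h1 h2 h3.
have [u0|u0] := eqVneq u 0.
  rewrite u0 (cochain0 (A0_is_gmod k Swf Sgr) A0_submod cf) // sub0r.
  rewrite (eq_mrg (G := fun=> 0)) ?mrg0 ?oppr0 //.
  by move=> [|c m] _ //=; rewrite ffunE mulr0 oppr0 if_same.
have rj : (plen r)%:Z = j.
  by case: du => _ [e|e] _; [rewrite h3; lia|rewrite e eqxx in u0].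
have nr : (n.+1 < plen r)%N.
  rewrite h3 ltn_neqAle -{2}sl (size_tlen ok) andbT; apply: contraNneq nj => e.
  by rewrite -rj h3 -e.
have [G1 G2] := GP _ h1 nr rj.
rewrite [in RHS](A0_dom _ du) // -[_ *: _]addr0 cf.1 //; first last.
- by apply: (subspace0 (dom_sub (A0_is_gmod k Swf Sgr) A0_submod _ _)).
- by apply: vdelta_dom => //; rewrite -h3.
rewrite (cochain0 (A0_is_gmod k Swf Sgr) A0_submod cf) // addr0.
rewrite -/(F (b :: l)) -G2 // sub0r.
pose c : k := - u (phead b).
rewrite (eq_mrg (G := fun m => c * G r m + 0)).
  by rewrite mrg_lin mrg0 addr0 mulNr opprK.
move=> m hm; have [b' [m' [e e']]] := merges_lprod hm.
have [_ hh ht] := mergesP ok hm; rewrite e in hh ht *.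
by case: hh => hh; rewrite /g ht -h3 nr e' hh addr0 /c mulNr mulrC.
Qed.

End ListExact.

(** * Order complexes and joins *)

Section SetCochains.
Variables (k : fieldType) (I : finType) (lt : rel I).
Local Notation sI := {set I}.
Implicit Types (A B : sI) (D : {set sI}) (phi psi : sI -> k).

Definition above (x : I) A : nat := #|[set y in A | lt x y]|.

(* Signs count the vertices above the removed one, as [mrg] does. *)
Definition sdelta phi A : k := \sum_(x in A) (-1) ^+ above x A * phi (A :\ x).

Definition schain A : Prop :=
  forall x y, x \in A -> y \in A -> x != y -> lt x y (+) lt y x.

Definition scomplex D : Prop :=
  (forall A B, A \in D -> B \subset A -> B \in D) /\ (forall A, A \in D -> schain A).

(* Exactness of the cochain complex of the order complex [D] at faces with [m] vertices. *)
Definition face_exact D m : Prop :=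
  forall phi, (forall A, A \in D -> #|A| = m.+1 -> sdelta phi A = 0) ->
  exists psi, forall A, A \in D -> #|A| = m -> sdelta psi A = phi A.

Lemma eq_sdelta phi psi A :
  (forall x, x \in A -> phi (A :\ x) = psi (A :\ x)) -> sdelta phi A = sdelta psi A.
Proof. by move=> H; apply: eq_bigr => x /H ->. Qed.

Lemma sdelta_lin a phi psi A :
  sdelta (fun B => a * phi B + psi B) A = a * sdelta phi A + sdelta psi A.
Proof.
rewrite /sdelta mulr_sumr -big_split; apply: eq_bigr => x _ /=.
by rewrite mulrDr mulrCA.
Qed.

Lemma sdeltaB phi psi A :
  sdelta (fun B => phi B - psi B) A = sdelta phi A - sdelta psi A.
Proof.
by rewrite /sdelta -sumrB; apply: eq_bigr => x _; rewrite mulrBr.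
Qed.

Lemma aboveD1 x y A : y \in A -> above x A = (lt x y + above x (A :\ y))%N.
Proof.
move=> yA; rewrite /above; case: (boolP (lt x y)) => h.
  rewrite (cardsD1 y) inE yA h /=; congr (_ + _)%N; apply: eq_card => z.
  by rewrite !inE; case: (z == y).
rewrite add0n; apply: eq_card => z; rewrite !inE.
by have [->|] //= := eqVneq z y; rewrite (negPf h) andbF.
Qed.

(** Deleting the upper of two vertices lowers by one the count above the lower one, but not
    conversely, so the two orders of deletion contribute opposite signs. *)
Lemma sdelta_sdelta phi A : schain A -> sdelta (sdelta phi) A = 0.
Proof.
move=> cA.
pose T x y : k := (-1) ^+ above x A * ((-1) ^+ above y (A :\ x) * phi (A :\ x :\ y)).
have -> : sdelta (sdelta phi) A = \sum_(x in A) \sum_(y in A :\ x) T x y.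
  by apply: eq_bigr => x _; rewrite mulr_sumr.
have sw x y : x \in A -> y \in A -> lt x y -> ~~ lt y x -> T y x = - T x y.
  move=> xA yA l1 l2; rewrite /T (aboveD1 x yA) (aboveD1 y xA) l1 (negPf l2) add0n.
  rewrite add1n exprS -!mulrA mulN1r opprK mulrCA.
  by rewrite setDDl setUC -setDDl.
transitivity (\sum_(x in A) (\sum_(y in A | (y != x) && lt x y) T x y +
                             \sum_(y in A | (y != x) && ~~ lt x y) T x y)).
  apply: eq_bigr => x xA; rewrite (bigID (lt x)) /=.
  by congr (_ + _); apply: eq_bigl => y; rewrite !inE [RHS]andbA; congr (_ && _); rewrite andbC.
rewrite big_split /= [X in _ + X](_ : _ =
   \sum_(x in A) \sum_(y in A | (x != y) && lt y x) T x y); last first.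
  apply: eq_bigr => x xA; apply: eq_bigl => y; rewrite eq_sym.
  case yA: (y \in A) => //=; case ne: (x == y) => //=.
  by have := cA x y xA yA; rewrite ne => /(_ isT); case: (lt x y); case: (lt y x).
rewrite [X in _ + X](exchange_big_dep (mem A)) /= => [|x y xA /andP [] //].
rewrite -[RHS](addNr (\sum_(x in A) \sum_(y in A | (y != x) && lt x y) T x y)).
rewrite addrC; congr (_ + _); rewrite -sumrN; apply: eq_bigr => x xA.
rewrite -sumrN; apply: eq_big => [y|y /and4P [yA _ ne l]]; first by rewrite xA.
rewrite sw //; have := cA y x yA xA ne; rewrite l; by case: (lt y x).
Qed.

End SetCochains.

(** * Exactness for joins *)

Section Join.
Variables (k : fieldType) (I : finType) (lt : rel I).
Local Notation sI := {set I}.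
Implicit Types (A B : sI) (phi psi : sI -> k).
Variables (D1 D2 : {set sI}) (N1 N2 : nat) (X : sI).
Local Notation sd := (sdelta lt).
Local Notation face_exact D := (face_exact k lt D).
Hypotheses (C1 : scomplex lt D1) (C2 : scomplex lt D2).
Hypotheses (X1 : forall A, A \in D1 -> A \subset X)
           (X2 : forall A, A \in D2 -> [disjoint A & X]).
Hypothesis lt12 : forall A B x y, A \in D1 -> B \in D2 -> x \in A -> y \in B ->
  lt x y /\ ~~ lt y x.
Hypotheses (le1 : forall A, A \in D1 -> (#|A| <= N1)%N)
           (le2 : forall A, A \in D2 -> (#|A| <= N2)%N).
Hypotheses (ex1 : forall m, (m < N1)%N -> face_exact D1 m)
           (ex2 : forall m, (m < N2)%N -> face_exact D2 m).

(** [X] contains the vertices of [D1] and avoids those of [D2], so it splits each face of the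
    join. *)
Definition joinc : {set sI} := [set A | (A :&: X \in D1) && (A :\: X \in D2)].

Lemma join_split A B : A \in D1 -> B \in D2 ->
  ((A :|: B) :&: X = A) * ((A :|: B) :\: X = B).
Proof.
move=> /X1 /setIidPl hA /X2; rewrite -setI_eq0 => /eqP hB; split.
  by rewrite setIUl hA hB setU0.
have hA' : A :\: X = set0 by apply/eqP; rewrite setD_eq0; apply/setIidPl.
by rewrite setDUl hA' set0U; apply/setDidPl; rewrite -setI_eq0 hB.
Qed.

Lemma joincE A B : A \in D1 -> B \in D2 -> A :|: B \in joinc.
Proof. by move=> hA hB; rewrite inE !join_split // hA hB. Qed.

Lemma joinc_dec A : A \in joinc -> exists A1 A2, [/\ A1 \in D1, A2 \in D2 & A = A1 :|: A2].
Proof.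
rewrite inE => /andP [h1 h2]; exists (A :&: X), (A :\: X); split=> //.
by rewrite setID.
Qed.

Lemma join_disj A B : A \in D1 -> B \in D2 -> [disjoint A & B].
Proof.
move=> hA hB; rewrite disjoint_sym; apply: disjointWr (X2 hB); exact: X1.
Qed.

Lemma join_card A B : A \in D1 -> B \in D2 -> #|A :|: B| = (#|A| + #|B|)%N.
Proof.
by move=> hA hB; apply/eqP; rewrite (leq_card_setU A B).2; apply: join_disj.
Qed.

Lemma joinc_complex : scomplex lt joinc.
Proof.
split=> [A B|A].
  rewrite !inE => /andP [h1 h2] s; apply/andP; split.
    by apply: C1.1 h1 _; apply: setSI.
  by apply: C2.1 h2 _; apply: setSD.
move=> /joinc_dec [A1 [A2 [h1 h2 ->]]] x y; rewrite !inE.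
case/orP=> hx /orP [hy|hy] ne.
- exact: C1.2 h1 _ _ hx hy ne.
- by have [-> /negPf ->] := lt12 h1 h2 hx hy.
- by have [-> /negPf ->] := lt12 h1 h2 hy hx.
- exact: C2.2 h2 _ _ hx hy ne.
Qed.

(** Every vertex of [B] lies above every vertex of [A], so deletions from [A] pick up the sign of
    [#|B|] and deletions from [B] pick up none. *)
Lemma join_sdelta phi A B : A \in D1 -> B \in D2 ->
  sd phi (A :|: B) = (-1) ^+ #|B| * sd (fun A' => phi (A' :|: B)) A +
                         sd (fun B' => phi (A :|: B')) B.
Proof.
move=> hA hB; have dAB := join_disj hA hB.
rewrite {1}/sdelta (eq_bigl [predU A & B]); last by move=> x; rewrite !inE.
rewrite bigU //=; congr (_ + _).
  rewrite mulr_sumr; apply: eq_bigr => x xA.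
  have xB : x \notin B by rewrite (disjointFr dAB xA).
  have -> : (A :|: B) :\ x = (A :\ x) :|: B.
    by rewrite setDUl; congr (_ :|: _); apply/setDidPl; rewrite disjoint_sym disjoints1.
  rewrite mulrA -exprD; congr (_ ^+ _ * _).
  rewrite /above -(cardsID X [set y in A :|: B | lt x y]) addnC; congr (_ + _)%N.
    apply: eq_card => y; rewrite !inE; have [yA|yA] := boolP (y \in A).
      by rewrite (disjointFr dAB yA) (subsetP (X1 hA) _ yA).
    have [yB|yB] := boolP (y \in B); rewrite ?andbF //=.
    by rewrite (disjointFr (X2 hB) yB); have [-> _] := lt12 hA hB xA yB.
  apply: eq_card => y; rewrite !inE; have [yA|yA] := boolP (y \in A).
    by rewrite (subsetP (X1 hA) _ yA) andbT.
  by have [yB|yB] := boolP (y \in B); rewrite ?andbF //= (disjointFr (X2 hB) yB) andbF.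
apply: eq_bigr => x xB; have xA : x \notin A by rewrite (disjointFl dAB xB).
have -> : (A :|: B) :\ x = A :|: (B :\ x).
  by rewrite setDUl; congr (_ :|: _); apply/setDidPl; rewrite disjoint_sym disjoints1.
congr (_ ^+ _ * _).
rewrite /above; apply: eq_card => y; rewrite !inE.
have [yA|yA] := boolP (y \in A); rewrite //= (disjointFr dAB yA) /=.
by have [_ /negPf ->] := lt12 hA hB yA xB.
Qed.

(* Clearing a cocycle of total degree [m] of the double complex starting from the
   largest [D1]-degree; below the top degree of [D1] this only uses exactness of [D1]. *)
Lemma join_clear m t phi : (t <= N1)%N ->
  (forall A B, A \in D1 -> B \in D2 -> (#|A| + #|B|)%N = m.+1 -> sd phi (A :|: B) = 0) ->
  (forall A B, A \in D1 -> B \in D2 -> (#|A| + #|B|)%N = m -> (t <= #|A|)%N ->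
     phi (A :|: B) = 0) ->
  exists psi : sI -> k, forall A B, A \in D1 -> B \in D2 -> (#|A| + #|B|)%N = m ->
     sd psi (A :|: B) = phi (A :|: B).
Proof.
elim: t phi => [|t IH] phi ht zphi phi0.
  exists (fun _ => 0) => A B hA hB e; rewrite phi0 //.
  by rewrite /sdelta big1 // => x _; rewrite mulr0.
have /choice [g gP] : forall B, exists g : sI -> k, B \in D2 -> (t + #|B|)%N = m ->
    forall A, A \in D1 -> #|A| = t -> sd g A = phi (A :|: B).
  move=> B; case: (pselect (B \in D2 /\ (t + #|B|)%N = m)) => [[hB e]|n]; last first.
    by exists (fun _ => 0) => hB e; case: n.
  (* For fixed [B] the component of [D1]-degree [t] is a cocycle on [D1], since the components of
     larger [D1]-degree vanish. *)
  have [|g gE] := ex1 ht (phi := fun A => phi (A :|: B)); last by exists g.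
  move=> A hA cA; have := zphi A B hA hB; rewrite cA addSn e => /(_ erefl).
  rewrite join_sdelta // [X in _ + X](_ : _ = 0) ?addr0.
    by move/eqP; rewrite mulf_eq0 signr_eq0 => /eqP.
  rewrite /sdelta big1 // => x xB; rewrite phi0 ?mulr0 //.
  - by apply: C2.1 hB _; apply: subsetDl.
  - by move: e; rewrite (cardsD1 x) xB; lia.
  - by rewrite cA.
(* The sign cancels the one in [join_sdelta]. For [t = 0] the function is 0, and exactness of [D1]
   already says that the component vanishes. *)
pose psi C : k := if #|C :&: X|.+1 == t then (-1) ^+ #|C :\: X| * g (C :\: X) (C :&: X) else 0.
have psiE A B : A \in D1 -> B \in D2 ->
    psi (A :|: B) = if #|A|.+1 == t then (-1) ^+ #|B| * g B A else 0.
  by move=> hA hB; rewrite /psi !join_split.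
have sub1 A x : A \in D1 -> A :\ x \in D1 by move=> hA; apply: C1.1 hA _; apply: subsetDl.
have sub2 B x : B \in D2 -> B :\ x \in D2 by move=> hB; apply: C2.1 hB _; apply: subsetDl.
have dpsi A B : A \in D1 -> B \in D2 -> (#|A| + #|B|)%N = m -> (t <= #|A|)%N ->
    sd psi (A :|: B) = phi (A :|: B).
  move=> hA hB e le; rewrite join_sdelta // [X in _ + X](_ : _ = 0) ?addr0; last first.
    rewrite /sdelta big1 // => x xB; rewrite psiE ?sub2 // gtn_eqF ?mulr0 //; lia.
  have [At|At] := eqVneq #|A| t.
    rewrite -gP // -?At // (eq_sdelta lt (psi := fun A' => (-1) ^+ #|B| * g B A' + 0)).
      rewrite sdelta_lin [sd (fun=> 0) A](_ : _ = 0) ?addr0; last first.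
        by rewrite /sdelta big1 // => x _; rewrite mulr0.
      by rewrite mulrA -exprD -signr_odd oddD addbb mul1r.
    move=> x xA; rewrite psiE ?sub1 // addr0; move: At; rewrite (cardsD1 x) xA add1n.
    by move=> ->; rewrite eqxx.
  rewrite phi0 //; last lia.
  rewrite /sdelta big1 ?mulr0 // => x xA; rewrite psiE ?sub1 //.
  move: At le; rewrite (cardsD1 x) xA add1n => At le.
  by rewrite (negPf At) mulr0.
have [||psi' psi'E] := IH (fun C => phi C - sd psi C) (ltnW ht).
- move=> A B hA hB e; rewrite sdeltaB zphi // sdelta_sdelta ?subrr //.
  by apply: joinc_complex.2; apply: joincE.
- by move=> A B hA hB e le; rewrite dpsi ?subrr.
exists (fun C => 1 * psi' C + psi C) => A B hA hB e.
by rewrite sdelta_lin mul1r psi'E // subrK.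
Qed.

(** If [m < N1], no component has top [D1]-degree and exactness of [D1] suffices. Otherwise the
    component of [D1]-degree [N1] has [D2]-degree [m - N1 < N2], and exactness of [D2] is applied
    modulo the coboundaries of [D1]. *)
Lemma join_face_exact m : (m < N1 + N2)%N -> face_exact joinc m.
Proof.
move=> hm phi zphi.
have sub1 A x : A \in D1 -> A :\ x \in D1 by move=> hA; apply: C1.1 hA _; apply: subsetDl.
have sub2 B x : B \in D2 -> B :\ x \in D2 by move=> hB; apply: C2.1 hB _; apply: subsetDl.
have zphi' A B : A \in D1 -> B \in D2 -> (#|A| + #|B|)%N = m.+1 -> sd phi (A :|: B) = 0.
  by move=> hA hB e; apply: zphi; rewrite ?joincE // join_card.
suff [psi psiE] : exists psi : sI -> k, forall A B, A \in D1 -> B \in D2 ->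
    (#|A| + #|B|)%N = m -> sd psi (A :|: B) = phi (A :|: B).
  exists psi => C hC cC; have [A [B [hA hB e]]] := joinc_dec hC.
  by rewrite e psiE // -join_card // -e.
have [lt1|le] := ltnP m N1.
  apply: (join_clear (t := N1) _ zphi') => // A B hA hB e le.
  by move: (le1 hA) e lt1 le; lia.
pose b := (m - N1)%N; have hb : (b < N2)%N by rewrite /b; lia.
(* Project the component of top [D1]-degree away from the coboundaries of [D1]. *)
pose W : lmodType k := {ffun sI -> k^o}.
pose top A := (A \in D1) && (#|A| == N1).
pose Bd (w : W) := exists g : sI -> k, forall A, w A = if top A then sd g A else 0.
have BdS : subspace Bd.
  split.
    exists (fun _ => 0) => A; rewrite ffunE /sdelta big1 ?if_same // => x _.
    by rewrite mulr0.
  move=> a u v [g gE] [h hE]; exists (fun C => a * g C + h C) => A.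
  rewrite !ffunE gE hE; case: ifP => _; last by rewrite scaler0 addr0.
  by rewrite sdelta_lin.
have [rho [rl rB rid]] := projection_exists BdS.
pose cut B : W := [ffun A => if top A then phi (A :|: B) else 0].
pose chi B : W := cut B - rho (cut B).
(* By the cocycle condition at faces with [N1] vertices in [D1], the [D2]-coboundary of [cut] is a
   [D1]-coboundary. The linear projection [rho], common to all [B], fixes it, so [chi] is a cocycle
   along [D2]. *)
have chi0 B : B \in D2 -> #|B| = b.+1 ->
    \sum_(x in B) (-1) ^+ above lt x B *: chi (B :\ x) = 0.
  move=> hB cB; rewrite /chi.
  have -> : \sum_(x in B) (-1) ^+ above lt x B *: (cut (B :\ x) - rho (cut (B :\ x))) =
     \sum_(x in B) (-1) ^+ above lt x B *: cut (B :\ x)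
      - rho (\sum_(x in B) (-1) ^+ above lt x B *: cut (B :\ x)).
    rewrite (lin_sum rl) -sumrB; apply: eq_bigr => x _.
    by rewrite (linZ rl) scalerBr.
  rewrite rid ?subrr //; exists (fun A => - (-1) ^+ #|B| * phi (A :|: B)) => A.
  rewrite sum_ffunE; case: (boolP (top A)) => hA; last first.
    by rewrite big1 // => x _; rewrite !ffunE (negPf hA) scaler0.
  case/andP: (hA) => hA1 /eqP cA.
  have := zphi' A B hA1 hB; rewrite cA cB => z.
  have {}z : sd phi (A :|: B) = 0 by apply: z; rewrite /b; lia.
  rewrite join_sdelta // in z.
  have -> : \sum_(x in B) ((-1) ^+ above lt x B *: cut (B :\ x)) A =
      sd (fun B' => phi (A :|: B')) B.
    by apply: eq_bigr => x xB; rewrite !ffunE hA.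
  rewrite -[LHS]addr0 -[in LHS]oppr0 -z opprD addrCA subrr addr0.
  rewrite /sdelta mulr_sumr -sumrN; apply: eq_bigr => x _.
  by rewrite cB mulNr mulrN mulrCA.
have /choice [g gP] : forall A, exists g : sI -> k, top A ->
    forall B, B \in D2 -> #|B| = b -> sd g B = chi B A.
  move=> A; have [|g gE] := ex2 hb (phi := fun B => chi B A); last by exists g.
  move=> B hB cB; have := congr1 (fun w : W => w A) (chi0 B hB cB).
  rewrite sum_ffunE ffunE => h; rewrite -[RHS]h.
  by apply: eq_bigr => x _; rewrite !ffunE.
have /choice [h hP] : forall B, exists h : sI -> k, forall A,
    rho (cut B) A = if top A then sd h A else 0 by move=> B; apply: rB.
(* [g] accounts for [chi] along [D2], and [h], one [D1]-degree lower, for [rho (cut B)] along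
   [D1]. *)
pose psi C : k := let A := C :&: X in let B := C :\: X in
  if #|A| == N1 then g A B else if #|A|.+1 == N1 then (-1) ^+ #|B| * h B A else 0.
have psiE A B : A \in D1 -> B \in D2 -> psi (A :|: B) =
    if #|A| == N1 then g A B else if #|A|.+1 == N1 then (-1) ^+ #|B| * h B A else 0.
  by move=> hA hB; rewrite /psi !join_split.
have dpsi A B : A \in D1 -> B \in D2 -> #|A| = N1 -> #|B| = b ->
    sd psi (A :|: B) = phi (A :|: B).
  move=> hA hB cA cB; have tA : top A by rewrite /top hA cA eqxx.
  rewrite join_sdelta // (eq_sdelta lt (psi := fun A' => (-1) ^+ #|B| * h B A' + 0)).
    rewrite sdelta_lin [sd (fun=> 0) A](_ : _ = 0) ?addr0; last first.
      by rewrite /sdelta big1 // => x _; rewrite mulr0.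
    rewrite mulrA -exprD -signr_odd oddD addbb mul1r.
    rewrite [X in _ + X](eq_sdelta lt (psi := g A)); last first.
      by move=> x xB; rewrite psiE ?sub2 // cA eqxx.
    rewrite gP // /chi !ffunE hP tA.
    by rewrite addrCA subrr addr0.
  move=> x xA; rewrite psiE ?sub1 // addr0.
  have -> : #|A :\ x| == N1 = false.
    by move: cA; rewrite (cardsD1 x) xA add1n => <-; rewrite ltn_eqF.
  by have -> : #|A :\ x|.+1 == N1 by move: cA; rewrite (cardsD1 x) xA add1n => ->.
(* What remains is a cocycle without component of top [D1]-degree. *)
have [||psi' psi'E] := @join_clear m N1 (fun C => phi C - sd psi C) (leqnn _).
- move=> A B hA hB e; rewrite sdeltaB zphi' // sdelta_sdelta ?subrr //.
  by apply: joinc_complex.2; apply: joincE.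
- move=> A B hA hB e leA; have cA : #|A| = N1 by move: (le1 hA) leA; lia.
  by rewrite dpsi ?subrr //; move: e; rewrite cA /b; lia.
exists (fun C => 1 * psi' C + psi C) => A B hA hB e.
by rewrite sdelta_lin mul1r psi'E // subrK.
Qed.

End Join.

(** * Reduced homology by ranks and exactness of cochains *)

Section Ranks.
Variables (k : fieldType) (n : nat) (lt : rel 'I_n).
Local Notation sI := {set 'I_n}.
Hypothesis lt_irr : irreflexive lt.
Implicit Types (A B : sI) (D : {set sI}) (phi psi : sI -> k).

(* The parity of [noninv] compares the orientation of [A] given by the indices with
   the one given by [lt]. *)
Definition noninv A : nat := \sum_(a in A) \sum_(b in A) ((a < b)%N && lt a b : nat).

Definition twist A : k := (-1) ^+ noninv A.

Lemma odd_sum (I : finType) (B : {set I}) (f g : I -> nat) :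
  (forall y, y \in B -> odd (f y) = odd (g y)) ->
  odd (\sum_(y in B) f y) = odd (\sum_(y in B) g y).
Proof.
move=> H; rewrite !(big_morph odd oddD (erefl _)).
by apply: eq_bigr => y /H.
Qed.

Lemma cards_sum A (P : pred 'I_n) : #|[set y in A | P y]| = (\sum_(y in A) P y)%N.
Proof.
rewrite -sum1_card big_mkcond [RHS]big_mkcond; apply: eq_bigr => y _.
by rewrite inE; case: (y \in A); case: (P y).
Qed.

(** The parities agree vertex by vertex. If [y < x] as indices, the incidence sign counts 1 and
    [noninv] counts [lt y x], which together have the parity of [lt x y]; if [x < y], only [lt x y]
    is counted. *)
Lemma twist_above A x : schain lt A -> x \in A ->
  (-1) ^+ #|[set y in A | (y < x)%N]| * twist (A :\ x) =
  twist A * (-1) ^+ above lt x A :> k.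
Proof.
move=> cA xA.
rewrite /twist -!exprD -[LHS]signr_odd -[RHS]signr_odd; congr (_ ^+ nat_of_bool _).
have -> : noninv A = (noninv (A :\ x) +
    \sum_(y in A :\ x) (((x < y)%N && lt x y) + ((y < x)%N && lt y x)))%N.
  rewrite /noninv (big_setD1 x) //= (big_setD1 x) //= ltnn /= add0n.
  rewrite big_split /= addnCA; congr (_ + _)%N.
  rewrite addnC -big_split /=; apply: eq_bigr => a _.
  by rewrite (big_setD1 x) //= addnC.
rewrite /above !cards_sum (big_setD1 x) //= ltnn add0n.
rewrite (big_setD1 x (A := A)) //= lt_irr add0n oddD -addnA [RHS]oddD addbC.
congr (_ (+) _); rewrite -big_split /=; apply: odd_sum => y.
rewrite !inE => /andP [ne yA]; have := cA _ _ xA yA; rewrite eq_sym ne => /(_ isT).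
by have [xy|yx|/ord_inj e] := ltngtP x y; last (by rewrite e eqxx in ne);
  case: (lt x y); case: (lt y x).
Qed.

(** The non-zero incidence coefficients sit at the faces [A :\ x], and [twist] turns the index sign
    into that of [sdelta]. *)
Lemma bcoef_sum A phi m : #|A| = m.+1 -> forall D, scomplex lt D -> A \in D ->
  \sum_(b < #|faces D m|) bcoef k A (enum_val b) * (twist (enum_val b) * phi (enum_val b)) =
  twist A * sdelta lt phi A.
Proof.
move=> cA D [Dsub Dch] AD.
transitivity (\sum_(B in faces D m) bcoef k A B * (twist B * phi B)).
  rewrite -[RHS]big_enum [RHS](big_nth A) [RHS]big_mkord -cardE.
  by apply: eq_bigr => b _; rewrite (enum_val_nth A).
rewrite (bigID (fun B => B \subset A)) /= [X in _ + X]big1 ?addr0; last first.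
  by move=> B /andP [_ /negPf h]; rewrite /bcoef h mul0r.
rewrite /sdelta mulr_sumr.
have im : [set B in faces D m | B \subset A] = [set A :\ x | x in A].
  apply/setP => B; rewrite !inE; apply/andP/imsetP => [[/andP [BD /eqP cB] BA]|[x xA ->]].
    have /cards1P [x xE] : #|A :\: B| == 1%N by rewrite cardsDS // cA cB subSnn.
    have xAB : x \in A :\: B by rewrite xE inE.
    exists x; first by move: xAB; rewrite inE => /andP [].
    by rewrite -xE setDDr setDv set0U; apply/esym/setIidPr.
  split; last exact: subsetDl.
  rewrite (Dsub _ _ AD) ?subsetDl //=; apply/eqP.
  by move: cA; rewrite (cardsD1 x) xA add1n => -[].
rewrite (eq_bigl (fun B => B \in [set A :\ x | x in A])); last by move=> B; rewrite -im [RHS]inE.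
rewrite big_imset /=; last first.
  move=> x y xA yA /setP /(_ x); rewrite !inE eqxx xA andbT /=.
  by case: eqP.
apply: eq_bigr => x xA; rewrite [RHS]mulrA -twist_above //; last exact: Dch.
rewrite mulrA; congr (_ * _ * _); rewrite /bcoef subsetDl.
case: pickP => [y|/(_ x)]; last by rewrite !inE eqxx xA.
rewrite !inE negb_and negbK => /andP [/orP [/eqP ->|nA] yA] //.
by rewrite yA in nA.
Qed.

Section OneComplex.
Variables (D : {set sI}) (CD : scomplex lt D).

(** The twisted coordinates are those in which multiplication by [bd] becomes [sdelta]. *)
Definition colv m phi : 'cV[k]_(#|faces D m|) := \col_b (twist (enum_val b) * phi (enum_val b)).

Lemma twistK A : twist A * twist A = 1.
Proof. by rewrite /twist -exprD addnn -signr_odd odd_double. Qed.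

Lemma colv_surj m (v : 'cV[k]_(#|faces D m|)) : exists phi, colv m phi = v.
Proof.
exists (fun A => twist A * if [pick b | enum_val b == A] is Some b then v b 0 else 0).
apply/colP => b; rewrite mxE mulrA twistK mul1r.
case: pickP => [c /eqP /enum_val_inj -> //|/(_ b)].
by rewrite eqxx.
Qed.

Lemma colv_eq m phi psi : colv m phi = colv m psi <->
  forall A, A \in D -> #|A| = m -> phi A = psi A.
Proof.
split=> [/colP h A AD cA|H].
  have Af : A \in faces D m by rewrite inE AD cA eqxx.
  have := h (enum_rank_in Af A); rewrite !mxE enum_rankK_in // => /(congr1 ( *%R (twist A))).
  by rewrite !mulrA twistK !mul1r.
apply/colP => b; rewrite !mxE; congr (_ * _); have := enum_valP b.
by rewrite inE => /andP [h1 /eqP h2]; apply: H.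
Qed.

Lemma bd_colv m phi : bd k D m.+1 *m colv m phi = colv m.+1 (sdelta lt phi).
Proof.
apply/colP => a; rewrite !mxE; under eq_bigr do rewrite !mxE.
have := enum_valP a; rewrite inE => /andP [h1 /eqP h2].
by rewrite bcoef_sum.
Qed.

Lemma sdelta0 A : sdelta lt (fun=> 0 : k) A = 0.
Proof. by rewrite /sdelta big1 // => x _; rewrite mulr0. Qed.

(** On columns [bd] is the coboundary, so over a field the vanishing of reduced homology compares
    the dimension of the kernel of one coboundary with the rank of the preceding one. *)
Lemma rhom_face_exact m : rhom_dim k D m = 0%N <-> face_exact k lt D m.
Proof.
(* Subtraction is truncated, so vanishing records a single inequality, the one exactness needs. *)
have ker_im : (#|faces D m| - \rank (bd k D m.+1) <= (if m is 0 then 0 else \rank (bd k D m)))%N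
    <-> rhom_dim k D m = 0%N.
  rewrite /rhom_dim; split; [|move/eqP; rewrite subn_eq0]; lia.
rewrite -ker_im -(mxrank_tr (bd k D m.+1)) -mxrank_ker.
have KP phi : ((colv m phi)^T <= kermx (bd k D m.+1)^T)%MS <-> forall A, A \in D -> #|A| = m.+1 -> sdelta lt phi A = 0.
  have -> : (forall A, A \in D -> #|A| = m.+1 -> sdelta lt phi A = 0) <->
     colv m.+1 (sdelta lt phi) = colv m.+1 (fun=> 0) by rewrite colv_eq.
  have -> : colv m.+1 (fun=> 0) = 0 by apply/colP => b; rewrite !mxE mulr0.
  rewrite -bd_colv; split=> [/sub_kermxP h|h]; last first.
    by apply/sub_kermxP; rewrite -trmx_mul h trmx0.
  by apply: trmx_inj; rewrite trmx_mul h trmx0.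
(* At [m = 0] there is no incoming coboundary, so exactness means that the kernel is 0. *)
case: m ker_im KP => [|m] _ KP; set K := kermx _ in KP *.
  rewrite leqn0 mxrank_eq0; split=> [/eqP K0 phi /KP|H].
    rewrite K0 submx0 => /eqP h; exists (fun=> 0) => A AD cA; rewrite sdelta0.
    have : colv 0 phi = colv 0 (fun=> 0).
      by apply: trmx_inj; rewrite h; apply/rowP => b; rewrite !mxE mulr0.
    by move/colv_eq => ->.
  apply/eqP/row_matrixP => i; rewrite row0.
  have [phi phiE] := colv_surj (row i K)^T.
  have /KP /H [psi psiE] : ((colv 0 phi)^T <= K)%MS by rewrite phiE trmxK row_sub.
  apply: trmx_inj; rewrite -phiE trmx0; apply/colP => b; rewrite !mxE.
  have := enum_valP b; rewrite inE => /andP [h1 /eqP h2].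
  rewrite -psiE // /sdelta big1 ?mulr0 // => x.
  by move/eqP: h2; rewrite cards_eq0 => /eqP ->; rewrite inE.
have dd : bd k D m.+2 *m bd k D m.+1 = 0.
  have H (v : 'cV_(#|faces D m|)) : bd k D m.+2 *m bd k D m.+1 *m v = 0.
    have [phi <-] := colv_surj v; rewrite -mulmxA !bd_colv.
    apply/colP => b; rewrite !mxE; have := enum_valP b; rewrite inE => /andP [h1 _].
    by rewrite sdelta_sdelta ?mulr0 //; apply: CD.2.
  apply/matrixP => a b; have := H (delta_mx b 0); rewrite -colE => /colP /(_ a).
  by rewrite !mxE.
have BK : ((bd k D m.+1)^T <= K)%MS by apply/sub_kermxP; rewrite -trmx_mul dd trmx0.
split=> [le phi /KP h|H].
  have /submxP [w wE] : ((colv m.+1 phi)^T <= (bd k D m.+1)^T)%MS.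
    apply: (submx_trans h); rewrite -(mxrank_leqif_sup BK).
    by rewrite eqn_leq mxrankS // mxrank_tr.
  have [psi psiE] := colv_surj w^T.
  exists psi; apply/colv_eq; rewrite -bd_colv psiE.
  by apply: trmx_inj; rewrite trmx_mul trmxK wE.
rewrite -(mxrank_tr (bd k D m.+1)); apply: mxrankS; apply/row_subP => i.
have [phi phiE] := colv_surj (row i K)^T.
have /KP /H [psi /colv_eq psiE] : ((colv m.+1 phi)^T <= K)%MS by rewrite phiE trmxK row_sub.
apply/submxP; exists (colv m psi)^T.
by rewrite -trmx_mul bd_colv psiE phiE trmxK.
Qed.

End OneComplex.
End Ranks.

(** * Intervals of the path poset *)

Section PathOrder.
Variables (k : fieldType) (V E : finType) (tl hd : E -> V).
Variable S : qpath V E -> qpath V E -> Prop.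
Local Notation qp := (qpath V E).
Local Notation is_path := (is_path tl hd).
Local Notation composable := (composable hd).
Local Notation sim := (sim k tl hd S).
Local Notation path_lt := (path_lt k tl hd S).
Local Notation okl := (okl tl hd).
Local Notation lsim := (lsim k tl hd S).
Hypotheses (Swf : S_wf tl hd S) (Sgr : S_graded S) (Hcan : cancellative k tl hd S).
Implicit Types (p q r w : qp) (l m : seq qp).

Lemma path_ltP p q : path_lt p q <->
  exists r, [/\ is_path r, composable p r, (0 < plen r)%N & sim q (pcat p r)].
Proof.
split=> [[[r [h1 h2 h3]] h4]|[r [h1 h2 h3 h4]]].
  exists r; split=> //; rewrite lt0n; apply/eqP => r0; apply: h4.
  by case: r r0 h1 h2 h3 => v [] // _ _ _; rewrite pcat_id => /sim_sym.
split; first by exists r.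
move=> /(sim_len Swf Sgr); rewrite (sim_len Swf Sgr h4) plen_pcat; lia.
Qed.

Lemma path_lt_len p q : path_lt p q -> (plen p < plen q)%N.
Proof.
by move/path_ltP=> [r [_ _ h /(sim_len Swf Sgr)]]; rewrite plen_pcat; lia.
Qed.

Lemma path_lt_pathl p q : path_lt p q -> is_path p.
Proof.
by move/path_ltP=> [r [_ h2 _ /sim_pathr]]; rewrite is_path_pcat // => /andP [].
Qed.

Lemma path_lt_irr p : ~ path_lt p p.
Proof. by move/path_lt_len; rewrite ltnn. Qed.

Lemma path_lt_trans p q w : path_lt p q -> path_lt q w -> path_lt p w.
Proof.
move=> /path_ltP [r [h1 h2 h3 h4]] /path_ltP [r' [g1 g2 g3 g4]].
have c : composable r r'.
  by move: g2; rewrite /composable (sim_head Swf Sgr h4) phead_pcat.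
apply/path_ltP; exists (pcat r r'); split => //.
- by rewrite is_path_pcat // h1.
- by rewrite plen_pcat; lia.
- by rewrite pcatA; apply: (sim_trans g4); apply: sim_catr.
Qed.

Lemma path_lt_simr p q q' : sim q q' -> path_lt p q -> path_lt p q'.
Proof.
move=> h /path_ltP [r [h1 h2 h3 h4]]; apply/path_ltP; exists r; split=> //.
exact: sim_trans (sim_sym h) h4.
Qed.

Lemma path_lt_siml p p' q : sim p p' -> path_lt p q -> path_lt p' q.
Proof.
move=> h /path_ltP [r [h1 h2 h3 h4]]; apply/path_ltP; exists r; split=> //.
  by move: h2; rewrite /composable (sim_head Swf Sgr h).
by apply: (sim_trans h4); apply: sim_catr.
Qed.

Lemma path_lt_cat p r : is_path p -> is_path r -> composable p r -> (0 < plen r)%N ->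
  path_lt p (pcat p r).
Proof.
move=> hp hr c r0; apply/path_ltP; exists r; split=> //.
by apply: sim_refl; rewrite is_path_pcat // hp.
Qed.

Definition path_leq p q : Prop := sim p q \/ path_lt p q.

Lemma path_lt_leq_trans p q w : path_lt p q -> path_leq q w -> path_lt p w.
Proof. by move=> h [h'|h']; [apply: path_lt_simr h|apply: path_lt_trans h h']. Qed.

Lemma path_leq_lt_trans p q w : path_leq p q -> path_lt q w -> path_lt p w.
Proof.
move=> [h'|h'] h; last exact: path_lt_trans h' h.
by apply: path_lt_siml h; apply: sim_sym.
Qed.

Lemma path_lt_leq p q w : path_lt p q -> path_leq q w -> path_leq p w.
Proof. by move=> h h'; right; apply: path_lt_leq_trans h h'. Qed.

Section Interval.
Variables (x y : qp) (s : seq qp).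
Hypothesis Hs : enum_interval k tl hd S x y s.
Local Notation N := (size s).
Implicit Types (A B : {set 'I_N}) (i j : 'I_N).

Let z i : qp := nth x s i.

Definition ilt : rel 'I_N := fun i j => `[< path_lt (z i) (z j) >].

Lemma z_int i : path_lt x (z i) /\ path_lt (z i) y.
Proof. by case: Hs => h _ _; apply: h; apply: mem_nth. Qed.

Lemma z_inj i j : sim (z i) (z j) -> i = j.
Proof.
case: Hs => _ h _ hs; apply/eqP/negPn/negP => ne; exact: (h i j _ _ ne hs).
Qed.

(** Stated as an equality of sets because [chain_of] is a union of such sets. *)
Lemma z_ex w : path_lt x w -> path_lt w y -> exists i, [set j | `[< sim (z j) w >]] = [set i].
Proof.
move=> h1 h2; case: Hs => _ _ h; have [v /(nthP x) [i hi e] hv] := h w (path_lt_pathl h2) h1 h2.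
exists (Ordinal hi); apply/setP => j; rewrite !inE; apply/asboolP/eqP => [hj|->].
  by apply: z_inj; rewrite /z /= e; apply: sim_trans hj hv.
by apply: sim_sym; rewrite /z /= e.
Qed.

Lemma ilt_irr : irreflexive ilt.
Proof. by move=> i; apply/asboolP; apply: path_lt_irr. Qed.

Lemma ilt_asym i j : ilt i j -> ~~ ilt j i.
Proof.
by move=> /asboolP h1; apply/asboolP => h2; apply: (path_lt_irr (path_lt_trans h1 h2)).
Qed.

Lemma ilt_trans i j i' : ilt i j -> ilt j i' -> ilt i i'.
Proof.
by move=> /asboolP h1 /asboolP h2; apply/asboolP; apply: path_lt_trans h1 h2.
Qed.

Definition int_complex : {set {set 'I_N}} :=
  order_complex (fun i j : 'I_N => path_lt (nth x s i) (nth x s j)).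

Lemma int_complexP A : reflect (forall i j, i \in A -> j \in A -> i != j -> ilt i j \/ ilt j i) (A \in int_complex).
Proof.
rewrite inE; apply: (iffP (asboolP _)) => H i j iA jA ne.
  by have [h|h] := H i j iA jA ne; [left|right]; apply/asboolP.
by have [/asboolP h|/asboolP h] := H i j iA jA ne; [left|right].
Qed.

Lemma int_complex_complex : scomplex ilt int_complex.
Proof.
split=> [A B /int_complexP h /subsetP sub|A /int_complexP h i j iA jA ne].
  by apply/int_complexP => i j /sub iA /sub jA; apply: h.
by have [l|l] := h i j iA jA ne; rewrite l (negPf (ilt_asym l)).
Qed.

(** All subintervals are realized on the vertices of the ambient interval, so that links and joins
    are sets over one type. *)
Definition subint p q : {set {set 'I_N}} :=
  [set A in int_complex | `[< forall i, i \in A -> path_lt p (z i) /\ path_lt (z i) q >]].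

Lemma subintP p q A : reflect (A \in int_complex /\ forall i, i \in A -> path_lt p (z i) /\ path_lt (z i) q)
  (A \in subint p q).
Proof.
apply: (iffP idP); first by rewrite /subint in_set => /andP [h1 /asboolP h2].
by move=> [h1 h2]; rewrite /subint in_set h1; apply/asboolP.
Qed.

Lemma subint_complex p q : scomplex ilt (subint p q).
Proof.
split=> [A B /subintP [h1 h2] sub|A /subintP [h1 _]]; last exact: int_complex_complex.2.
apply/subintP; split; first exact: int_complex_complex.1 h1 sub.
by move=> i iB; apply: h2; apply: (subsetP sub).
Qed.

Lemma subint_full : subint x y = int_complex.
Proof.
apply/setP => A; apply/subintP/idP => [[] //|h]; split=> // i _; exact: z_int.
Qed.

Lemma subint_sim p q q' : sim q q' -> subint p q = subint p q'.
Proof.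
move=> h; apply/setP => A; apply/subintP/subintP => -[h1 h2]; split=> // i /h2 [g1 g2];
 split=> //; first exact: path_lt_simr h g2.
exact: path_lt_simr (sim_sym h) g2.
Qed.

Lemma top_exists A : A \in int_complex -> A != set0 ->
  exists2 i, i \in A & forall j, j \in A -> j != i -> ilt j i.
Proof.
move=> /int_complexP h /set0Pn [i0 i0A].
case: (arg_maxnP (fun i => plen (z i)) i0A) => i iA imax.
exists i => // j jA ne; have [//|/asboolP /path_lt_len l] := h j i jA iA ne.
by have /= := imax j jA; move: l; lia.
Qed.

Section Bottom.
Variable p : qp.
Hypotheses (hp : is_path p) (hxp : path_leq x p).

(* The chain of partial products attached to a factorization. *)
Fixpoint chain_of l : {set 'I_N} :=
  if l is b :: t then
    if t is c :: l' then [set i | `[< sim (z i) (pcat p (lprod c l')) >]] :|: chain_of t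
    else set0
  else set0.

Lemma chain_of2 b c l : chain_of [:: b, c & l] =
  [set i | `[< sim (z i) (pcat p (lprod c l)) >]] :|: chain_of (c :: l).
Proof. by []. Qed.

Lemma chain_of_hd b c l : chain_of (b :: l) = chain_of (c :: l).
Proof. by case: l. Qed.

Definition good b l : Prop :=
  [/\ okl (b :: l), composable p (lprod b l) & path_leq (pcat p (lprod b l)) y].

Lemma good_lt b c l : good b (c :: l) ->
  path_lt (pcat p (lprod c l)) (pcat p (lprod b (c :: l))).
Proof.
move=> [ok cp _]; have [h1 h2 h3] := lprod_ok (okl_tl ok).
have cl := lprod_comp ok.
rewrite [lprod b _]/= pcatA; apply: path_lt_cat.
- by rewrite is_path_pcat ?hp.
- exact: okl_path ok.
- by rewrite composable_pcatl.
- exact: okl_pos ok.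
Qed.

Lemma good_tl b c l : good b (c :: l) -> good c l.
Proof.
move=> g; have h := good_lt g; case: g => ok cp hy; split=> //.
  exact: okl_tl ok.
exact: path_lt_leq h hy.
Qed.

Lemma good_gt b l : good b l -> path_lt p (pcat p (lprod b l)).
Proof.
move=> [ok cp hy]; have [h1 h2 h3] := lprod_ok ok; apply: path_lt_cat => //.
by rewrite h3 tlen_cons; have := okl_pos ok; lia.
Qed.

Lemma chain_of_cons b c l : good b (c :: l) -> exists i,
  [/\ sim (z i) (pcat p (lprod c l)), chain_of [:: b, c & l] = i |: chain_of (c :: l)
    & [set j | `[< sim (z j) (pcat p (lprod c l)) >]] = [set i]].
Proof.
move=> g; have h1 := good_gt (good_tl g).
have h2 : path_lt (pcat p (lprod c l)) y.
  by apply: path_lt_leq_trans (good_lt g) _; case: g.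
have [i iE] := z_ex (path_leq_lt_trans hxp h1) h2; exists i.
rewrite chain_of2 iE; split=> //.
by have := set11 i; rewrite -iE inE => /asboolP.
Qed.

Lemma chain_of_int b l : good b l -> forall i, i \in chain_of (b :: l) ->
  path_lt p (z i) /\ path_lt (z i) (pcat p (lprod b l)).
Proof.
elim: l b => [|c l IH] b g i; first by rewrite inE.
have [i0 [h1 -> _]] := chain_of_cons g; have hb := good_lt g.
rewrite in_setU1 => /orP [/eqP ->|/(IH c (good_tl g)) [g1 g2]].
  split; first exact: path_lt_simr (sim_sym h1) (good_gt (good_tl g)).
  exact: path_lt_siml (sim_sym h1) hb.
by split=> //; apply: path_lt_trans g2 hb.
Qed.

Lemma chain_of_below b c l i : good b (c :: l) -> sim (z i) (pcat p (lprod c l)) ->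
  forall j, j \in chain_of (c :: l) -> ilt j i.
Proof.
move=> g h j /(chain_of_int (good_tl g)) [_ h2]; apply/asboolP.
exact: path_lt_simr (sim_sym h) h2.
Qed.

Lemma chain_of_chain b l : good b l ->
  chain_of (b :: l) \in int_complex /\ #|chain_of (b :: l)| = size l.
Proof.
elim: l b => [|c l IH] b g.
  by rewrite cards0; split=> //; apply/int_complexP => i j; rewrite inE.
have [i0 [h1 -> _]] := chain_of_cons g; have [/int_complexP h2 h3] := IH c (good_tl g).
have hb := chain_of_below g h1.
have ni : i0 \notin chain_of (c :: l) by apply/negP => /hb; rewrite ilt_irr.
split; last by rewrite cardsU1 ni h3.
apply/int_complexP => i j; rewrite !in_setU1.
case/orP => [/eqP ->|iA] /orP [/eqP ->|jA] ne.
- by rewrite eqxx in ne.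
- by right; apply: hb.
- by left; apply: hb.
- exact: h2.
Qed.

Lemma chain_of_dint b l : good b l -> chain_of (b :: l) \in subint p (pcat p (lprod b l)).
Proof.
move=> g; apply/subintP; split; first by case: (chain_of_chain g).
exact: chain_of_int.
Qed.

(** The top of the chain is [p] times the product of all factors but the last one applied on the
    right. Cancelling [p] identifies these products, and cancelling them from the full products
    identifies the first list entries; the rest is induction. *)
Lemma chain_of_inj b l c m : good b l -> good c m -> sim (lprod b l) (lprod c m) ->
  chain_of (b :: l) = chain_of (c :: m) -> lsim (b :: l) (c :: m).
Proof.
elim: l b c m => [|b' l IH] b c m gb gc hs e.
  have [_ c1] := chain_of_chain gb; have [_ c2] := chain_of_chain gc.
  by move: c2; rewrite -e c1; case: m {gc e} hs.
have [_ c1] := chain_of_chain gb; have [_ c2] := chain_of_chain gc.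
case: m gc hs e c2 => [|c' m] gc hs e c2; first by move: c2; rewrite -e c1.
have [i [i1 i2 _]] := chain_of_cons gb; have [j [j1 j2 _]] := chain_of_cons gc.
have bi := chain_of_below gb i1; have bj := chain_of_below gc j1.
have ij : i = j.
  apply/eqP/negPn/negP => ne; rewrite i2 j2 in e.
  have : i \in j |: chain_of (c' :: m) by rewrite -e setU11.
  rewrite in_setU1 (negPf ne) /= => /bj l1.
  have : j \in i |: chain_of (b' :: l) by rewrite e setU11.
  rewrite in_setU1 eq_sym (negPf ne) /= => /bi l2.
  by rewrite (negPf (ilt_asym l1)) in l2.
have e' : chain_of (b' :: l) = chain_of (c' :: m).
  have n1 : i \notin chain_of (b' :: l) by apply/negP => /bi; rewrite ilt_irr.
  have n2 : i \notin chain_of (c' :: m) by rewrite ij; apply/negP => /bj; rewrite ilt_irr.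
  by rewrite -(setU1K n1) -(setU1K n2) -i2 e j2 ij.
have gb' := good_tl gb; have gc' := good_tl gc.
have [okb cb _] := gb'; have [okc cc _] := gc'.
have [pb _ _] := lprod_ok okb; have [pc _ _] := lprod_ok okc.
have hs' : sim (lprod b' l) (lprod c' m).
  apply: (Hcan.1 p) => //; apply: sim_trans (sim_sym i1) _; by rewrite ij.
split; last exact: IH.
have [ok1 _ _] := gb; have [ok2 _ _] := gc.
have k1 := lprod_comp ok1; have k2 := lprod_comp ok2.
have k3 : composable (lprod b' l) c by rewrite /composable (sim_head Swf Sgr hs').
apply: (Hcan.1 (lprod b' l)) => //; [exact: okl_path ok1|exact: okl_path ok2|].
apply: (sim_trans hs); apply: sim_sym.
by apply: sim_catr => //; apply: okl_path ok2.
Qed.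

(** With [p w] the top of the chain and [r] equivalent to [w b], the remaining chain lies between
    [p] and [p w] and comes by induction from a factorization of [w], to which [b] is added. *)
Lemma chain_of_surj A r : is_path r -> composable p r -> (0 < plen r)%N ->
  path_leq (pcat p r) y -> A \in subint p (pcat p r) ->
  exists b l, [/\ good b l, sim (lprod b l) r & chain_of (b :: l) = A].
Proof.
move cA : #|A| => n; elim: n A cA r => [|n IH] A cA r hr cr r0 hy /subintP [AD Aint].
  exists r, [::]; split=> //; last by apply/esym/eqP; rewrite -cards_eq0 cA.
    by split=> //; rewrite okl_cons hr r0.
  exact: sim_refl.
have [|i iA itop] := top_exists AD; first by rewrite -card_gt0 cA.
have [/path_ltP [w [w1 w2 w3 w4]] /path_ltP [b [b1 b2 b3 b4]]] := Aint i iA.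
have hpw : is_path (pcat p w) by apply: sim_pathr w4.
have cwb : composable w b.
  by move: b2; rewrite /composable (sim_head Swf Sgr w4) phead_pcat.
have wy : path_lt (pcat p w) y.
  apply: path_lt_leq_trans hy; apply: (path_lt_siml w4).
  by apply/path_ltP; exists b.
have cA' : #|A :\ i| = n by move: cA; rewrite (cardsD1 i) iA => -[].
have Ai : A :\ i \in subint p (pcat p w).
  apply/subintP; split; first by apply: int_complex_complex.1 AD _; apply: subsetDl.
  move=> j; rewrite !inE => /andP [ne jA]; split; first by case: (Aint j jA).
  by apply: (path_lt_simr w4); apply/asboolP; apply: itop.
have [c [l [g1 g2 g3]]] := IH _ cA' w w1 w2 w3 (or_intror wy) Ai.
have [ok cc _] := g1; have [lp lh ll] := lprod_ok ok.
have cb : composable (lprod c l) b by rewrite /composable (sim_head Swf Sgr g2).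
have hprod : sim (lprod b (c :: l)) r.
  rewrite [lprod b _]/=; apply: (sim_trans (sim_catr Swf Sgr b1 cb g2)).
  apply: (Hcan.1 p) => //; first by rewrite is_path_pcat // w1.
  rewrite pcatA; apply: sim_sym; apply: (sim_trans b4).
  exact: (sim_catr Swf Sgr b1 b2 w4).
have g : good b (c :: l).
  split.
  - rewrite okl_cons b1 b3 ok /= andbT; move: cb; rewrite /composable lh => /eqP ->.
    by rewrite eqxx.
  - by rewrite /composable (sim_tail Swf Sgr hprod).
  - have h := sim_catl Swf Sgr hp (_ : composable p (lprod b (c :: l))) hprod.
    case: hy => hy; [left; apply: sim_trans (h _) hy|right; apply: path_lt_siml hy; apply: sim_sym; apply: h].
      by rewrite /composable (sim_tail Swf Sgr hprod).
    by rewrite /composable (sim_tail Swf Sgr hprod).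
exists b, (c :: l); split=> //.
have [i' [h1 -> _]] := chain_of_cons g.
have -> : i' = i.
  apply: z_inj; apply: (sim_trans h1); apply: sim_sym; apply: (sim_trans w4).
  by apply: sim_catl => //; apply: sim_sym.
by rewrite g3 setD1K.
Qed.

(** Nothing lies above [i], so its deletion has sign 1, while [i] lies above every other vertex and
    reverses the signs of their deletions. *)
Lemma sdelta_top (phi : {set 'I_N} -> k) i A : (forall j, j \in A -> ilt j i) ->
  sdelta ilt phi (i |: A) = phi A - sdelta ilt (fun B => phi (i |: B)) A.
Proof.
move=> top; have iA : i \notin A by apply/negP => /top; rewrite ilt_irr.
rewrite /sdelta big_setU1 //=; congr (_ + _).
  have -> : above ilt i (i |: A) = 0%N.
    apply: eq_card0 => j; rewrite !inE; case: eqP => [->|_] /=; first by rewrite ilt_irr.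
    by apply/negP => /andP [/top /ilt_asym /negPf ->].
  by rewrite expr0 mul1r setU1K.
rewrite -sumrN; apply: eq_bigr => j jA.
have ji : j != i by apply: contraNneq iA => <-.
have -> : (i |: A) :\ j = i |: (A :\ j).
  by rewrite setDUl; congr (_ :|: _); apply/setDidPl; rewrite disjoint_sym disjoints1 inE.
rewrite (aboveD1 ilt j (setU11 i A)) (top j jA) setU1K // exprS mulN1r mulNr //.
Qed.

(** Merging two neighbouring factors deletes the partial product between them. The first merge
    deletes the top vertex, so [mrg] and [sdelta] obey the same recursion. *)
Lemma mrg_sdelta (F : seq qp -> k) (phi : {set 'I_N} -> k) b l : good b l ->
  (forall m, m \in merges (b :: l) -> F m = phi (chain_of m)) ->
  mrg F (b :: l) = sdelta ilt phi (chain_of (b :: l)).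
Proof.
elim: l b F phi => [|c l IH] b F phi g H.
  by rewrite mrg1 /sdelta big_set0.
have [i [h1 h2 h3]] := chain_of_cons g.
have hb := chain_of_below g h1.
rewrite mrg2 h2 sdelta_top // H ?merges2 ?inE ?eqxx // (chain_of_hd _ c).
congr (_ - _); apply: IH; first exact: good_tl g.
move=> m hm; rewrite H; last by rewrite merges2 inE map_f ?orbT.
have [c' [m' [e e']]] := merges_lprod hm.
by rewrite e chain_of2 e' h3.
Qed.

End Bottom.
End Interval.
End PathOrder.

(** * Factorizations as faces, and links as joins *)

Section Bridge.
Variables (k : fieldType) (V E : finType) (tl hd : E -> V).
Variable S : qpath V E -> qpath V E -> Prop.
Local Notation qp := (qpath V E).
Local Notation is_path := (is_path tl hd).
Local Notation composable := (composable hd).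
Local Notation path_lt := (path_lt k tl hd S).
Local Notation path_leq := (path_leq k tl hd S).
Local Notation okl := (okl tl hd).
Local Notation lsim := (lsim k tl hd S).
Local Notation factors := (factors k tl hd S).
Local Notation factor_exact := (factor_exact k tl hd S).
Hypotheses (Swf : S_wf tl hd S) (Sgr : S_graded S) (Hcan : cancellative k tl hd S).
Implicit Types (p q r w : qp) (l : seq qp).

Section Interval.
Variables (x y : qp) (s : seq qp).
Hypothesis Hs : enum_interval k tl hd S x y s.
Local Notation N := (size s).
Implicit Types (A B : {set 'I_N}) (i j : 'I_N).
Local Notation ilt := (ilt k tl hd S x (s := s)).
Local Notation subint := (subint k tl hd S x s).
Local Notation chain_of := (chain_of k tl hd S x s).
Local Notation good := (good k tl hd S y).

Section Bottom.
Variables (p r : qp).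
Hypotheses (hp : is_path p) (hxp : path_leq x p).
Hypotheses (hr : is_path r) (cr : composable p r) (r0 : (0 < plen r)%N)
           (hy : path_leq (pcat p r) y).

Lemma factors_good b l : okl (b :: l) -> factors r (b :: l) -> good p b l.
Proof.
move=> ok h; have c : composable p (lprod b l) by rewrite /composable (sim_tail Swf Sgr h).
split=> //; have h' := sim_catl Swf Sgr hp c h.
case: hy => g; first by left; apply: sim_trans h' g.
by right; apply: (path_lt_siml Swf Sgr (sim_sym h')).
Qed.

Lemma chain_of_factors b l : okl (b :: l) -> factors r (b :: l) ->
  chain_of p (b :: l) \in subint p (pcat p r) /\ #|chain_of p (b :: l)| = size l.
Proof.
move=> ok h; have g := factors_good ok h.
have [_ ->] := chain_of_chain Swf Sgr Hs hp hxp g; split=> //.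
have c : composable p (lprod b l) by case: g.
rewrite -(subint_sim Swf Sgr x s p (sim_catl Swf Sgr hp c h)).
exact: chain_of_dint g.
Qed.

Lemma subint_factors A : A \in subint p (pcat p r) ->
  exists l, [/\ okl l, factors r l, chain_of p l = A & size l = #|A|.+1].
Proof.
move=> hA; have [b [l [g h e]]] := chain_of_surj Swf Sgr Hcan Hs hp hxp hr cr r0 hy hA.
exists (b :: l); have [ok _ _] := g; split=> //.
by rewrite -e; have [_ ->] := chain_of_chain Swf Sgr Hs hp hxp g.
Qed.

Lemma chain_of_eq l m : okl l -> okl m -> factors r l -> factors r m ->
  chain_of p l = chain_of p m -> lsim l m.
Proof.
case: l m => [|b l] [|c m] // ok1 ok2 h1 h2 e.
apply: (chain_of_inj Swf Sgr Hcan Hs hp hxp) e.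
- exact: factors_good.
- exact: factors_good.
- exact: sim_trans h1 (sim_sym h2).
Qed.

Lemma chain_of_lsim b l c m : good p b l -> lsim (b :: l) (c :: m) ->
  chain_of p (b :: l) = chain_of p (c :: m).
Proof.
elim: l b c m => [|b' l IH] b c [|c' m] g [_ hs] //; try by case: hs.
have g' := good_tl Swf Sgr hp g; have [ok cc _] := g'.
rewrite !chain_of2 (IH b' c' m) //; congr (_ :|: _).
have h := sim_catl Swf Sgr hp cc (lsim_lprod Swf Sgr ok hs).
apply/setP => i; rewrite !inE; apply: asbool_equiv_eq.
by split=> h'; [apply: sim_trans h' h|apply: sim_trans h' (sim_sym h)].
Qed.

Lemma chain_of_invariant (phi : {set 'I_N} -> k) n : sim_invariant tl hd S r n (fun l => phi (chain_of p l)).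
Proof.
move=> [|b l] [|c m] // ok hs _ h; congr (phi _).
by apply: chain_of_lsim => //; apply: factors_good.
Qed.

Lemma listing_exists : exists lof : {set 'I_N} -> seq qp, forall A, A \in subint p (pcat p r) ->
  [/\ okl (lof A), factors r (lof A), chain_of p (lof A) = A & size (lof A) = #|A|.+1].
Proof.
have /choice [lof lofP] : forall A, exists l, A \in subint p (pcat p r) ->
  [/\ okl l, factors r l, chain_of p l = A & size l = #|A|.+1].
  move=> A; case: (boolP (A \in subint p (pcat p r))) => [/subint_factors [l hl]|_].
    by exists l.
  by exists [::].
by exists lof.
Qed.

(** A merge of [lof A] and the listing of its chain are factorizations with the same chain, hence
    equivalent, and [F] does not distinguish them. *)
Lemma sdelta_listing lof (F : seq qp -> k) (m : nat) A :
  (forall A, A \in subint p (pcat p r) ->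
    [/\ okl (lof A), factors r (lof A), chain_of p (lof A) = A & size (lof A) = #|A|.+1]) ->
  sim_invariant tl hd S r m F -> A \in subint p (pcat p r) -> #|A| = m ->
  sdelta ilt (fun B => F (lof B)) A = mrg F (lof A).
Proof.
move=> lofP Finv hA cA; have [ok h e sz] := lofP A hA.
case: (lof A) ok h e sz => // b l ok h e sz; rewrite -[in LHS]e; symmetry.
apply: (mrg_sdelta Swf Sgr Hs hp hxp); first exact: factors_good.
move=> l' hl'; have [ok' _ _] := mergesP ok hl'.
have h' : factors r l' by apply/(factors_merges k tl hd S r hl').
have [c [m' [el' _]]] := merges_lprod hl'; rewrite el' in ok' h' hl' *.
have sz' := merges_size hl'; rewrite sz cA in sz'.
have [hA' _] := chain_of_factors ok' h'.
have [ok2 h2 e2 sz2] := lofP _ hA'.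
apply: Finv => //; first by apply: chain_of_eq.
by case: sz'.
Qed.

(** A factorization into [m.+1] factors has [m] intermediate partial products, whence the shift. *)
Lemma factor_exact_face_exact m : factor_exact r m.+1 -> face_exact k ilt (subint p (pcat p r)) m.
Proof.
move=> ex phi zphi; have [lof lofP] := listing_exists.
have [l ok sz h|G Ginv GE] := ex (fun l => phi (chain_of p l)) (@chain_of_invariant phi m.+1).
  case: l ok sz h => // b l ok sz h; rewrite (@mrg_sdelta _ _ _ _ _ _ Swf Sgr _ _ _ Hs _ hp hxp _ phi) //.
    have [h1 h2] := chain_of_factors ok h; apply: zphi => //.
    by rewrite h2; case: sz.
  exact: factors_good.
exists (fun A => G (lof A)) => A hA cA; have [l1 l2 l3 l4] := lofP A hA.
by rewrite (sdelta_listing lofP Ginv) // GE ?l3 // l4 cA.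
Qed.

Lemma face_exact_factor_exact m : face_exact k ilt (subint p (pcat p r)) m -> factor_exact r m.+1.
Proof.
move=> ex F Finv F0; have [lof lofP] := listing_exists.
have [A hA cA|psi psiE] := ex (fun A => F (lof A)).
  by have [l1 l2 l3 l4] := lofP A hA; rewrite (sdelta_listing lofP Finv) // F0 // l4 cA.
exists (fun l => psi (chain_of p l)); first exact: chain_of_invariant.
move=> [|b l] ok // sz h; have g := factors_good ok h.
have [h1 h2] := chain_of_factors ok h.
rewrite (@mrg_sdelta _ _ _ _ _ _ Swf Sgr _ _ _ Hs _ hp hxp _ psi) // psiE //; last first.
  by rewrite h2; case: sz.
have [l1 l2 l3 l4] := lofP _ h1; apply: Finv => //; last first.
  by rewrite l4 h2 -sz.
by apply: chain_of_eq.
Qed.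

Lemma subint_card A : A \in subint p (pcat p r) -> (#|A| < plen r)%N.
Proof.
move=> /subint_factors [l [ok h _ <-]].
by rewrite -(factors_tlen Swf Sgr ok h); apply: size_tlen ok.
Qed.

End Bottom.

Section Links.
Hypothesis Hex : forall r n, (n < plen r)%N -> factor_exact r n.
Hypothesis hx : is_path x.

Let z i : qp := nth x s i.

Lemma subint_bound p q A : path_leq x p -> path_leq q y -> path_lt p q ->
  A \in subint p q -> (#|A| + plen p < plen q)%N.
Proof.
move=> hxp hqy hpq; have hp := path_lt_pathl Swf Sgr hpq.
have [r [r1 r2 r3 r4]] := (path_ltP k Swf Sgr p q).1 hpq.
have hy : path_leq (pcat p r) y.
  case: hqy => h; first by left; apply: sim_trans (sim_sym r4) h.
  by right; apply: (path_lt_siml Swf Sgr r4).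
rewrite (subint_sim Swf Sgr x s p r4) => /(subint_card hp hxp r1 r2 r3 hy).
by rewrite (sim_len Swf Sgr r4) plen_pcat; lia.
Qed.

Lemma subint_face_exact p q m : path_leq x p -> path_leq q y -> path_lt p q ->
  (m.+1 + plen p < plen q)%N -> face_exact k ilt (subint p q) m.
Proof.
move=> hxp hqy hpq hm; have hp := path_lt_pathl Swf Sgr hpq.
have [r [r1 r2 r3 r4]] := (path_ltP k Swf Sgr p q).1 hpq.
have hy : path_leq (pcat p r) y.
  case: hqy => h; first by left; apply: sim_trans (sim_sym r4) h.
  by right; apply: (path_lt_siml Swf Sgr r4).
rewrite (subint_sim Swf Sgr x s p r4); apply: factor_exact_face_exact => //.
by apply: Hex; move: hm; rewrite (sim_len Swf Sgr r4) plen_pcat; lia.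
Qed.

Lemma linkE (C : {set {set 'I_N}}) F A : (A \in link C F) =
  [&& A \in C, F :|: A \in C & [disjoint F & A]].
Proof. by rewrite inE. Qed.

Lemma link_complex (C : {set {set 'I_N}}) F : scomplex ilt C -> scomplex ilt (link C F).
Proof.
move=> [Cs Cc]; split=> [A B|A]; rewrite ?linkE.
  move=> /and3P [h1 h2 h3] BA; apply/and3P; split.
  - exact: Cs h1 BA.
  - by apply: Cs h2 _; apply: setUS.
  - exact: disjointWr BA h3.
by move=> /and3P [h _ _]; apply: Cc.
Qed.

Lemma link_bound q F A : path_leq q y -> path_lt x q ->
  A \in link (subint x q) F -> (#|A| + #|F| + plen x < plen q)%N.
Proof.
move=> hqy hxq; rewrite linkE => /and3P [_ h2 h3].
have := subint_bound (or_introl (sim_refl k S hx)) hqy hxq h2.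
have -> : #|F :|: A| = (#|F| + #|A|)%N by apply/eqP; rewrite (leq_card_setU F A).2.
lia.
Qed.

(** Induction on the number of vertices of [F]: with [z i] its top, the link of [F] is the join of
    the link of [F :\ i] in the interval from [x] to [z i] with the interval from [z i] to [q]. *)
Lemma link_face_exact q F m : path_leq q y -> path_lt x q -> F \in subint x q ->
  (m.+1 + #|F| + plen x < plen q)%N -> face_exact k ilt (link (subint x q) F) m.
Proof.
have xx : path_leq x x by left; apply: sim_refl.
move cF : #|F| => n; elim: n F cF q m => [|n IH] F cF q m hqy hxq hF hm.
  have F0 : F = set0 by apply/eqP; rewrite -cards_eq0 cF.
  have -> : link (subint x q) F = subint x q.
    by apply/setP => A; rewrite linkE F0 set0U -setI_eq0 set0I eqxx andbT andbb.
  by apply: subint_face_exact => //; lia.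
have [FD Fint] := elimT (subintP k tl hd S x (s := s) x q F) hF.
have [|i iF itop] := top_exists Swf Sgr FD; first by rewrite -card_gt0 cF.
have [xi iq] := Fint i iF.
have iy : path_leq (z i) y by apply: (path_lt_leq Swf Sgr) iq hqy.
have xzi : path_leq x (z i) by right.
pose D1 := link (subint x (z i)) (F :\ i); pose D2 := subint (z i) q.
(* A chain strictly between paths of lengths [a < b] has at most [b - a - 1] vertices, and [F :\ i]
   uses up some of those below [z i]. The sum of [N1] and [N2] is the corresponding bound for the
   link of [F]. *)
pose N1 := (plen (z i) - (plen x + #|F :\ i|).+1)%N.
pose N2 := (plen q - (plen (z i)).+1)%N.
pose X := [set j | ilt j i].
have cFi : #|F :\ i| = n by move: cF; rewrite (cardsD1 i) iF => -[].
have Fi : F :\ i \in subint x (z i).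
  apply/subintP; split; first by apply: (int_complex_complex k Swf Sgr x s).1 FD _; apply: subsetDl.
  move=> j; rewrite !inE => /andP [ne jF]; split; first by case: (Fint j jF).
  by apply/asboolP; apply: itop.
have bFi := subint_bound xx iy xi Fi.
have liq := path_lt_len Swf Sgr iq.
have C1 : scomplex ilt D1 by apply: link_complex; apply: subint_complex.
have C2 : scomplex ilt D2 by apply: subint_complex.
have X1 A : A \in D1 -> A \subset X.
  rewrite linkE => /and3P [/subintP [_ h] _ _]; apply/subsetP => j jA.
  by rewrite inE; apply/asboolP; case: (h j jA).
have X2 A : A \in D2 -> [disjoint A & X].
  move=> /subintP [_ h]; rewrite disjoint_subset; apply/subsetP => j jA.
  rewrite !inE; apply/asboolP => l1; have [l2 _] := h j jA.
  exact: (path_lt_irr Swf Sgr (path_lt_trans Swf Sgr l1 l2)).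
have lt12 A B a b : A \in D1 -> B \in D2 -> a \in A -> b \in B -> ilt a b /\ ~~ ilt b a.
  rewrite linkE => /and3P [/subintP [_ h1] _ _] /subintP [_ h2] aA bB.
  have l : ilt a b.
    by apply/asboolP; apply: (path_lt_trans Swf Sgr) (h1 a aA).2 (h2 b bB).1.
  by split=> //; apply: ilt_asym l.
have le1 A : A \in D1 -> (#|A| <= N1)%N.
  by move=> hA; have := link_bound iy xi hA; rewrite /N1; lia.
have le2 A : A \in D2 -> (#|A| <= N2)%N.
  by move=> hA; have := subint_bound xzi hqy iq hA; rewrite /N2; lia.
have ex1 m1 : (m1 < N1)%N -> face_exact k ilt D1 m1.
  by move=> h; apply: IH => //; rewrite /N1 in h; lia.
have ex2 m2 : (m2 < N2)%N -> face_exact k ilt D2 m2.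
  by move=> h; apply: subint_face_exact => //; rewrite /N2 in h; lia.
(* A vertex compatible with [F] is comparable with [z i], so a face of the link splits into a part
   below [z i] and a part above it. *)
have -> : link (subint x q) F = joinc D1 D2 X.
  apply/setP => A; rewrite linkE [RHS]in_set; apply/and3P/andP.
    move=> [/subintP [AD Aint] /subintP [FAD FAint] dFA]; split.
      rewrite linkE; apply/and3P; split.
      - apply/subintP; split; first by apply: (int_complex_complex k Swf Sgr x s).1 AD _; apply: subsetIl.
        move=> j; rewrite !inE => /andP [jA /asboolP ji]; split=> //.
        by case: (Aint j jA).
      - apply/subintP; split.
          apply: (int_complex_complex k Swf Sgr x s).1 FAD _; apply: setUSS; first exact: subsetDl.
          exact: subsetIl.
        move=> j; rewrite in_setU => /orP [jF|].
          by have [_ h] := elimT (subintP _ _ _ _ _ _ _ _) Fi; apply: h.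
        rewrite !inE => /andP [jA /asboolP ji]; split=> //.
        by case: (Aint j jA).
      - apply: disjointWl (subsetDl _ _) _; exact: disjointWr (subsetIl _ _) dFA.
    apply/subintP; split; first by apply: (int_complex_complex k Swf Sgr x s).1 AD _; apply: subsetDl.
    move=> j; rewrite !inE => /andP [nji jA]; split; last by case: (Aint j jA).
    have ne : j != i by apply/eqP => e; rewrite -e in iF; rewrite (disjointFr dFA iF) in jA.
    have := elimT (int_complexP k tl hd S x (s := s) (F :|: A)) FAD j i; rewrite !in_setU iF jA orbT /=.
    by move=> /(_ isT isT ne) [h|/asboolP //]; rewrite h in nji.
  move=> [h1 h2]; have := h1; rewrite linkE => /and3P [/subintP [A1 a1] /subintP [A2 a2] A3].
  have [B1 b1] := elimT (subintP _ _ _ _ _ _ _ _) h2.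
  have Aint j : j \in A -> path_lt x (z j) /\ path_lt (z j) q.
    move=> jA; have [jX|jX] := boolP (j \in X).
      have [|l1 l2] := a1 j; first by rewrite !inE jA; move: jX; rewrite inE => ->.
      by split=> //; apply: (path_lt_trans Swf Sgr) l2 iq.
    have [|l1 l2] := b1 j; first by rewrite !inE jA; move: jX; rewrite inE => ->.
    by split=> //; apply: (path_lt_trans Swf Sgr) xi l1.
  have FAint j : j \in F :|: A -> path_lt x (z j) /\ path_lt (z j) q.
    by rewrite in_setU => /orP [/Fint|/Aint].
  have FAX j : j \in F :|: A -> [\/ j \in F :\ i :|: A :&: X, j = i | j \in A :\: X].
    rewrite in_setU => /orP [jF|jA].
      by have [->|ne] := eqVneq j i; [apply: Or32|apply: Or31; rewrite !inE ne jF].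
    by have [jX|jX] := boolP (j \in X); [apply: Or31|apply: Or33]; rewrite !inE jA ?jX ?orbT //;
      move: jX; rewrite inE => ->; rewrite ?orbT.
  have FAD : F :|: A \in int_complex k tl hd S x s.
    apply/int_complexP => j j' jFA j'FA ne.
    have low t : t \in F :\ i :|: A :&: X -> ilt t i by move/a2 => [_ h]; apply/asboolP.
    have upp t : t \in A :\: X -> ilt i t by move/b1 => [h _]; apply/asboolP.
    case: (FAX j jFA) => hj; case: (FAX j' j'FA) => hj'.
    - exact: (elimT (int_complexP _ _ _ _ _ _) A2).
    - by rewrite hj'; left; apply: low.
    - by left; apply: (ilt_trans Swf Sgr (low _ hj) (upp _ hj')).
    - by rewrite hj; right; apply: low.
    - by rewrite hj hj' eqxx in ne.
    - by rewrite hj; left; apply: upp.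
    - by right; apply: (ilt_trans Swf Sgr (low _ hj') (upp _ hj)).
    - by rewrite hj'; right; apply: upp.
    - exact: (elimT (int_complexP _ _ _ _ _ _) B1).
  split.
  - apply/subintP; split=> //; apply: (int_complex_complex k Swf Sgr x s).1 FAD _; exact: subsetUr.
  - by apply/subintP.
  - rewrite disjoint_subset; apply/subsetP => j jF; rewrite inE; apply/negP => jA.
    have [e|ne] := eqVneq j i.
      have [|l _] := b1 i; last by apply: (path_lt_irr Swf Sgr l).
      by rewrite -e !inE jA e (ilt_irr k Swf Sgr).
    have jA' : j \in A :&: X by rewrite !inE jA itop.
    have jF' : j \in F :\ i by rewrite !inE ne jF.
    by rewrite (disjointFr A3 jF') in jA'.
apply: (join_face_exact (N1 := N1) (N2 := N2)) => //.
by rewrite /N1 /N2; lia.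
Qed.

End Links.
End Interval.
End Bridge.

(** * The equivalence *)

Section Main.
Variables (k : fieldType) (V E : finType) (tl hd : E -> V).
Variable S : qpath V E -> qpath V E -> Prop.
Local Notation qp := (qpath V E).
Local Notation is_path := (is_path tl hd).
Local Notation composable := (composable hd).
Local Notation path_lt := (path_lt k tl hd S).
Local Notation okl := (okl tl hd).
Local Notation factor_exact := (factor_exact k tl hd S).
Hypotheses (Swf : S_wf tl hd S) (Sgr : S_graded S) (Hcan : cancellative k tl hd S).
Implicit Types (p q r w : qp) (l : seq qp).

Lemma factor_exact_CM : (forall r n, (n < plen r)%N -> factor_exact r n) -> locally_CM k tl hd S.
Proof.
move=> Hex x y hx hy s Hs F hF m hm.
have CL : scomplex (ilt k tl hd S x (s := s)) (link (int_complex k tl hd S x s) F).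
  by apply: link_complex; apply: (int_complex_complex k Swf Sgr).
apply/(rhom_face_exact k (ilt_irr k Swf Sgr x (s := s)) CL).
(* A face with more than [m] vertices turns the dimension condition into the length inequality that
   [link_face_exact] asks for, and its vertices show that [x] lies below [y]. *)
have [A AL mA] : exists2 A, A \in link (int_complex k tl hd S x s) F & (m < #|A|)%N.
  apply: contrapT => H; move: hm; rewrite ltnNge => /negP; apply.
  apply/bigmax_leqP => A AL; rewrite leqNgt; apply/negP => mA; apply: H.
  by exists A.
have [i iA] : exists i, i \in A by apply/set0Pn; rewrite -card_gt0; lia.
have [xi iy] := z_int Hs i.
have xy : path_lt x y := path_lt_trans Swf Sgr xi iy.
have yy : path_leq k tl hd S y y by left; apply: sim_refl.
change (is_true (F \in int_complex k tl hd S x s)) in hF.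
rewrite -(subint_full Hs); rewrite -(subint_full Hs) in AL hF.
have bA := link_bound Swf Sgr Hcan Hs hx yy xy AL.
apply: (link_face_exact Swf Sgr Hcan Hs Hex hx yy xy hF).
by move: bA mA; lia.
Qed.

(** [locally_CM] speaks of given enumerations, so one is needed to apply it. Lengths are bounded by
    that of [y], which leaves finitely many representatives. *)
Lemma enum_interval_exists x y : exists s, enum_interval k tl hd S x y s.
Proof.
pose s := [seq z <- nfs k tl hd S (plen y) | `[< path_lt x z /\ path_lt z y >]].
exists s; split.
- by move=> z; rewrite mem_filter => /andP [/asboolP].
- move=> i j hi hj ne h; case/negP: ne; rewrite -(nth_uniq x hi hj) ?filter_uniq ?nfs_uniq //.
  have hn w : w \in s -> nf k tl hd S w = w.
    by rewrite mem_filter mem_nfs => /andP [_ /and3P [_ /eqP]].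
  rewrite -(hn (nth x s i)) ?mem_nth // -(hn (nth x s j)) ?mem_nth //.
  by apply/eqP; apply: nf_sim.
- move=> z hz xz zy; have h := sim_nf k S hz; exists (nf k tl hd S z) => //.
  rewrite mem_filter (nf_mem_nfs k Swf Sgr hz (ltnW (path_lt_len Swf Sgr zy))) andbT.
  apply/asboolP; split; first exact: (path_lt_simr Swf Sgr h).
  exact: (path_lt_siml Swf Sgr h).
Qed.

(* The factorization of a path into arrows gives a maximal chain. *)
Lemma arrow_factorization r : is_path r -> (0 < plen r)%N ->
  exists b l, [/\ okl (b :: l), lprod b l = r & size (b :: l) = plen r].
Proof.
case: r => v t; elim/last_ind: t => // t a IH hr _.
have hcat : (v, rcons t a) = pcat (v, t) (tl a, [:: a]) :> qp by rewrite /pcat /= cats1.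
have [t0|t0] := eqVneq t [::].
  exists (v, rcons t a), [::]; rewrite t0 in hr *; split=> //.
  by rewrite okl_cons hr.
move: hr; rewrite is_pathE /= -cats1 walk_cat /= andbT => /andP [wt /eqP ha].
have ht : is_path (v, t) by rewrite is_pathE.
have [c [l [ok e sz]]] : exists b l, [/\ okl (b :: l), lprod b l = (v, t) &
    size (b :: l) = plen ((v, t) : qp)] by apply: IH; rewrite // /plen lt0n size_eq0.
exists (tl a, [:: a]), (c :: l); split.
- rewrite ok andbT is_pathE /= eqxx /=.
  by have [_ <- _] := lprod_ok ok; rewrite e ha.
- by rewrite /= e -hcat cats1.
- by rewrite /= in sz *; rewrite sz /plen /= size_cat addn1.
Qed.

(** The hypothesis is applied to the interval from a trivial path to [r] and to the empty face. The
    factorization into arrows gives a face with [plen r - 1] vertices, so [m.+1 < plen r] puts [m]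
    below the top. *)
Lemma CM_factor_exact : locally_CM k tl hd S ->
  forall r n, is_path r -> (0 < n)%N -> (n < plen r)%N -> factor_exact r n.
Proof.
move=> CM r [//|m] hr _ hm; pose x : qp := (ptail r, [::]).
have hx : is_path x by [].
have [s Hs] := enum_interval_exists x r.
have xr : pcat x r = r by apply: id_pcat.
have cr : composable x r by rewrite /composable.
have r0 : (0 < plen r)%N by lia.
have xx : path_leq k tl hd S x x by left; apply: sim_refl.
have rr : path_leq k tl hd S (pcat x r) r by left; rewrite xr; apply: sim_refl.
apply: (face_exact_factor_exact Swf Sgr Hcan Hs hx xx hr cr r0 rr).
rewrite xr (subint_full Hs).
have CD := int_complex_complex k Swf Sgr x s.
apply/(rhom_face_exact k (ilt_irr k Swf Sgr x (s := s)) CD).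
have [b [l [ok e sz]]] := arrow_factorization hr r0.
have fb : factors k tl hd S r (b :: l) by rewrite /= e; apply: sim_refl.
have [hT cT] := chain_of_factors Swf Sgr Hs hx xx cr rr ok fb.
rewrite xr (subint_full Hs) in hT.
have D0 : set0 \in int_complex k tl hd S x s by apply: CD.1 hT _; apply: sub0set.
have lk : link (int_complex k tl hd S x s) set0 = int_complex k tl hd S x s.
  by apply/setP => A; rewrite linkE set0U -setI_eq0 set0I eqxx andbT andbb.
have := CM x r hx hr s Hs set0 D0 m; rewrite lk; apply.
apply: leq_trans (leq_bigmax_cond _ hT); rewrite cT.
by move: sz hm => /=; lia.
Qed.

Lemma koszul_iff_locally_CM : koszul k tl hd S <-> locally_CM k tl hd S.
Proof.
split=> h.
  apply: factor_exact_CM; apply: (acyc_factor_exact Swf Sgr) => n j.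
  exact: koszul_acyc.
apply: (acyc_koszul Swf Sgr Hcan); apply: (factor_exact_acyc Swf Sgr).
exact: CM_factor_exact.
Qed.

End Main.

Theorem theorem4p3 (k : fieldType) (V E : finType) (tl hd : E -> V)
    (S : qpath V E -> qpath V E -> Prop) :
  S_wf tl hd S -> S_graded S -> cancellative k tl hd S ->
  (koszul k tl hd S <-> locally_CM k tl hd S).
Proof. exact: koszul_iff_locally_CM. Qed.
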